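(* Consider the Shifted Boundary Method (SBM) discretisation of the Stokes problem on a family of meshes indexed by the mesh size $h$, with the spaces $V_h,Q_h$, the forms $a,b_1,b_2$ (built with the polynomial-extrapolation trial extension $\mathbf{u}^F$ and the first-order Taylor test extension $\mathbf{v}^T$), the norms $\|\cdot\|_a,\|\cdot\|_Q$ and the matrices $A,A_s,B_1,B_2,M$ described in the context. Assume: (1) (Well-posed pair.) There are constants $C_a,C_A,\beta,C_b>0$, independent of $h$, such that for all $\mathbf{u}_h,\mathbf{v}_h\in V_h$ and $q_h\in Q_h$ $$a(\mathbf{v}_h,\mathbf{v}_h)\ge C_a\|\mathbf{v}_h\|_a^2,\qquad |a(\mathbf{u}_h,\mathbf{v}_h)|\le C_A\|\mathbf{u}_h\|_a\|\mathbf{v}_h\|_a,$$ $$\inf_{q_h\in Q_h}\sup_{\mathbf{v}_h\in V_h}\frac{b_2(\mathbf{v}_h,q_h)}{\|\mathbf{v}_h\|_a\|q_h\|_Q}\ge\beta,\qquad |b_i(\mathbf{v}_h,q_h)|\le C_b\|\mathbf{v}_h\|_a\|q_h\|_Q\quad(i=1,2).$$ (2) (Geometric resolution.) There are $c_d>0$ and $\zeta>0$, independent of $h$, such that $\|\mathbf{d}(\tilde{\mathbf{x}})\|\le c_d\,h_T\hat h_T^{\zeta}$ for every $\tilde{\mathbf{x}}$ on the surrogate boundary $\Gamma'$, where $T$ is the active element whose face contains $\tilde{\mathbf{x}}$. (3) (Penalty scaling.) There is $c_\alpha>0$, independent of $h$, such that $\alpha\le c_\alpha\,2\mu\,h_T^{-1}$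 on each face of $T$ in $\Gamma'$. Let $$\mathcal{A}=\begin{bmatrix}A & B_1^T \\ B_2 & 0\end{bmatrix},\qquad \mathcal{P}=\begin{bmatrix}A & B_1^T \\ 0 & -M\end{bmatrix},\qquad \mathcal{H}=\operatorname{diag}(A_s^{-1},M^{-1}),$$ with $\langle x,y\rangle_{\mathcal{H}}=y^T\mathcal{H}x$ and $\|y\|_{\mathcal{H}}^2=\langle y,y\rangle_{\mathcal{H}}$. Then there exist $h_0>0$ and constants $0<\gamma\le\Gamma$, with $\gamma,\Gamma$ depending only on $C_a,C_A,\beta,C_b$, such that for all $h\le h_0$ the matrix $\mathcal{P}$ is invertible and $$\gamma\le\frac{\langle\mathcal{A}\mathcal{P}^{-1}y,y\rangle_{\mathcal{H}}}{\langle y,y\rangle_{\mathcal{H}}}\qquad\text{and}\qquad\|\mathcal{A}\mathcal{P}^{-1}y\|_{\mathcal{H}}\le\Gamma\|y\|_{\mathcal{H}}\qquad\text{for all }y\ne0.$$ Consequently, GMRES applied to the right-preconditioned system with matrix $\mathcal{A}\mathcal{P}^{-1}$ in the $\mathcal{H}$-inner product reduces the residual by a factor of at least $(1-\gamma^2/\Gamma^2)^{1/2}$ per iteration, i.e. $\|r_{k+1}\|_{\mathcal{H}}\le(1-\gamma^2/\Gamma^2)^{1/2}\|r_k\|_{\mathcal{H}}$, independently of the mesh size.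
   Context: **Geometry.** $\Omega\subset\mathbb{R}^d$ is a bounded domain covered by a shape-regular family of background meshes of quadrilaterals/hexahedra that need not fit the boundary. The active elements are those lying inside $\Omega$; their union is the surrogate domain $\Omega'$ (also written $\tilde\Omega$). $\Gamma'\subset\partial\Omega'$ is the surrogate boundary: the union of the element faces which replace the embedded Dirichlet boundary $\Gamma_D$; its outward unit normal is $\mathbf{n}'$. Each $\tilde{\mathbf{x}}\in\Gamma'$ is mapped to its closest-point projection on the true boundary, and $\mathbf{d}(\tilde{\mathbf{x}})$ is the vector from $\tilde{\mathbf{x}}$ to that projection. $h_T$ is the diameter of an element $T$, $h=\max_T h_T$, $l(\tilde\Omega)$ is a characteristic length of $\Omega'$ (e.g. its diameter), $\hat h_T=h_T/l(\tilde\Omega)$ (with $\hat h_T\le1$). $\langle\cdot,\cdot\rangle$ without matrix subscript denotes the $L^2(\Gamma')$ inner product. **Spaces and extensions.** $V_h\subset[H^1(\Omega')]^d$ is a space of continuous, elementwise polynomial velocities of fixed degree, $Q_h\subset L^2(\Omega')$ a space of (continuous or discontinuous) elementwise polynomial pressures of fixed degree. For $\tilde{\mathbf{x}}\in\Gamma'$ on a face of the active element $T$, $\mathbf{u}^F(\tilde{\mathbf{x}})=\mathbf{u}|_T(\tilde{\mathbf{x}}+\mathbf{d}(\tilde{\mathbf{x}}))$, where the polynomial $\mathbf{u}|_T$ is continued outside $T$ as a polynomial, and $\mathbf{v}^T=\mathbf{v}+(\nabla\mathbf{v})\mathbf{d}$ on $\Gamma'$, with $(\nabla\mathbf{v})_{ij}=\partial_jv_i$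 taken from $T$. **Forms.** $\mu>0$ is the constant viscosity, $\alpha>0$ the Nitsche penalty. $\boldsymbol{\nabla}_s$ is either the symmetric gradient $\varepsilon(\mathbf{u})=\frac12(\nabla\mathbf{u}+\nabla\mathbf{u}^T)$ or the regular gradient $\frac12\nabla\mathbf{u}$ (the same choice throughout; the result covers both). Then $$a(\mathbf{u},\mathbf{v})=\int_{\Omega'}2\mu\,\boldsymbol{\nabla}_s\mathbf{u}:\nabla\mathbf{v}\,dx-\langle2\mu(\boldsymbol{\nabla}_s\mathbf{u})\mathbf{n}',\mathbf{v}\rangle-\langle2\mu(\boldsymbol{\nabla}_s\mathbf{v})\mathbf{n}',\mathbf{u}^F\rangle+\langle\alpha\,\mathbf{u}^F,\mathbf{v}^T\rangle,$$ $$b_1(\mathbf{v},q)=-\int_{\Omega'}(\nabla\cdot\mathbf{v})q\,dx+\langle\mathbf{n}'\cdot\mathbf{v},q\rangle,\qquad b_2(\mathbf{v},q)=-\int_{\Omega'}(\nabla\cdot\mathbf{v})q\,dx+\langle\mathbf{n}'\cdot\mathbf{v}^F,q\rangle.$$ The discrete problem is: find $[\mathbf{u}_h,p_h]\in V_h\times Q_h$ with $a(\mathbf{u}_h,\mathbf{v}_h)+b_1(\mathbf{v}_h,p_h)+b_2(\mathbf{u}_h,q_h)=\ell(\mathbf{v}_h,q_h)$ for all $[\mathbf{v}_h,q_h]\in V_h\times Q_h$. **Norms.** $\|q\|_Q=\|q/\sqrt{2\mu}\|_{L^2(\Omega')}$. $\|\cdot\|_a$ is the energy norm of the SBM–Stokes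 analysis of Atallah, Canuto and Scovazzi (2020) on $V_h$; it is equivalent (not necessarily uniformly in $h$) to the $H^1$-norm on $V_h$ and has the viscous seminorm and the Taylor-extended trace among its constituents: for all $\mathbf{v}\in V_h$, $\sqrt{2\mu}\,\|\varepsilon(\mathbf{v})\|_{L^2(\Omega')}\le\|\mathbf{v}\|_a$ (in the regular-gradient case $\sqrt{2\mu}\,\|\nabla\mathbf{v}\|_{L^2(\Omega')}\le\|\mathbf{v}\|_a$) and $\|(2\mu/h_T)^{1/2}\mathbf{v}^T\|_{L^2(\Gamma')}\le\|\mathbf{v}\|_a$, with $h_T$ taken facewise. **Matrices.** Identifying functions with coefficient vectors in fixed bases: $\mathbf{v}^TA\mathbf{u}=a(\mathbf{u},\mathbf{v})$, $q^TB_i\mathbf{v}=b_i(\mathbf{v},q)$ for $i=1,2$, $A_s=\frac12(A+A^T)$, and $M$ is the pressure mass matrix, i.e. the Gram matrix of $\|\cdot\|_Q$. Here superscript $T$ on matrices and coefficient vectors is the transpose. *)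

(* Defs.v *)
From HB Require Import structures.
From mathcomp Require Import all_boot all_order all_algebra.
From mathcomp Require Import all_classical all_reals all_analysis.
(* Importing the notations of mpoly would clash with those of all_analysis. *)
From mathcomp Require Import (canonicals, coercions) mpoly.

Set Implicit Arguments.
Unset Strict Implicit.
Unset Printing Implicit Defensive.

Import Order.TTheory GRing.Theory Num.Theory.
Import numFieldNormedType.Exports.

Local Open Scope classical_set_scope.
Local Open Scope ring_scope.

Section LebesgueTuple.
Context (R : realType).
Local Notation RB := (measurableTypeR R).

Definition tcons n (z : n.-tuple RB * RB) : n.+1.-tuple RB :=
  [the n.+1.-tuple RB of z.2 :: z.1].

Lemma measurable_tcons n : measurable_fun setT (@tcons n).
Proof. by apply: measurable_cons; [exact: measurable_snd|exact: measurable_fst]. Qed.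

Definition lebesgue_tupleS n (mu : {measure set (n.-tuple RB) -> \bar R}) :
  {measure set (n.+1.-tuple RB) -> \bar R}.
Proof.
unshelve refine
  [the measure _ _ of pushforward (mu \x @lebesgue_measure R)%E (@tcons n)].
exact: measurable_tcons.
Defined.

(* The Lebesgue measure on R^n. *)
Fixpoint lebesgue_tuple n : {measure set (n.-tuple RB) -> \bar R} :=
  match n with
  | 0 => [the measure _ _ of \d_([tuple] : 0.-tuple RB)]
  | m.+1 => lebesgue_tupleS (lebesgue_tuple m)
  end.

Lemma lebesgue_tupleSE n (A : set (n.+1.-tuple RB)) :
  lebesgue_tuple n.+1 A =
  (lebesgue_tuple n \x @lebesgue_measure R)%E (@tcons n @^-1` A).
Proof. by []. Qed.

End LebesgueTuple.

Section Euclid.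
Context (R : realType).

(* The library's norm on row vectors is the sup norm. *)
Definition dotv n (x y : 'rV[R]_n) : R := \sum_i x 0 i * y 0 i.
Definition enorm n (x : 'rV[R]_n) : R := Num.sqrt (dotv x x).

Definition frob m n (A B : 'M[R]_(m, n)) : R := \sum_i \sum_j A i j * B i j.

Definition diam n (X : set 'rV[R]_n) : R :=
  sup [set enorm (z.1 - z.2) | z in X `*` X].

Definition bdry n (X : set 'rV[R]_n) : set 'rV[R]_n := closure X `\` interior X.

Definition cube n : set 'rV[R]_n := [set x | forall i, 0 <= x 0 i <= 1].

Definition tuple_row n (t : n.-tuple (measurableTypeR R)) : 'rV[R]_n :=
  \row_i tnth t i.

Definition int_on n (X : set 'rV[R]_n) (f : 'rV[R]_n -> R) : R :=
  \int[lebesgue_tuple R n]_(t in [set t | X (tuple_row t)]) f (tuple_row t).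

(* The multilinear map sending the vertex 1_b of the unit cube to V b: bilinear
   for quadrilaterals, trilinear for hexahedra. *)
Definition multilinear n (V : {set 'I_n} -> 'rV[R]_n) (x : 'rV[R]_n) :
  'rV[R]_n :=
  \sum_(b : {set 'I_n})
    (\prod_i (if i \in b then x 0 i else 1 - x 0 i)) *: V b.

(* y |-> the point of the facet {x_i = s} of the unit cube with the remaining
   coordinates y. *)
Definition facet_point n (i : 'I_n) (s : bool) (y : 'rV[R]_n.-1) : 'rV[R]_n :=
  \row_j (if unlift i j is Some k then y 0 k else s%:R).

End Euclid.

Section Polynomials.
Context (R : realType) (d : nat).
Local Notation poly := (mpoly.mpoly d R).

Definition pval (p : poly) (x : 'rV[R]_d) : R := mpoly.meval (fun i => x 0 i) p.

Definition vval (v : 'I_d -> poly) (x : 'rV[R]_d) : 'rV[R]_d :=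
  \row_i pval (v i) x.

Definition vgrad (v : 'I_d -> poly) (x : 'rV[R]_d) : 'M[R]_d :=
  \matrix_(i, j) pval (mpoly.mderiv j (v i)) x.

Definition vdiv (v : 'I_d -> poly) (x : 'rV[R]_d) : R := \tr (vgrad v x).

Definition vsymgrad (v : 'I_d -> poly) (x : 'rV[R]_d) : 'M[R]_d :=
  2^-1 *: (vgrad v x + (vgrad v x)^T).

(* [sym] selects the symmetric gradient; otherwise half the full gradient. *)
Definition nabla_s (sym : bool) (v : 'I_d -> poly) (x : 'rV[R]_d) : 'M[R]_d :=
  if sym then vsymgrad v x else 2^-1 *: vgrad v x.

(* Polynomial extrapolation v^F and first-order Taylor extension v^T, for the
   shift vector field dv. *)
Definition vextF (dv : 'rV[R]_d -> 'rV[R]_d) (v : 'I_d -> poly) x : 'rV[R]_d :=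
  vval v (x + dv x).
Definition vextT (dv : 'rV[R]_d -> 'rV[R]_d) (v : 'I_d -> poly) x : 'rV[R]_d :=
  vval v x + dv x *m (vgrad v x)^T.

End Polynomials.

(* One member of the family: a background mesh with the data of the discrete
   problem.  A facet (T, (i, s)) is the image of the facet {x_i = s} of the
   reference cube.  Elementwise polynomial functions are families of
   polynomials indexed by the elements, so that their continuation outside an
   element is evaluation; only their values at active elements are used. *)
Record sbm (R : realType) (d : nat) := SBM {
  cell : finType;
  vertex : cell -> {set 'I_d} -> 'rV[R]_d;
  gamma' : {set cell * ('I_d * bool)};     (* the facets making up Gamma' *)
  shift : 'rV[R]_d -> 'rV[R]_d;            (* the vector field d on Gamma' *)
  charlen : R;                             (* l(Omega') *)
  alpha : cell * ('I_d * bool) -> R;       (* Nitsche penalty, facetwise *)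
  nV : nat;
  phi : 'I_nV -> cell -> 'I_d -> mpoly.mpoly d R;  (* basis of V_h *)
  nQ : nat;
  psi : 'I_nQ -> cell -> mpoly.mpoly d R;          (* basis of Q_h *)
  norma : 'cV[R]_nV -> R                   (* ||.||_a, on coefficient vectors *)
}.

Section Discretisation.
Context (R : realType) (d : nat) (Omega : set 'rV[R]_d).
Context (mu : R) (sym : bool) (S : sbm R d).
Local Notation poly := (mpoly.mpoly d R).
Local Notation cell := (cell S).
Local Notation facet := (cell * ('I_d * bool))%type.
Local Notation velocity := (cell -> 'I_d -> poly).
Local Notation pressure := (cell -> poly).

Definition refmap (T : cell) : 'rV[R]_d -> 'rV[R]_d := multilinear (vertex T).

Definition elem (T : cell) : set 'rV[R]_d := refmap T @` @cube R d.

(* Elements are closed sets: those fitted to the boundary count as lying inside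
   Omega. *)
Definition active (T : cell) : bool := `[< interior (elem T) `<=` Omega >].

Definition surrogate : set 'rV[R]_d := \bigcup_(T in [set T | active T]) elem T.

Definition diam_elem (T : cell) : R := diam (elem T).

Definition meshsize : R := \big[Num.max/0]_(T : cell) diam_elem T.

Definition facet_param (F : facet) (y : 'rV[R]_d.-1) : 'rV[R]_d :=
  refmap F.1 (facet_point F.2.1 F.2.2 y).

Definition facet_set (F : facet) : set 'rV[R]_d := facet_param F @` @cube R d.-1.

(* The library's jacobian acts on row vectors from the right, hence it is the
   transpose of DF.  The tangent vectors of a facet are its rows other than the
   i-th one, and the outward unit normal is DF^{-T} n^ / |DF^{-T} n^|, with
   n^ = +-e_i the outward normal of the reference facet. *)
Definition facet_jac (F : facet) (y : 'rV[R]_d.-1) : 'M[R]_d :=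
  jacobian (refmap F.1) (facet_point F.2.1 F.2.2 y).

Definition facet_area (F : facet) (y : 'rV[R]_d.-1) : R :=
  let t := row' F.2.1 (facet_jac F y) in Num.sqrt (\det (t *m t^T)).

Definition facet_normal (F : facet) (y : 'rV[R]_d.-1) : 'rV[R]_d :=
  let nhat := (if F.2.2 then 1 else -1) *: delta_mx 0 F.2.1 : 'rV[R]_d in
  let nu := nhat *m (invmx (facet_jac F y))^T in
  (enorm nu)^-1 *: nu.

(* Integrals over Omega' and Gamma' of elementwise (resp. facetwise) defined
   integrands; the latter take the point and the normal n' as arguments. *)
Definition int_Omega' (f : cell -> 'rV[R]_d -> R) : R :=
  \sum_(T | active T) int_on (elem T) (f T).

Definition int_Gamma' (g : facet -> 'rV[R]_d -> 'rV[R]_d -> R) : R :=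
  \sum_(F in gamma' S)
    int_on (@cube R d.-1)
      (fun y => g F (facet_param F y) (facet_normal F y) * facet_area F y).

Definition form_a (u v : velocity) : R :=
  int_Omega' (fun T x => 2 * mu * frob (nabla_s sym (u T) x) (vgrad (v T) x))
  - int_Gamma' (fun F x n =>
      dotv (2 * mu *: (n *m (nabla_s sym (u F.1) x)^T)) (vval (v F.1) x))
  - int_Gamma' (fun F x n =>
      dotv (2 * mu *: (n *m (nabla_s sym (v F.1) x)^T))
           (vextF (shift S) (u F.1) x))
  + int_Gamma' (fun F x _ =>
      alpha F * dotv (vextF (shift S) (u F.1) x) (vextT (shift S) (v F.1) x)).

Definition form_b1 (v : velocity) (q : pressure) : R :=
  - int_Omega' (fun T x => vdiv (v T) x * pval (q T) x)
  + int_Gamma' (fun F x n => dotv n (vval (v F.1) x) * pval (q F.1) x).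

Definition form_b2 (v : velocity) (q : pressure) : R :=
  - int_Omega' (fun T x => vdiv (v T) x * pval (q T) x)
  + int_Gamma' (fun F x n =>
      dotv n (vextF (shift S) (v F.1) x) * pval (q F.1) x).

Definition ipQ (p q : pressure) : R :=
  int_Omega' (fun T x => (pval (p T) x / Num.sqrt (2 * mu)) *
                         (pval (q T) x / Num.sqrt (2 * mu))).

Definition normQ (q : pressure) : R := Num.sqrt (ipQ q q).

Definition normH1 (v : velocity) : R :=
  Num.sqrt (int_Omega' (fun T x => dotv (vval (v T) x) (vval (v T) x)
                                   + frob (vgrad (v T) x) (vgrad (v T) x))).

Definition visc_seminorm (v : velocity) : R :=
  let G T x := if sym then vsymgrad (v T) x else vgrad (v T) x in
  Num.sqrt (2 * mu) * Num.sqrt (int_Omega' (fun T x => frob (G T x) (G T x))).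

Definition taylor_trace (v : velocity) : R :=
  Num.sqrt (int_Gamma' (fun F x _ =>
    let w := Num.sqrt (2 * mu / diam_elem F.1) *: vextT (shift S) (v F.1) x in
    dotv w w)).

Definition vel (c : 'cV[R]_(nV S)) : velocity :=
  fun T j => \sum_i c i 0 *: phi i T j.

Definition pres (c : 'cV[R]_(nQ S)) : pressure :=
  fun T => \sum_i c i 0 *: psi i T.

(* Elements are nondegenerate images of the cube; the last bounds say that
   |DF| <= sigma h_T and |DF^{-1}| <= sigma / h_T on the whole cube. *)
Definition shape_regular (sigma : R) : Prop :=
  forall T : cell,
    {in @cube R d &, injective (refmap T)} /\
    forall x, cube x -> forall xi : 'rV[R]_d,
      enorm (xi *m jacobian (refmap T) x) <= sigma * diam_elem T * enorm xi /\
      diam_elem T * enorm xi <= sigma * enorm (xi *m jacobian (refmap T) x).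

Definition background_mesh (sigma : R) : Prop :=
  [/\ Omega `<=` \bigcup_T elem T,
      forall T T' : cell, T != T' ->
        interior (elem T) `&` interior (elem T') = set0
    & shape_regular sigma].

(* Gamma' consists of facets of active elements on the boundary of Omega', and
   x + d(x) is a closest point to x of the true Dirichlet boundary GammaD,
   chosen measurably. *)
Definition surrogate_boundary (GammaD : set 'rV[R]_d) : Prop :=
  forall F, F \in gamma' S ->
    [/\ active F.1, facet_set F `<=` bdry surrogate,
        forall x, facet_set F x ->
          GammaD (x + shift S x) /\
          forall z, GammaD z -> enorm (shift S x) <= enorm (z - x)
      & forall j : 'I_d, measurable_fun
          [set t : (d.-1).-tuple (measurableTypeR R) | cube (tuple_row t)]
          (fun t => shift S (facet_param F (tuple_row t)) 0 j)].

(* l(Omega') is comparable to the diameter of Omega', and h^_T <= 1. *)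
Definition characteristic_length (cl Cl : R) : Prop :=
  cl * diam surrogate <= charlen S <= Cl * diam surrogate /\
  forall T, active T -> diam_elem T <= charlen S.

Definition velocity_space (kV : nat) : Prop :=
  [/\ forall i T j, active T -> (mpoly.msize (@phi R d S i T j) <= kV.+1)%N,
      forall i T T', active T -> active T' -> forall x, elem T x -> elem T' x ->
        vval (@phi R d S i T) x = vval (@phi R d S i T') x
    & forall c, (forall T, active T -> forall j, vel c T j = 0) -> c = 0].

Definition pressure_space (kQ : nat) : Prop :=
  (forall i T, active T -> (mpoly.msize (@psi R d S i T) <= kQ.+1)%N) /\
  forall c, (forall T, active T -> pres c T = 0) -> c = 0.

Definition energy_norm : Prop :=
  [/\ [/\ forall v w, @norma R d S (v + w) <= norma v + norma w,
          forall (t : R) v, @norma R d S (t *: v) = `|t| * norma v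
        & forall v, @norma R d S v = 0 -> v = 0],
      exists c C : R, [/\ 0 < c, 0 < C
        & forall v, c * normH1 (vel v) <= norma v <= C * normH1 (vel v)],
      forall v, visc_seminorm (vel v) <= norma v
    & forall v, taylor_trace (vel v) <= norma v].

Definition well_posed (Ca CA beta Cb : R) : Prop :=
  [/\ forall v, Ca * norma v ^+ 2 <= form_a (vel v) (vel v),
      forall u v, `|form_a (vel u) (vel v)| <= CA * norma u * norma v,
      (beta%:E <= ereal_inf
         [set ereal_sup
            [set (form_b2 (vel v) (pres q) / (norma v * normQ (pres q)))%:E
            | v in [set v | v != 0%R]]
         | q in [set q | q != 0%R]])%E
    & forall v q,
        `|form_b1 (vel v) (pres q)| <= Cb * norma v * normQ (pres q) /\
        `|form_b2 (vel v) (pres q)| <= Cb * norma v * normQ (pres q)].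

Definition geometric_resolution (cd zeta : R) : Prop :=
  forall F, F \in gamma' S -> forall x, facet_set F x ->
    enorm (shift S x) <=
      cd * diam_elem F.1 * (diam_elem F.1 / charlen S) `^ zeta.

Definition penalty_scaling (calpha : R) : Prop :=
  forall F, F \in gamma' S -> alpha F <= calpha * (2 * mu) * (diam_elem F.1)^-1.

Definition mxA : 'M[R]_(nV S) := \matrix_(i, j) form_a (@phi R d S j) (phi i).
Definition mxAs : 'M[R]_(nV S) := 2^-1 *: (mxA + mxA^T).
Definition mxB1 : 'M[R]_(nQ S, nV S) :=
  \matrix_(i, j) form_b1 (@phi R d S j) (@psi R d S i).
Definition mxB2 : 'M[R]_(nQ S, nV S) :=
  \matrix_(i, j) form_b2 (@phi R d S j) (@psi R d S i).
Definition mxM : 'M[R]_(nQ S) := \matrix_(i, j) ipQ (@psi R d S j) (psi i).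

Definition saddle_mx : 'M[R]_(nV S + nQ S) := block_mx mxA mxB1^T mxB2 0.
Definition precond_mx : 'M[R]_(nV S + nQ S) := block_mx mxA mxB1^T 0 (- mxM).
Definition weight_mx : 'M[R]_(nV S + nQ S) :=
  block_mx (invmx mxAs) 0 0 (invmx mxM).

End Discretisation.

Section GMRES.
Context (R : realType) (n : nat) (H K : 'M[R]_n).

Definition ipH (x y : 'cV[R]_n) : R := (y^T *m H *m x) 0 0.
Definition normH (y : 'cV[R]_n) : R := Num.sqrt (ipH y y).

Definition krylov_affine (b y0 : 'cV[R]_n) (k : nat) : set 'cV[R]_n :=
  [set y | exists c : 'I_k -> R,
     y = y0 + \sum_j c j *: iter j (mulmx K) (b - K *m y0)].

(* y is the k-th GMRES iterate for K y = b in the H-inner product, from the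
   initial guess y0. *)
Definition gmres_iterate (b y0 : 'cV[R]_n) (k : nat) (y : 'cV[R]_n) : Prop :=
  krylov_affine b y0 k y /\
  forall z, krylov_affine b y0 k z -> normH (b - K *m y) <= normH (b - K *m z).

End GMRES.

(* Main.v *)
Require Import Defs.
From HB Require Import structures.
From mathcomp Require Import all_boot all_order all_algebra.
From mathcomp Require Import all_classical all_reals all_analysis.
From mathcomp Require Import (canonicals, coercions) mpoly.
From mathcomp Require Import measurable_realfun.
From mathcomp Require Import ring lra.

Set Implicit Arguments.
Unset Strict Implicit.
Unset Printing Implicit Defensive.

Import Order.TTheory GRing.Theory Num.Theory.
Import numFieldNormedType.Exports.

Local Open Scope classical_set_scope.
Local Open Scope ring_scope.

(** Write a residual as y = (As x, M q).  The preconditioner P contains the exact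
    off-diagonal block, so K = A P^-1 is block lower triangular, and its quadratic
    form in the weighted inner product is a(x, x) + z^T As x + b1(z, q), where z
    represents b2(-, q) in the form a, that is a(v, z) = b2(v, q) for all v.  If b1
    and b2 were equal, then b1(z, q) = a(z, z), Young's inequality would absorb the
    mixed term, and the inf-sup condition would bound q by z.  A discrepancy with
    |b1 - b2|(v, q) <= (beta Ca / 4 CA) |v|_a |q|_Q costs only half of this gain
    (saddle_fov); the upper bound is continuity (saddle_bounded).  The matrix M is
    definite because the inf-sup condition excludes pressures of norm zero
    (normQ_gt0).  GMRES is at least as good as one step of fixed length along the
    residual, which contracts by the stated factor (gmres_contraction).

    What remains is that the discrepancy, the integral of n' . (v^F - v) q over
    Gamma', is small on fine meshes (consistency_small).  The difference v^F - v is
    about the shift times the gradient of v, but the energy norm sees only the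
    symmetric gradient, and a global Korn inequality with a constant uniform in the
    mesh is not at hand.  Korn's inequality is used on each element instead: v is
    an infinitesimal rigid motion plus a remainder that the strain controls
    (korn_coef).  The skew matrix W of the rigid motion is controlled by the values
    of the motion on the facet (spin_facet_control); these agree with the Taylor
    trace v^T, which is part of the energy norm, up to the remainder and W times
    the shift, and the latter is absorbed when the shift is small relative to the
    element.  Each facet then contributes at most a constant times tau times the
    local energy norm of v and the local norm of q (facet_consistency), where tau
    is the power zeta of the relative element size; and tau tends to zero because
    the surrogate domain contains two points at a fixed distance
    (surrogate_wide).

    The constants are uniform because every quantity is expressed by polynomial
    coefficients in the coordinates of a box of side proportional to the element
    diameter that is contained in the element.  Such a box exists by a quantitative
    inverse function theorem for the multilinear reference map (mel_box), and the
    mean square over the box bounds the coefficients (coef_box_bound).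

    The matrices represent the forms because all integrands are bounded and
    measurable, on elements that are measurable sets (mel_measurable). *)

(** * Block preconditioning of a perturbed saddle-point matrix *)

Section BilinearForm.
Context (R : realType).

Definition bil m n (B : 'M[R]_(m, n)) (v : 'cV[R]_n) (q : 'cV[R]_m) : R :=
  (q^T *m B *m v) 0 0.

Lemma bilDl m n (B : 'M[R]_(m, n)) u v q : bil B (u + v) q = bil B u q + bil B v q.
Proof. by rewrite /bil mulmxDr mxE. Qed.
Lemma bilDr m n (B : 'M[R]_(m, n)) u p q : bil B u (p + q) = bil B u p + bil B u q.
Proof. by rewrite /bil linearD/= !mulmxDl mxE. Qed.
Lemma bilNl m n (B : 'M[R]_(m, n)) u q : bil B (- u) q = - bil B u q.
Proof. by rewrite /bil mulmxN mxE. Qed.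
Lemma bilNr m n (B : 'M[R]_(m, n)) u q : bil B u (- q) = - bil B u q.
Proof. by rewrite /bil linearN/= !mulNmx mxE. Qed.
Lemma bilZl m n (B : 'M[R]_(m, n)) t u q : bil B (t *: u) q = t * bil B u q.
Proof. by rewrite /bil -scalemxAr mxE. Qed.
Lemma bilZr m n (B : 'M[R]_(m, n)) t u q : bil B u (t *: q) = t * bil B u q.
Proof. by rewrite /bil linearZ/= -!scalemxAl mxE. Qed.
Lemma bil0l m n (B : 'M[R]_(m, n)) q : bil B 0 q = 0.
Proof. by rewrite /bil mulmx0 mxE. Qed.
Lemma bil_tr m n (B : 'M[R]_(m, n)) u q : bil B^T u q = bil B q u.
Proof.
rewrite /bil -[in LHS](trmxK (q^T *m B^T *m u)) mxE.
by rewrite !trmx_mul !trmxK mulmxA.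
Qed.
Lemma bilDm m n (B C : 'M[R]_(m, n)) u q : bil (B + C) u q = bil B u q + bil C u q.
Proof. by rewrite /bil mulmxDr mulmxDl mxE. Qed.
Lemma bilZm m n t (B : 'M[R]_(m, n)) u q : bil (t *: B) u q = t * bil B u q.
Proof. by rewrite /bil -scalemxAr -scalemxAl mxE. Qed.

Definition bilDE := (bilDl, bilDr, bilNl, bilNr).

Lemma bilE m n (B : 'M[R]_(m, n)) v q :
  bil B v q = \sum_i \sum_j q i 0 * v j 0 * B i j.
Proof.
rewrite /bil mxE exchange_big/=; apply: eq_bigr => j _.
rewrite mxE big_distrl/=; apply: eq_bigr => i _; rewrite mxE; ring.
Qed.

Definition posdef n (B : 'M[R]_n) := forall v, v != 0 -> 0 < bil B v v.

Lemma posdef_ge0 n (B : 'M[R]_n) v : posdef B -> 0 <= bil B v v.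
Proof. by case: (eqVneq v 0) => [->|v0 /(_ _ v0)/ltW//]; rewrite bil0l. Qed.

Lemma posdef_unit n (B : 'M[R]_n) : posdef B -> B \in unitmx.
Proof.
move=> Bp; rewrite -unitmx_tr unitmxE unitfE; apply/det0P => -[v v0 vB].
have := Bp v^T; rewrite trmx_eq0 => /(_ v0).
by rewrite -bil_tr /bil trmxK vB mul0mx mxE ltxx.
Qed.

Lemma posdef_bil_ge n (B : 'M[R]_n) x z : B^T = B -> posdef B ->
  - (bil B x x + bil B z z) / 2 <= bil B x z.
Proof.
move=> Bs Bp; have := posdef_ge0 (x + z) Bp.
rewrite !bilDE -[bil B z x]bil_tr Bs; lra.
Qed.

Lemma posdef_bil_le n (B : 'M[R]_n) x z : B^T = B -> posdef B ->
  bil B x z <= (bil B x x + bil B z z) / 2.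
Proof.
move=> Bs Bp; have := posdef_bil_ge (- x) z Bs Bp; rewrite !bilDE; lra.
Qed.

End BilinearForm.

Section SaddlePoint.
Context (R : realType) (n m : nat).
Variables (A : 'M[R]_n) (B1 B2 : 'M[R]_(m, n)) (M : 'M[R]_m) (N : 'cV[R]_n -> R).
Variables (Ca CA beta Cb : R).
Hypotheses (Ca0 : 0 < Ca) (CA0 : 0 < CA) (beta0 : 0 < beta) (Cb0 : 0 < Cb).
Hypotheses (N0 : forall v, 0 <= N v) (NP : forall v, v != 0 -> 0 < N v)
  (ND : forall v w, N (v + w) <= N v + N w).
Hypotheses (Acoer : forall v, Ca * N v ^+ 2 <= bil A v v)
  (Acont : forall u v, bil A u v <= CA * N u * N v).
Hypotheses (Msym : M^T = M) (Mpos : posdef M).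
Let Q q := Num.sqrt (bil M q q).
Hypothesis infsup : forall q t, 0 <= t ->
  (forall v, bil B2 v q <= t * N v) -> beta * Q q <= t.
Hypotheses (B1cont : forall v q, bil B1 v q <= Cb * N v * Q q)
  (B2cont : forall v q, bil B2 v q <= Cb * N v * Q q).
Hypothesis B12 : forall v q,
  bil B1 v q - bil B2 v q >= - (beta * Ca / (4 * CA)) * N v * Q q.

Let As := 2^-1 *: (A + A^T).
Let H : 'M[R]_(n + m) := block_mx (invmx As) 0 0 (invmx M).
Let P : 'M[R]_(n + m) := block_mx A B1^T 0 (- M).
Let K := block_mx A B1^T B2 0 *m invmx P.

Let AsE v : bil As v v = bil A v v.
Proof. by rewrite bilZm bilDm bil_tr; field. Qed.

Let Apos : posdef A.
Proof.
by move=> v v0; apply: lt_le_trans (Acoer v); rewrite mulr_gt0// exprn_gt0// NP.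
Qed.

Let Aspos : posdef As.
Proof. by move=> v v0; rewrite AsE Apos. Qed.

Let Assym : As^T = As.
Proof. by rewrite linearZ/= linearD/= trmxK addrC. Qed.

Let Au : A \in unitmx. Proof. exact: posdef_unit. Qed.
Let Asu : As \in unitmx. Proof. exact: posdef_unit. Qed.
Let Mu : M \in unitmx. Proof. exact: posdef_unit. Qed.

Lemma saddle_precond_unit : P \in unitmx.
Proof.
rewrite unitmxE det_ublock unitrM -!unitmxE Au/=.
by rewrite -scaleN1r unitmxZ ?unitrN1 ?Mu.
Qed.

(** Right preconditioning with the exact upper triangular factor leaves a lower
    triangular operator: the first component of the residual is fixed, the
    second one goes through the Schur complement. *)
Lemma saddle_precondE (x : 'cV[R]_n) (q : 'cV[R]_m) :
  K *m col_mx (As *m x) (M *m q) =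
  col_mx (As *m x) (B2 *m (invmx A *m (As *m x) + invmx A *m (B1^T *m q))).
Proof.
set u := invmx A *m (As *m x) + _.
have AuE : A *m u = As *m x + B1^T *m q by rewrite mulmxDr !mulKVmx.
have -> : col_mx (As *m x) (M *m q) = P *m col_mx u (- q).
  by rewrite mul_block_col AuE mul0mx add0r !(mulmxN, mulNmx, opprK) addrK.
rewrite /K -mulmxA mulKmx ?saddle_precond_unit// mul_block_col AuE.
by rewrite mulmxN addrK mul0mx addr0.
Qed.

Let ipHE (x x' : 'cV[R]_n) (q q' : 'cV[R]_m) :
  ipH H (col_mx (As *m x) (M *m q)) (col_mx (As *m x') q') =
  bil As x x' + bil 1%:M q q'.
Proof.
rewrite /ipH tr_col_mx mul_row_block mul_row_col !mulmx0 addr0 add0r mxE /bil.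
rewrite mulmx1 -!mulmxA !mulKmx// trmx_mul Assym -mulmxA.
by rewrite mulmxA.
Qed.

Let bilMM q : bil 1%:M q (M *m q) = bil M q q.
Proof. by rewrite /bil trmx_mul mulmx1 Msym. Qed.

Let col_mxE (y : 'cV[R]_(n + m)) :
  y = col_mx (As *m (invmx As *m usubmx y)) (M *m (invmx M *m dsubmx y)).
Proof. by rewrite !mulKVmx// vsubmxK. Qed.

Let QE q : Q q ^+ 2 = bil M q q.
Proof. by rewrite sqr_sqrtr// posdef_ge0. Qed.

Let Q0 q : 0 <= Q q. Proof. exact: sqrtr_ge0. Qed.

Lemma saddle_ipH_gt0 y : y != 0 -> 0 < ipH H y y.
Proof.
rewrite (col_mxE y); set x := invmx As *m _; set q := invmx M *m _ => y0.
have -> : ipH H (col_mx (As *m x) (M *m q)) (col_mx (As *m x) (M *m q)) =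
    bil As x x + bil M q q.
  by rewrite ipHE bilMM.
have [x0|x0] := eqVneq x 0; last by rewrite ltr_pwDl ?posdef_ge0 ?Aspos.
rewrite x0 bil0l add0r Mpos//; apply: contraNneq y0 => ->.
by rewrite x0 !mulmx0 col_mx0.
Qed.

Definition fov_lower : R := Num.min (2^-1) (Ca * beta ^+ 2 / (4 * CA ^+ 2)).
Definition fov_upper : R := 1 + 2 * Cb ^+ 2 / Ca + 2 * Cb ^+ 4 / Ca ^+ 2.

Let ipHyy (x : 'cV[R]_n) (q : 'cV[R]_m) :
  ipH H (col_mx (As *m x) (M *m q)) (col_mx (As *m x) (M *m q)) =
  bil A x x + Q q ^+ 2.
Proof. by rewrite ipHE AsE QE bilMM. Qed.

(** With z = A^-T B2^T q, the Schur complement term is b1(z, q), which differs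
    from a(z, z) = b2(z, q) only by the discrepancy of the two forms; this works
    without symmetry of A because the same z also represents the off-diagonal
    block, so that Young's inequality absorbs it. *)
Lemma saddle_fov y : fov_lower * ipH H y y <= ipH H (K *m y) y.
Proof.
rewrite (col_mxE y); set x := invmx As *m _; set q := invmx M *m _.
rewrite saddle_precondE ipHyy.
set u := _ + invmx A *m _.
pose z := (invmx A)^T *m (B2^T *m q).
have bz v : bil A v z = bil B2 v q.
  rewrite /bil trmx_mul trmxK trmx_mul trmxK.
  by rewrite -(mulmxA _ (invmx A)) mulVmx ?mulmx1.
have bu : bil B2 u q = bil As x z + bil B1 z q.
  rewrite -bz -(bil_tr B1) /bil -!mulmxA [A *m u]mulmxDr !mulKVmx//.
  by rewrite mulmxDr mxE.
have -> : ipH H (col_mx (As *m x) (B2 *m u)) (col_mx (As *m x) (M *m q)) =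
    bil A x x + bil B2 u q.
  rewrite -[B2 *m u](mulKVmx Mu) ipHE AsE; congr (_ + _).
  by rewrite /bil mulmx1 trmx_mul Msym -!mulmxA mulKVmx.
have hz := Acoer z.
have hq : beta * Q q <= CA * N z.
  apply: infsup => [|v]; first by rewrite mulr_ge0// ltW.
  by rewrite -bz (le_trans (Acont _ _))// mulrAC.
have hzz := bz z.
have h12 := B12 z q.
have hY := posdef_bil_ge x z Assym Aspos; rewrite !AsE in hY.
have Nz := N0 z; have Qq := Q0 q.
(* the constant in B12 makes the discrepancy cost half of the gain Ca N(z)^2 / 2
   that Young's inequality leaves *)
have h3 : beta * Ca / (4 * CA) * N z * Q q <= Ca / 4 * N z ^+ 2.
  have -> : beta * Ca / (4 * CA) * N z * Q q =
            (Ca / (4 * CA) * N z) * (beta * Q q) by field; rewrite gt_eqF.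
  have -> : Ca / 4 * N z ^+ 2 = (Ca / (4 * CA) * N z) * (CA * N z).
    by field; rewrite gt_eqF.
  by rewrite ler_wpM2l// mulr_ge0// divr_ge0// ?mulr_ge0// ltW.
have h4 : Ca * beta ^+ 2 / (4 * CA ^+ 2) * Q q ^+ 2 <= Ca / 4 * N z ^+ 2.
  have -> : Ca * beta ^+ 2 / (4 * CA ^+ 2) * Q q ^+ 2 =
            Ca / 4 / CA ^+ 2 * (beta * Q q) ^+ 2 by field; rewrite gt_eqF.
  have -> : Ca / 4 * N z ^+ 2 = Ca / 4 / CA ^+ 2 * (CA * N z) ^+ 2.
    by field; rewrite gt_eqF.
  apply: ler_wpM2l; first by rewrite !divr_ge0 ?sqr_ge0// ltW.
  by rewrite ler_sqr// nnegrE mulr_ge0// ltW.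
have hx : 0 <= bil A x x by exact: posdef_ge0.
have g1 : fov_lower * bil A x x <= 2^-1 * bil A x x.
  by rewrite ler_wpM2r// /fov_lower ge_min lexx.
have g2 : fov_lower * Q q ^+ 2 <= Ca * beta ^+ 2 / (4 * CA ^+ 2) * Q q ^+ 2.
  by rewrite ler_wpM2r// ?exprn_ge0// /fov_lower ge_min lexx orbT.
lra.
Qed.

(** The second component of K y is B2 (u1 + w), where u1 and w solve problems
    coercive with constant Ca; its dual norm is at most Cb times the norm of
    u1 + w. *)
Lemma saddle_bounded y : normH H (K *m y) <= fov_upper * normH H y.
Proof.
have G1 : 1 <= fov_upper.
  rewrite /fov_upper -addrA lerDl addr_ge0// divr_ge0 ?mulr_ge0 ?exprn_ge0 ?ltW//.
have G0 : 0 <= fov_upper by lra.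
rewrite /normH; have -> : fov_upper = Num.sqrt (fov_upper ^+ 2).
  by rewrite sqrtr_sqr ger0_norm.
rewrite -sqrtrM ?sqr_ge0// ler_wsqrtr//.
rewrite (col_mxE y); set x := invmx As *m _; set q := invmx M *m _.
rewrite saddle_precondE ipHyy.
set u1 := invmx A *m (As *m x); set w := invmx A *m (B1^T *m q).
pose q' := invmx M *m (B2 *m (u1 + w)).
have -> : B2 *m (u1 + w) = M *m q' by rewrite mulKVmx.
rewrite ipHyy.
have hq' : Q q' ^+ 2 <= Cb ^+ 2 * N (u1 + w) ^+ 2.
  have : Q q' ^+ 2 <= Cb * N (u1 + w) * Q q'.
    rewrite QE (_ : bil M q' q' = bil B2 (u1 + w) q') ?B2cont//.
    by rewrite /bil -!mulmxA mulKVmx.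
  rewrite expr2 -exprMn; have [->|q0] := eqVneq (Q q') 0.
    by rewrite mul0r sqr_ge0.
  rewrite ler_pM2r ?lt_def ?q0 ?Q0// => h.
  by rewrite -expr2 ler_sqr// nnegrE// mulr_ge0// ltW.
have hu1 : Ca * N u1 ^+ 2 <= bil A x x.
  have h1 : bil A u1 u1 = bil As x u1 by rewrite /bil -!mulmxA mulKVmx.
  have := posdef_bil_le x u1 Assym Aspos; rewrite -h1 !AsE.
  have := Acoer u1; lra.
have hw : N w ^+ 2 <= Cb ^+ 2 / Ca ^+ 2 * Q q ^+ 2.
  have h1 : bil A w w = bil B1 w q.
    by rewrite -[in RHS]bil_tr /bil -!mulmxA mulKVmx.
  have := Acoer w; rewrite h1 => /le_trans/(_ (B1cont w q)).
  have [->|w0] := eqVneq (N w) 0.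
    by rewrite expr0n/= => _; rewrite mulr_ge0 ?sqr_ge0// divr_ge0// sqr_ge0.
  have wp : 0 < N w by rewrite lt_def w0 N0.
  move=> hww; have h : Ca * N w <= Cb * Q q by rewrite -(ler_pM2r wp); lra.
  have -> : Cb ^+ 2 / Ca ^+ 2 * Q q ^+ 2 = (Cb * Q q / Ca) ^+ 2.
    by field; rewrite gt_eqF.
  rewrite ler_sqr ?nnegrE ?divr_ge0 ?mulr_ge0 ?(ltW Ca0) ?(ltW Cb0)//.
  by rewrite ler_pdivlMr// mulrC.
have hN : N (u1 + w) ^+ 2 <= 2 * N u1 ^+ 2 + 2 * N w ^+ 2.
  have : N (u1 + w) ^+ 2 <= (N u1 + N w) ^+ 2.
    by rewrite ler_sqr ?nnegrE// addr_ge0.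
  have := sqr_ge0 (N u1 - N w); nra.
have hx : 0 <= bil A x x by exact: posdef_ge0.
have hu1' : N u1 ^+ 2 <= bil A x x / Ca by rewrite ler_pdivlMr// mulrC.
apply: (@le_trans _ _ (fov_upper * (bil A x x + Q q ^+ 2))); last first.
  by rewrite ler_wpM2r ?addr_ge0 ?sqr_ge0// expr2 ler_peMl// (le_trans ler01).
have h5 : Cb ^+ 2 * N (u1 + w) ^+ 2 <=
    Cb ^+ 2 * (2 * (bil A x x / Ca) + 2 * (Cb ^+ 2 / Ca ^+ 2 * Q q ^+ 2)).
  by rewrite ler_wpM2l ?sqr_ge0//; lra.
have e : fov_upper * (bil A x x + Q q ^+ 2) =
  bil A x x + Cb ^+ 2 * (2 * (bil A x x / Ca) + 2 * (Cb ^+ 2 / Ca ^+ 2 * Q q ^+ 2))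
  + (1 + 2 * Cb ^+ 2 / Ca) * Q q ^+ 2 + 2 * Cb ^+ 4 / Ca ^+ 2 * bil A x x.
  by rewrite /fov_upper; field; rewrite gt_eqF.
rewrite e.
have : 0 <= (1 + 2 * Cb ^+ 2 / Ca) * Q q ^+ 2.
  by rewrite mulr_ge0 ?sqr_ge0// addr_ge0// divr_ge0 ?mulr_ge0 ?sqr_ge0 ?ltW.
have : 0 <= 2 * Cb ^+ 4 / Ca ^+ 2 * bil A x x.
  by rewrite mulr_ge0// divr_ge0 ?mulr_ge0 ?exprn_ge0 ?ltW.
lra.
Qed.

End SaddlePoint.

(** * Minimal residual iteration *)

Section Gmres.
Context (R : realType) (n : nat) (H K : 'M[R]_n) (g G : R).
Hypotheses (g0 : 0 < g) (gG : g <= G).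
Hypothesis Hsym : H^T = H.
Hypothesis Hpos : forall y, y != 0 -> 0 < ipH H y y.
Hypothesis lower : forall y, g * ipH H y y <= ipH H (K *m y) y.
Hypothesis upper : forall y, normH H (K *m y) <= G * normH H y.

(** A residual lies in the next Krylov space, so that GMRES does at least as
    well as one step y + t r of fixed length t = g / G^2 along it. *)
Lemma gmres_contraction b y0 (y : nat -> 'cV[R]_n) :
  (forall k, gmres_iterate H K b y0 k (y k)) -> forall k,
  normH H (b - K *m y k.+1) <=
    Num.sqrt (1 - g ^+ 2 / G ^+ 2) * normH H (b - K *m y k).
Proof.
move=> hy k; have G0 : 0 < G by exact: lt_le_trans gG.
set r := b - K *m y k; pose t := g / G ^+ 2.
have ipge0 z : 0 <= ipH H z z.
  by have [->|/Hpos/ltW//] := eqVneq z 0; rewrite /ipH mulmx0 mxE.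
apply: (@le_trans _ _ (normH H (b - K *m (y k + t *: r)))).
  apply: (hy k.+1).2.
  have [[c yE] _] := hy k.
  set r0 := b - K *m y0 in yE.
  (* r = r0 - sum_i c_i K^(i+1) r0, so its coefficients are those of y k shifted
     by one *)
  exists (fun j : 'I_k.+1 =>
      (if unlift ord_max j is Some i then c i else 0) +
      t * ((if j == 0 then 1 else 0) -
           (if unlift 0 j is Some i then c i else 0))).
  rewrite {1}yE -addrA; congr (_ + _).
  under [RHS]eq_bigr do rewrite scalerDl.
  rewrite big_split/=; congr (_ + _).
    rewrite big_ord_recr/= unlift_none scale0r addr0.
    apply: eq_bigr => i _; rewrite (_ : widen_ord _ i = lift ord_max i).
      by rewrite liftK.
    by apply: val_inj => /=; rewrite /bump leqNgt ltn_ord.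
  under [RHS]eq_bigr do rewrite -scalerA.
  rewrite -scaler_sumr; congr (_ *: _).
  rewrite big_ord_recl/= unlift_none subr0 scale1r.
  rewrite /r yE mulmxDr opprD addrA; congr (_ + _).
  rewrite mulmx_sumr -sumrN; apply: eq_bigr => i _.
  by rewrite liftK sub0r scaleNr -scalemxAr.
have -> : b - K *m (y k + t *: r) = r - t *: (K *m r).
  by rewrite mulmxDr opprD addrA scalemxAr.
rewrite /normH; case: (leP 0 (1 - g ^+ 2 / G ^+ 2)) => hg; last first.
  have : g ^+ 2 <= G ^+ 2 by rewrite ler_sqr ?nnegrE ?(ltW g0) ?(ltW G0).
  by move: hg; rewrite subr_lt0 ltr_pdivlMr ?exprn_gt0// mul1r => /lt_geF->.
rewrite -sqrtrM// ler_wsqrtr//.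
have up : ipH H (K *m r) (K *m r) <= G ^+ 2 * ipH H r r.
  have := upper r; rewrite /normH -ler_sqr ?nnegrE ?sqrtr_ge0//; last first.
    by rewrite mulr_ge0 ?sqrtr_ge0 ?ltW.
  by rewrite exprMn !sqr_sqrtr.
have lo := lower r.
have e : ipH H (r - t *: (K *m r)) (r - t *: (K *m r)) =
    ipH H r r - 2 * t * ipH H (K *m r) r + t ^+ 2 * ipH H (K *m r) (K *m r).
  move: (r) (K *m r) => p q; have ipE p' q' : ipH H p' q' = bil H p' q' by [].
  by rewrite !ipE !bilDE !bilZl !bilZr -[bil H p q]bil_tr Hsym; ring.
have t0 : 0 <= t by rewrite divr_ge0// ?sqr_ge0// ltW.
have h1 : t * (g * ipH H r r) <= t * ipH H (K *m r) r by rewrite ler_wpM2l.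
have h2 : t ^+ 2 * ipH H (K *m r) (K *m r) <= t ^+ 2 * (G ^+ 2 * ipH H r r).
  by rewrite ler_wpM2l ?sqr_ge0.
have e1 : t * (g * ipH H r r) = g ^+ 2 / G ^+ 2 * ipH H r r.
  by rewrite /t; field; rewrite gt_eqF.
have e2 : t ^+ 2 * (G ^+ 2 * ipH H r r) = g ^+ 2 / G ^+ 2 * ipH H r r.
  by rewrite /t; field; rewrite gt_eqF.
rewrite e; lra.
Qed.

End Gmres.

(** * Lebesgue measure on tuples *)

Section LebesgueBox.
Context (R : realType).
Local Notation RB := (measurableTypeR R).
Local Notation leb := (@lebesgue_tuple R).

Definition box n (a : 'rV[R]_n) (r : R) : set 'rV[R]_n :=
  [set x | forall i, a 0 i <= x 0 i <= a 0 i + r].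

(** The domain over which int_on X integrates. *)
Definition tset n (X : set 'rV[R]_n) : set (n.-tuple RB) :=
  [set t | X (tuple_row t)].

Lemma measurable_tnthR n (D : set (n.-tuple RB)) (i : 'I_n) :
  measurable_fun D (fun t : n.-tuple RB => tnth t i : R).
Proof. exact: measurable_funTS (@measurable_tnth _ RB n i). Qed.

Lemma measurable_tbox n (a : 'rV[R]_n) r : measurable (tset (box a r)).
Proof.
rewrite (_ : tset _ = \bigcap_(i in [set: 'I_n])
    ((fun t : n.-tuple RB => tnth t i) @^-1` [set` `[a 0 i, a 0 i + r]])).
  apply: fin_bigcap_measurable => // i _.
  by rewrite -[X in measurable X]setTI; apply: measurable_tnthR.
apply/seteqP; split => t /= h; first by move=> i _ /=; have := h i; rewrite in_itv/= mxE.
by move=> i; have := h i I; rewrite /= in_itv/= mxE.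
Qed.

Lemma tcons_box n (a : 'rV[R]_n.+1) r :
  @tcons R n @^-1` tset (box a r) =
  tset (box (\row_j a 0 (lift ord0 j)) r) `*` [set` `[a 0 0, a 0 0 + r]].
Proof.
apply/seteqP; split => -[t x] /=.
  move=> h; split => [j|].
    by have := h (lift ord0 j); rewrite !mxE tnthS.
  by have := h ord0; rewrite mxE in_itv/= tnth0.
move=> [h1 h2] i; rewrite mxE; case: (unliftP ord0 i) => [j|] ->.
  by have := h1 j; rewrite !mxE tnthS.
by move: h2; rewrite in_itv/= tnth0.
Qed.

Lemma lebesgue_tuple_box n (a : 'rV[R]_n) r : 0 <= r ->
  leb n (tset (box a r)) = (r ^+ n)%:E.
Proof.
move=> r0; elim: n a => [|n IHn] a.
  by rewrite /= diracE/= mem_set// => -[].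
rewrite lebesgue_tupleSE tcons_box product_measure1E; [|exact: measurable_tbox|exact: measurable_itv].
rewrite [leb n _]IHn; rewrite /= lebesgue_measure_itv/= lte_fin ltrDl.
case: ltP => h; first by rewrite -EFinD -EFinM addrAC subrr add0r exprSr.
have -> : r = 0 by apply/eqP; rewrite eq_le r0 h.
by rewrite mule0 expr0n.
Qed.

Lemma lebesgue_tuple_sigma_finite n : sigma_finite setT (leb n).
Proof.
exists (fun k : nat => tset (box (\row_(i < n) - k%:R) (k%:R *+ 2))).
  apply/seteqP; split => // t _.
  have [k hk] : exists k : nat, forall i, `|tnth t i| <= k%:R :> R.
    exists (\max_i Num.truncn `|tnth t i|).+1 => i.
    apply: ltW; apply: (lt_le_trans (truncnS_gt _)).
    by rewrite ler_nat ltnS (leq_bigmax i).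
  exists k => // i; rewrite !mxE.
  by have := hk i; rewrite ler_norml mulr2n addrA addNr add0r.
move=> k; split; first exact: measurable_tbox.
by rewrite lebesgue_tuple_box ?ltry// mulrn_wge0.
Qed.

(** Sigma-finiteness of m1 is a hypothesis here, since for the Lebesgue measure on
    tuples it comes from its values on boxes. *)
Lemma tonelli_sigma_finite d1 d2 (T1 : measurableType d1) (T2 : measurableType d2)
    (m1 : {measure set T1 -> \bar R}) (m2 : {sigma_finite_measure set T2 -> \bar R})
    (f : T1 * T2 -> \bar R) : sigma_finite setT m1 ->
  measurable_fun setT f -> (forall z, 0 <= f z)%E ->
  (\int[m1 \x m2]_z f z = \int[m1]_x \int[m2]_y f (x, y))%E.
Proof.
move=> sf mf f0.
pose m1' := SigmaFiniteMeasure.Pack (SigmaFiniteMeasure.Class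
  (Measure.measure_function_Content_isMeasure_mixin (Measure.class m1))
  (@isSFinite.Axioms_ _ _ _ m1 (sfinite_measure_sigma_finite sf))
  (@isSigmaFinite.Axioms_ _ _ _ m1 sf)).
exact: (@fubini_tonelli1 _ _ _ _ _ m1' m2 f mf f0).
Qed.

Lemma integral_tcons n (f : n.+1.-tuple RB -> \bar R) :
  measurable_fun setT f -> (forall t, 0 <= f t)%E ->
  (\int[leb n.+1]_t f t =
   \int[leb n]_t \int[@lebesgue_measure R]_x f (tcons (t, x)))%E.
Proof.
move=> mf f0.
rewrite [LHS](ge0_integral_pushforward (@measurable_tcons R n))//.
rewrite preimage_setT tonelli_sigma_finite//=.
- exact: lebesgue_tuple_sigma_finite.
- by apply: measurableT_comp => //; exact: measurable_tcons.
Qed.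

Lemma integral_tuple_prod n (f : 'I_n -> R -> R) (c : 'I_n -> R) :
  (forall i, measurable_fun setT (f i)) -> (forall i x, 0 <= f i x) ->
  (forall i, \int[@lebesgue_measure R]_x (f i x)%:E = (c i)%:E)%E ->
  (\int[leb n]_t (\prod_i f i (tnth t i))%:E = (\prod_i c i)%:E)%E.
Proof.
elim: n f c => [|n IHn] f c mf f0 fc.
  rewrite big_ord0; under eq_integral => t _ do rewrite big_ord0.
  by rewrite /= integral_dirac// diracT mul1e.
have mprod m (g : 'I_m -> R -> R) : (forall i, measurable_fun setT (g i)) ->
    measurable_fun setT (fun t : m.-tuple RB => (\prod_i g i (tnth t i))%:E).
  move=> mg; apply/measurable_EFinP; apply: measurable_prod => i _.
  exact: (measurableT_comp (mg i) (@measurable_tnth _ RB m i)).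
rewrite [LHS]integral_tcons//; first last.
- by move=> t; rewrite lee_fin prodr_ge0.
- exact: mprod.
pose g t : R := \prod_(i < n) f (lift ord0 i) (tnth t i).
transitivity (\int[leb n]_t ((g t)%:E * (c ord0)%:E))%E.
  apply: eq_integral => t _.
  transitivity (\int[@lebesgue_measure R]_x ((g t)%:E * (f ord0 x)%:E))%E.
    apply: eq_integral => x _; rewrite big_ord_recl/= tnth0 EFinM muleC.
    by congr (_ * _)%E; congr EFin; apply: eq_bigr => i _; rewrite tnthS.
  rewrite ge0_integralZl//; first by rewrite fc.
  - by apply/measurable_EFinP; exact: mf.
  - by move=> x _; rewrite lee_fin.
  - by rewrite lee_fin prodr_ge0.
rewrite ge0_integralZr//=; first last.
- by rewrite -fc integral_ge0// => x _; rewrite lee_fin.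
- by move=> t _; rewrite lee_fin prodr_ge0.
- exact: (mprod _ (fun i => f (lift ord0 i))).
rewrite /g (IHn (fun i => f (lift ord0 i)) (fun i => c (lift ord0 i)))// big_ord_recl -EFinM.
by rewrite mulrC.
Qed.

Lemma integral_itv_affine_pow (a r : R) (j : nat) : 0 < r ->
  (\int[@lebesgue_measure R]_(x in `[a, (a + r)%R]) (((x - a) / r) ^+ j)%R%:E =
   (r / j.+1%:R)%R%:E)%E.
Proof.
move=> r0.
have du (x : R) : is_derive x 1 (fun x : R => (x - a) / r : R) r^-1.
  rewrite (_ : (fun x => _) = r^-1 \*: (id + cst (- a))).
    by apply: is_derive_eq; rewrite subr0 [LHS]mulr1.
  by apply/funext => y; rewrite /= mulrC.
pose F x : R := r / j.+1%:R * ((x - a) / r) ^+ j.+1.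
have dF (x : R) : is_derive x 1 F (((x - a) / r) ^+ j).
  rewrite (_ : F = (r / j.+1%:R) \*: ((fun x : R => (x - a) / r : R) ^+ j.+1)).
    apply: is_derive_eq; rewrite /GRing.scale/=; field.
    by rewrite gt_eqF//= nat1r pnatr_eq0.
  by apply/funext => y /=; rewrite fctE.
have cu : continuous (fun x : R => ((x - a) / r) ^+ j).
  move=> x; apply: differentiable_continuous.
  apply/derivable1_diffP. rewrite (_ : (fun x => _) = (fun x : R => (x - a) / r : R) ^+ j).
  by apply: derivableX.
  by apply/funext => y /=; rewrite fctE.
have cF : continuous F.
  move=> x; apply: differentiable_continuous.
  by apply/derivable1_diffP.
rewrite (@continuous_FTC2 _ _ F).
- rewrite -EFinB /F addrAC subrr add0r divff ?gt_eqF// expr1n mulr1.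
  by rewrite mul0r expr0n/= mulr0 subr0.
- by rewrite ltrDl.
- exact: continuous_subspaceT.
- split => [x _//||]; apply: cvg_at_right_filter || apply: cvg_at_left_filter; exact: cF.
- by move=> x _; rewrite derive1E derive_val.
Qed.

Lemma int_on_box_monomial n (a : 'rV[R]_n) r (m : 'I_n -> nat) : 0 < r ->
  int_on (box a r) (fun x => \prod_i ((x 0 i - a 0 i) / r) ^+ m i) =
  r ^+ n * \prod_i ((m i).+1%:R)^-1.
Proof.
move=> r0; rewrite /int_on /Rintegral.
pose f (i : 'I_n) (x : R) : R :=
  ((x - a 0 i) / r) ^+ m i * \1_[set` `[a 0 i, a 0 i + r]] x.
suff -> : (\int[leb n]_(t in tset (box a r))
    (\prod_i ((tuple_row t 0 i - a 0 i) / r) ^+ m i)%R%:E =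
    (\prod_i (r / (m i).+1%:R))%R%:E)%E.
  by rewrite /= big_split/= prodr_const card_ord.
rewrite -(@integral_tuple_prod _ f).
- rewrite integral_mkcond; apply: eq_integral => t _; rewrite patchE.
  case: ifPn => [/set_mem h|h]; rewrite /f.
    congr EFin; apply: eq_bigr => i _; rewrite indicE mem_set ?mulr1 ?mxE//.
    by have := h i; rewrite mxE /= in_itv.
  have [i hi] : exists i, ~~ (a 0 i <= tnth t i <= a 0 i + r).
    apply/not_existsP => hh; move/negP: h; apply; apply/mem_set => i.
    by have := hh i; rewrite mxE; case: (_ <= _ <= _).
  by rewrite (bigD1 i)//= indicE memNset ?mulr0 ?mul0r//= in_itv/=; exact/negP.
- move=> i; apply: measurable_funM; last exact: measurable_indic.
  apply: measurable_funX; apply: measurable_funM => //.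
  exact: measurable_funB.
- move=> i x; rewrite /f indicE; have [/set_mem|] := boolP (x \in _).
    by rewrite /= in_itv/= => /andP[h _]; rewrite mulr1 exprn_ge0// divr_ge0 ?subr_ge0// ltW.
  by rewrite mulr0.
- move=> i; rewrite -(integral_itv_affine_pow (a 0 i) (m i) r0).
  rewrite [RHS]integral_mkcond; apply: eq_integral => x _.
  by rewrite patchE /f indicE; case: ifP; rewrite ?mulr1 ?mulr0.
Qed.

End LebesgueBox.

(** * Integration of bounded measurable functions *)

Section BoundedMeasurable.
Context (R : realType) (n : nat).
Local Notation leb := (@lebesgue_tuple R n).
Implicit Types (X Y : set 'rV[R]_n) (f g : 'rV[R]_n -> R).

Definition bounded_mset X :=
  measurable (tset X) /\ exists B, forall x, X x -> forall i, `|x 0 i| <= B.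

(** On sets of finite measure these functions form an algebra and are
    integrable, so closure rules settle all questions of integrability. *)
Definition bmeas X f :=
  measurable_fun (tset X) (fun t => f (tuple_row t)) /\
  exists B, forall x, X x -> `|f x| <= B.

Lemma bounded_mset_fin X : bounded_mset X -> (leb (tset X) < +oo)%E.
Proof.
move=> [mX [B XB]].
have B0 : 0 <= Num.max 0 B by rewrite le_max lexx.
have sub : tset X `<=` tset (box (\row_(i < n) - Num.max 0 B) (Num.max 0 B *+ 2)).
  move=> t Xt i; rewrite [in X in _ <= X <= _]mxE.
  have := XB _ Xt i; rewrite !mxE => /le_trans/(_ (_ : B <= Num.max 0 B)).
  by rewrite le_max lexx orbT => /(_ isT); rewrite ler_norml mulr2n addrA addNr add0r.
apply: le_lt_trans (le_measure _ _ _ sub) _; rewrite ?inE//.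
  exact: measurable_tbox.
by rewrite [X in (X < _)%E]lebesgue_tuple_box ?ltry// mulrn_wge0.
Qed.

Lemma bounded_mset_box (a : 'rV[R]_n) r : bounded_mset (box a r).
Proof.
split; first exact: measurable_tbox.
exists (\sum_i (`|a 0 i| + `|r|)) => x hx i.
apply: (@le_trans _ _ (`|a 0 i| + `|r|)); last first.
  rewrite (bigD1 i)//= lerDl sumr_ge0// => j _; exact: addr_ge0.
have /andP[h1 h2] := hx i.
have := ler_norm (a 0 i); have := ler_norm (- a 0 i).
have := ler_norm r; have := normr_ge0 r; rewrite normrN ler_norml; lra.
Qed.

Lemma bmeas_ext X f g : (forall x, X x -> f x = g x) -> bmeas X f -> bmeas X g.
Proof.
move=> fg [mf [B fB]]; split; last by exists B => x Xx; rewrite -fg ?fB.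
apply: eq_measurable_fun mf => t /set_mem Xt; exact: fg.
Qed.

Lemma bmeas_cst X c : bmeas X (fun=> c).
Proof. by split; [exact: measurable_cst|exists `|c|]. Qed.

Lemma bmeasD X f g : bmeas X f -> bmeas X g -> bmeas X (fun x => f x + g x).
Proof.
move=> [mf [B fB]] [mg [C gC]]; split; first exact: measurable_funD.
by exists (B + C) => x Xx; rewrite (le_trans (ler_normD _ _))// lerD ?fB ?gC.
Qed.

Lemma bmeasM X f g : bmeas X f -> bmeas X g -> bmeas X (fun x => f x * g x).
Proof.
move=> [mf [B fB]] [mg [C gC]]; split; first exact: measurable_funM.
by exists (B * C) => x Xx; rewrite normrM ler_pM ?fB ?gC.
Qed.

Lemma bmeasN X f : bmeas X f -> bmeas X (fun x => - f x).
Proof.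
move=> bf; apply: (@bmeas_ext _ (fun x => (-1) * f x)).
  by move=> x _; rewrite mulN1r.
by apply: bmeasM bf; exact: bmeas_cst.
Qed.

Lemma bmeasB X f g : bmeas X f -> bmeas X g -> bmeas X (fun x => f x - g x).
Proof. by move=> bf bg; apply: bmeasD bf _; exact: bmeasN. Qed.

Lemma bmeas_sum X (I : Type) (s : seq I) (P : pred I) (f : I -> 'rV[R]_n -> R) :
  (forall i, P i -> bmeas X (f i)) -> bmeas X (fun x => \sum_(i <- s | P i) f i x).
Proof.
move=> bf; elim: s => [|i s IHs].
  by apply: bmeas_ext (bmeas_cst X 0) => x _; rewrite big_nil.
case Pi : (P i); last first.
  by apply: bmeas_ext IHs => x _; rewrite big_cons Pi.
by apply: bmeas_ext (bmeasD (bf i Pi) IHs) => x _; rewrite big_cons Pi.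
Qed.

Lemma bmeas_prod X (I : Type) (s : seq I) (P : pred I) (f : I -> 'rV[R]_n -> R) :
  (forall i, P i -> bmeas X (f i)) -> bmeas X (fun x => \prod_(i <- s | P i) f i x).
Proof.
move=> bf; elim: s => [|i s IHs].
  by apply: bmeas_ext (bmeas_cst X 1) => x _; rewrite big_nil.
case Pi : (P i); last first.
  by apply: bmeas_ext IHs => x _; rewrite big_cons Pi.
by apply: bmeas_ext (bmeasM (bf i Pi) IHs) => x _; rewrite big_cons Pi.
Qed.

Lemma bmeasX X f k : bmeas X f -> bmeas X (fun x => f x ^+ k).
Proof.
move=> bf; apply: bmeas_ext (@bmeas_prod X _ (index_enum 'I_k) xpredT (fun=> f) _).
  by move=> x _; rewrite prodr_const card_ord.
by [].
Qed.

Lemma bmeas_coord X i : bounded_mset X -> bmeas X (fun x => x 0 i).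
Proof.
move=> [_ [B XB]]; split; last by exists B => x Xx; exact: XB.
apply: eq_measurable_fun (@measurable_tnthR R n (tset X) i) => t _.
by rewrite mxE.
Qed.

Variable X : set 'rV[R]_n.
Hypothesis bX : bounded_mset X.

Lemma bmeas_integrable f : bmeas X f ->
  leb.-integrable (tset X) (EFin \o (fun t => f (tuple_row t))).
Proof.
move=> [mf [B fB]]; apply: measurable_bounded_integrable => //.
- exact: bX.1.
- exact: bounded_mset_fin.
- exists B; split; first exact: num_real.
  by move=> M BM t Xt /=; rewrite (le_trans (fB _ Xt))// ltW.
Qed.

Lemma eq_int_on f g : (forall x, X x -> f x = g x) -> int_on X f = int_on X g.
Proof. by move=> fg; apply: eq_Rintegral => t /set_mem Xt; exact: fg. Qed.

Lemma int_onD f g : bmeas X f -> bmeas X g ->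
  int_on X (fun x => f x + g x) = int_on X f + int_on X g.
Proof.
by move=> bf bg; apply: RintegralD; [exact: bX.1|exact: bmeas_integrable..].
Qed.

Lemma int_onZ c f : bmeas X f -> int_on X (fun x => c * f x) = c * int_on X f.
Proof. by move=> bf; apply: RintegralZl; [exact: bX.1|exact: bmeas_integrable]. Qed.

Lemma int_onB f g : bmeas X f -> bmeas X g ->
  int_on X (fun x => f x - g x) = int_on X f - int_on X g.
Proof.
by move=> bf bg; apply: RintegralB; [exact: bX.1|exact: bmeas_integrable..].
Qed.

Lemma int_on0 : int_on X (fun=> 0) = 0.
Proof. by rewrite /int_on Rintegral_cst ?mul0r//; exact: bX.1. Qed.

Lemma int_on_cst c : int_on X (fun=> c) = c * fine (leb (tset X)).
Proof. by rewrite /int_on Rintegral_cst//; exact: bX.1. Qed.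

Lemma int_on_sum (I : Type) (s : seq I) (P : pred I) (f : I -> 'rV[R]_n -> R) :
  (forall i, P i -> bmeas X (f i)) ->
  int_on X (fun x => \sum_(i <- s | P i) f i x) = \sum_(i <- s | P i) int_on X (f i).
Proof.
move=> bf; elim: s => [|i s IHs].
  rewrite big_nil -[RHS]int_on0; apply: eq_int_on => x _; rewrite big_nil//.
rewrite big_cons; case: ifP => Pi; rewrite -IHs; last first.
  by apply: eq_int_on => x _; rewrite big_cons Pi.
rewrite -int_onD//; [|exact: bf|exact: bmeas_sum].
by apply: eq_int_on => x _; rewrite big_cons Pi.
Qed.

Lemma int_on_ge0 f : (forall x, X x -> 0 <= f x) -> 0 <= int_on X f.
Proof. by move=> f0; apply: Rintegral_ge0 => t Xt; exact: f0. Qed.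

Lemma le_int_on f g : bmeas X f -> bmeas X g ->
  (forall x, X x -> f x <= g x) -> int_on X f <= int_on X g.
Proof.
move=> bf bg fg; apply: le_Rintegral; [exact: bX.1|exact: bmeas_integrable..|].
by move=> t Xt; exact: fg.
Qed.

Lemma int_on_norm_le f B : bmeas X f -> (forall x, X x -> `|f x| <= B) ->
  `|int_on X f| <= B * fine (leb (tset X)).
Proof.
move=> bf fB; rewrite -int_on_cst ler_norml; apply/andP; split.
  rewrite -mulN1r -int_onZ; last exact: bmeas_cst.
  apply: le_int_on => //; first exact: bmeas_cst.
  by move=> x Xx; rewrite mulN1r; have := fB x Xx; rewrite ler_norml => /andP[].
apply: le_int_on => //; first exact: bmeas_cst.
by move=> x Xx; have := fB x Xx; rewrite ler_norml => /andP[].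
Qed.

(** Cauchy-Schwarz, from the nonnegativity of the integral of (f - t g)^2. *)
Lemma int_on_cauchy_schwarz f g : bmeas X f -> bmeas X g ->
  int_on X (fun x => f x * g x) ^+ 2 <=
  int_on X (fun x => f x ^+ 2) * int_on X (fun x => g x ^+ 2).
Proof.
move=> bf bg; set a := int_on X (fun x => f x ^+ 2).
set b := int_on X _; set c := int_on X _.
have h t : 0 <= a - 2 * t * b + t ^+ 2 * c.
  have -> : a - 2 * t * b + t ^+ 2 * c = int_on X (fun x => (f x - t * g x) ^+ 2).
    transitivity (int_on X (fun x =>
        f x ^+ 2 + (- 2 * t) * (f x * g x) + t ^+ 2 * g x ^+ 2)).
      rewrite int_onD ?int_onD ?int_onZ//; first by rewrite -/a -/b -/c; ring.
      all: do ?[exact: bmeasM|exact: bmeasX|apply: bmeasM|apply: bmeasD|exact: bmeas_cst].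
    by apply: eq_int_on => x _; ring.
  by apply: int_on_ge0 => x _; exact: sqr_ge0.
have a0 : 0 <= a by apply: int_on_ge0 => x _; exact: sqr_ge0.
have c0 : 0 <= c by apply: int_on_ge0 => x _; exact: sqr_ge0.
have [c00|cn0] := eqVneq c 0.
  rewrite c00 mulr0; suff -> : b = 0 by rewrite expr0n.
  apply/eqP; apply: contraT => b0; have := h ((a + 1) / (2 * b)).
  rewrite c00 mulr0 addr0 (_ : 2 * _ * b = a + 1); first by lra.
  by field.
have := h (b / c); rewrite (_ : a - _ + _ = (a * c - b ^+ 2) / c); last by field.
by rewrite pmulr_lge0 ?invr_gt0 ?lt_def ?cn0// subr_ge0.
Qed.

End BoundedMeasurable.

Lemma int_on_subset (R : realType) n (X Y : set 'rV[R]_n) f : bounded_mset X ->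
  bounded_mset Y -> X `<=` Y -> bmeas Y f -> (forall x, Y x -> 0 <= f x) ->
  int_on X f <= int_on Y f.
Proof.
move=> bX bY XY bf f0.
have bfX : bmeas X f.
  case: bf => mf [B fB]; split; last by exists B => x /XY; exact: fB.
  by apply: measurable_funS mf; [exact: bY.1|move=> t /XY].
have iX := integrable_fin_num bX.1 (bmeas_integrable bX bfX).
have iY := integrable_fin_num bY.1 (bmeas_integrable bY bf).
rewrite /int_on /Rintegral fine_le//.
apply: ge0_subset_integral; [exact: bX.1|exact: bY.1| | |by move=> t /XY].
- by apply/measurable_EFinP; exact: bf.1.
- by move=> t Yt; rewrite lee_fin f0.
Qed.

Section PolyBmeas.
Context (R : realType) (n : nat).

Lemma pvalE (p : mpoly.mpoly n R) x :
  pval p x = \sum_(m <- mpoly.msupp p) mpoly.mcoeff m p * \prod_i x 0 i ^+ m i.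
Proof. exact: mpoly.mevalE. Qed.

Lemma bmeas_pval X (p : mpoly.mpoly n R) : bounded_mset X -> bmeas X (pval p).
Proof.
move=> bX.
apply: (@bmeas_ext _ _ _ (fun x => \sum_(m <- mpoly.msupp p)
  mpoly.mcoeff m p * \prod_i x 0 i ^+ m i)).
  by move=> x _; rewrite pvalE.
apply: bmeas_sum => m _; apply: bmeasM; first exact: bmeas_cst.
by apply: bmeas_prod => i _; apply: bmeasX; exact: bmeas_coord.
Qed.

End PolyBmeas.

(** * Coefficients of polynomials and their mean square on a box *)

Local Notation cf m p := (mpoly.mcoeff m p).

Section DualWeights.
Context (R : realType) (k : nat).

(** The Gram matrix of the monomials z^0, ..., z^k on [0, 1]. *)
Definition hilbert : 'M[R]_k.+1 := \matrix_(i, j) ((i + j).+1%:R)^-1.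

(** A vector v in the left kernel gives the polynomial with value
    prod_l (z + l + 1) * sum_l v_l / (z + l + 1), which has degree at most k and
    vanishes at 0, ..., k; its values at the poles are multiples of the v_l. *)
Lemma hilbert_unit : hilbert \in unitmx.
Proof.
rewrite unitmxE unitfE; apply/det0P => -[v v0 vH].
pose N : {poly R} := \sum_(l < k.+1)
  v 0 l *: \prod_(l' < k.+1 | l' != l) ('X - (- (l'.+1%:R))%:P).
have Ev z : N.[z] = \sum_(l < k.+1)
    v 0 l * \prod_(l' < k.+1 | l' != l) (z + l'.+1%:R).
  rewrite horner_sum; apply: eq_bigr => l _.
  rewrite hornerZ horner_prod; congr (_ * _); apply: eq_bigr => l' _.
  by rewrite !hornerE opprK.
have N0 : N = 0.
  apply/eqP/negP => /negP Nn0.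
  have := @max_poly_roots _ N [seq j%:R | j <- iota 0 k.+1] Nn0.
  rewrite size_map size_iota map_inj_uniq ?iota_uniq; last first.
    by move=> i j /eqP; rewrite eqr_nat => /eqP.
  have rt : all (root N) [seq j%:R | j <- iota 0 k.+1].
    apply/allP => _ /mapP[j jk ->]; rewrite mem_iota/= add0n in jk.
    rewrite rootE Ev; apply/eqP.
    have := congr1 (fun M : 'rV_(k.+1) => M 0 (Ordinal jk)) vH.
    rewrite !mxE => h.
    transitivity ((\sum_l v 0 l * hilbert l (Ordinal jk)) *
        \prod_(l < k.+1) (j%:R + l.+1%:R)); last by rewrite h mul0r.
    rewrite big_distrl; apply: eq_bigr => l _.
    rewrite [X in _ = _ * X](bigD1 l)//= /hilbert mxE mulrA; congr (_ * _).
    rewrite -mulrA -natrD addnS [(j + l)%N]addnC mulVf ?mulr1 ?pnatr_eq0//.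
  move=> /(_ rt isT); apply/negP; rewrite -leqNgt.
  apply: (leq_trans (size_sum _ _ _)); apply/bigmax_leqP => l _.
  apply: (leq_trans (size_scale_leq _ _)).
  rewrite -big_filter size_prod_XsubC size_filter -sum1_count ltnS.
  suff -> : (\sum_(i < k.+1 | i != l) 1 = k)%N by [].
  by rewrite (eq_bigl (mem (predC1 l)))// sum1_card cardC1 card_ord.
have : exists l, v 0 l != 0.
  apply/existsP; apply: contraNT v0; rewrite negb_exists => /forallP h.
  by apply/eqP/rowP => i; rewrite mxE; apply/eqP; have := h i; rewrite negbK.
move=> [l vl0]; have := Ev (- l.+1%:R); rewrite N0 horner0.
rewrite (bigD1 l)//= [X in _ + X]big1 ?addr0; last first.
  by move=> i il; rewrite (bigD1 l) 1?eq_sym//= addNr mul0r mulr0.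
move/esym/eqP; rewrite mulf_eq0 (negbTE vl0)/= prodf_seq_eq0 => /hasP[l' _].
move=> /andP[l'l]; rewrite addrC subr_eq0 eqr_nat eqSS.
by rewrite (inj_eq val_inj) (negbTE l'l).
Qed.

(** The polynomial with coefficients dualw j is dual to z^j: its integral on
    [0, 1] against z^i is (j == i). *)
Definition dualw (j l : 'I_k.+1) : R := invmx hilbert j l.

Lemma dualwE (j i : 'I_k.+1) :
  \sum_l dualw j l / (l + i).+1%:R = (j == i)%:R.
Proof.
have := congr1 (fun M : 'M[R]_k.+1 => M j i) (mulVmx hilbert_unit).
rewrite !mxE => <-; apply: eq_bigr => l _; by rewrite mxE.
Qed.

End DualWeights.

Section CoefBound.
Context (R : realType) (n : nat).
Local Notation poly := (mpoly.mpoly n R).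

(** The affine map taking the box of corner a and side r to the unit cube. *)
Definition unscale (a : 'rV[R]_n) (r : R) (x : 'rV[R]_n) : 'rV[R]_n :=
  r^-1 *: (x - a).

Lemma unscaleE a r x i : unscale a r x 0 i = (x 0 i - a 0 i) / r.
Proof. by rewrite !mxE mulrC. Qed.

Lemma bmeas_comp_unscale X a r (p : poly) : bounded_mset X ->
  bmeas X (fun x => pval p (unscale a r x)).
Proof.
move=> bX.
apply: (@bmeas_ext _ _ _ (fun x => \sum_(m <- mpoly.msupp p)
  cf m p * \prod_i ((x 0 i - a 0 i) / r) ^+ m i)).
  move=> x _; rewrite pvalE; apply: eq_bigr => m _; congr (_ * _).
  by apply: eq_bigr => i _; rewrite unscaleE.
apply: bmeas_sum => m _; apply: bmeasM; first exact: bmeas_cst.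
apply: bmeas_prod => i _; apply: bmeasX; apply: bmeasM; last exact: bmeas_cst.
by apply: bmeasB; [exact: bmeas_coord|exact: bmeas_cst].
Qed.

Lemma unscale_box a r x : 0 < r -> box a r x -> forall i,
  0 <= unscale a r x 0 i <= 1.
Proof.
move=> r0 hx i; rewrite unscaleE ler_pdivlMr// mul0r ler_pdivrMr// mul1r.
by have := hx i; rewrite subr_ge0 lerBlDl.
Qed.

(** The coefficients are the mean values against the tensor products of the
    dual weights, hence bounded by the mean square. *)
Lemma coef_box_bound (k : nat) : exists C : R, 0 < C /\
  forall (a : 'rV[R]_n) (r : R) (q : poly), 0 < r -> (mpoly.msize q <= k.+1)%N ->
  forall m, cf m q ^+ 2 * r ^+ n <=
    C * int_on (box a r) (fun x => pval q (unscale a r x) ^+ 2).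
Proof.
pose B : R := \prod_(i < n) \sum_(j < k.+1) \sum_(l < k.+1) `|dualw R j l|.
exists (B ^+ 2 + 1); split; first by rewrite ltr_wpDl ?sqr_ge0.
move=> a r q r0 qk m.
set I2 := int_on _ _.
have bX := bounded_mset_box a r.
have I20 : 0 <= I2 by apply: int_on_ge0 => x _; exact: sqr_ge0.
have [mk|mk] := leqP k.+1 (mpoly.mdeg m).
  rewrite mpoly.memN_msupp_eq0 ?expr0n ?mul0r/=; last first.
    by rewrite mpoly.msize_mdeg_ge// (leq_trans qk).
  by rewrite mulr_ge0// addr_ge0// sqr_ge0.
have mik m' : (mpoly.mdeg m' < k.+1)%N -> forall i, (m' i < k.+1)%N.
  move=> h i; apply: leq_ltn_trans h; rewrite mpoly.mdegE.
  by rewrite (bigD1 i)//= leq_addr.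
pose w i l : R := dualw R (inord (m i) : 'I_k.+1) l.
pose W (s : 'rV[R]_n) : R := \prod_i \sum_(l < k.+1) w i l * s 0 i ^+ l.
have WE s : W s = \sum_(f : {ffun 'I_n -> 'I_k.+1}) \prod_i (w i (f i) * s 0 i ^+ f i).
  by rewrite /W bigA_distr_bigA.
have bw : bmeas (box a r) (fun x => W (unscale a r x)).
  apply: bmeas_prod => i _; apply: bmeas_sum => l _; apply: bmeasM; first exact: bmeas_cst.
  apply: (@bmeas_ext _ _ _ (fun x => ((x 0 i - a 0 i) / r) ^+ l)).
    by move=> x _; rewrite unscaleE.
  apply: bmeasX; apply: bmeasM; last exact: bmeas_cst.
  by apply: bmeasB; [exact: bmeas_coord|exact: bmeas_cst].
have WB x : box a r x -> `|W (unscale a r x)| <= B.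
  move=> hx; rewrite /W normr_prod; apply: ler_prod => i _; rewrite normr_ge0/=.
  apply: le_trans (ler_norm_sum _ _ _) _.
  rewrite [leRHS](bigD1 (inord (m i)))//= -[leLHS]addr0 lerD//; last first.
    by apply: sumr_ge0 => j _; apply: sumr_ge0.
  apply: ler_sum => l _; rewrite normrM ler_piMr// normrX exprn_ile1//.
  have /andP[h1 h2] := unscale_box r0 hx i.
  by rewrite ger0_norm.
(* integration against the dual weight W extracts the coefficient at m *)
have key : int_on (box a r) (fun x => W (unscale a r x) * pval q (unscale a r x)) =
           r ^+ n * cf m q.
  transitivity (int_on (box a r) (fun x => \sum_(m' <- mpoly.msupp q)
     \sum_(f : {ffun 'I_n -> 'I_k.+1}) (cf m' q * \prod_i w i (f i)) *
        \prod_i ((x 0 i - a 0 i) / r) ^+ (f i + m' i))).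
    apply: eq_int_on => x _; rewrite pvalE mulr_sumr; apply: eq_bigr => m' _.
    rewrite WE big_distrl/=; apply: eq_bigr => f _.
    have -> : \prod_i ((x 0 i - a 0 i) / r) ^+ (f i + m' i) =
        (\prod_i unscale a r x 0 i ^+ f i) * \prod_i unscale a r x 0 i ^+ m' i.
      by rewrite -big_split/=; apply: eq_bigr => i _; rewrite exprD unscaleE.
    by rewrite big_split/=; ring.
  have bm f m' : bmeas (box a r) (fun x => \prod_i ((x 0 i - a 0 i) / r) ^+ (f i + m' i)).
    apply: bmeas_prod => i _; apply: bmeasX; apply: bmeasM; last exact: bmeas_cst.
    by apply: bmeasB; [exact: bmeas_coord|exact: bmeas_cst].
  rewrite int_on_sum//; last first.
    by move=> m' _; apply: bmeas_sum => f _; apply: bmeasM; [exact: bmeas_cst|exact: (bm (fun i => f i) (fun i => m' i))].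
  transitivity (\sum_(m' <- mpoly.msupp q)
      (r ^+ n * (cf m' q * \prod_i ((inord (m i) : 'I_k.+1) == inord (m' i))%:R))).
    rewrite big_seq [RHS]big_seq; apply: eq_bigr => m' m'q.
    have m'k := leq_trans (mpoly.msize_mdeg_lt m'q) qk.
    rewrite int_on_sum//; last first.
      by move=> f _; apply: bmeasM; [exact: bmeas_cst|exact: (bm (fun i => f i) (fun i => m' i))].
    transitivity (\sum_(f : {ffun 'I_n -> 'I_k.+1}) r ^+ n * (cf m' q *
        \prod_i (w i (f i) * ((f i + m' i).+1%:R)^-1))).
      apply: eq_bigr => f _.
      rewrite (int_onZ bX _ (bm (fun i => f i) (fun i => m' i))) int_on_box_monomial// big_split/=; ring.
    rewrite -!mulr_sumr; congr (_ * (_ * _)).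
    rewrite -(bigA_distr_bigA (fun i l => w i l * ((l + m' i).+1%:R)^-1)).
    apply: eq_bigr => i _; rewrite -dualwE; apply: eq_bigr => l _.
    by rewrite /w inordK// mik.
  rewrite -mulr_sumr; congr (_ * _).
  have dlt m' : m' \in mpoly.msupp q ->
      \prod_i ((inord (m i) : 'I_k.+1) == inord (m' i))%:R = (m == m')%:R :> R.
    move=> m'q; have m'k := leq_trans (mpoly.msize_mdeg_lt m'q) qk.
    have [->|mm'] := eqVneq m m'; first by rewrite big1// => i _; rewrite eqxx.
    have /existsP[i mi] : [exists i, m i != m' i].
      apply: contraNT mm'; rewrite negb_exists => /forallP h.
      by apply/eqP/mpoly.mnmP => i; have := h i; rewrite negbK => /eqP.
    rewrite (bigD1 i)//=; case: eqP => [/(congr1 val)/=|_]; last by rewrite mul0r.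
    by rewrite !inordK ?mik// => e; rewrite e eqxx in mi.
  have [mq|mq] := boolP (m \in mpoly.msupp q).
    rewrite (bigD1_seq m)//= ?mpoly.msupp_uniq// dlt// eqxx mulr1.
    rewrite big_seq_cond big1 ?addr0// => m' /andP[m'q mm'].
    by rewrite dlt// eq_sym (negbTE mm') mulr0.
  rewrite (mpoly.memN_msupp_eq0 mq) big_seq big1// => m' m'q.
  by rewrite dlt//; case: eqP mq => [->|_ _]; rewrite ?m'q// mulr0.
have bq := bmeas_comp_unscale a r q bX.
have := int_on_cauchy_schwarz bX bw bq; rewrite key -/I2.
have WW : int_on (box a r) (fun x => W (unscale a r x) ^+ 2) <= B ^+ 2 * r ^+ n.
  have := @int_on_norm_le _ _ _ bX _ (B ^+ 2) (bmeasX 2 bw).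
  rewrite lebesgue_tuple_box ?(ltW r0)//= => h.
  apply: le_trans (ler_norm _) (h _) => x hx; rewrite normrX ler_sqr ?nnegrE//; first exact: WB.
  by rewrite prodr_ge0// => i _; rewrite sumr_ge0// => j _; rewrite sumr_ge0.
move=> h; have rn : 0 < r ^+ n by rewrite exprn_gt0.
have h2 : (r ^+ n * cf m q) ^+ 2 <= B ^+ 2 * r ^+ n * I2.
  by apply: le_trans h _; rewrite ler_wpM2r.
rewrite -(ler_pM2l rn).
have : r ^+ n * (cf m q ^+ 2 * r ^+ n) = (r ^+ n * cf m q) ^+ 2 by ring.
move=> ->; apply: le_trans h2 _.
have -> : r ^+ n * ((B ^+ 2 + 1) * I2) = B ^+ 2 * r ^+ n * I2 + r ^+ n * I2 by ring.
by rewrite lerDl mulr_ge0// ltW.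
Qed.

End CoefBound.

Local Notation polyX R i := (mpoly.mpolyX R (mpoly.mnm1 i)).

(** * Bounds and Lipschitz bounds from coefficients *)

Section Lipschitz.
Context (R : realType) (n : nat).
Implicit Types (f g : 'rV[R]_n -> R).

(** A bound and a Lipschitz constant in the sup norm, taken equal so that the
    property passes to products. *)
Definition blip (M : R) f (C : R) := forall (s s' : 'rV[R]_n) t,
  (forall i, `|s 0 i| <= M) -> (forall i, `|s' 0 i| <= M) -> 0 <= t ->
  (forall i, `|s 0 i - s' 0 i| <= t) -> `|f s| <= C /\ `|f s - f s'| <= C * t.

Lemma blip_le M f C C' : C <= C' -> blip M f C -> blip M f C'.
Proof.
move=> CC' fC s s' t sM s'M t0 st; have [h1 h2] := fC s s' t sM s'M t0 st.
by split; [exact: le_trans CC'|rewrite (le_trans h2)// ler_wpM2r].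
Qed.

Lemma blip_cst M c : blip M (fun=> c) `|c|.
Proof. by move=> s s' t _ _ t0 _; split; rewrite // subrr normr0 mulr_ge0. Qed.

Lemma blip_coord M i : blip M (fun s => s 0 i) (Num.max M 1).
Proof.
move=> s s' t sM s'M t0 st; split; first by rewrite le_max sM.
by rewrite (le_trans (st i))// ler_peMl// le_max lexx orbT.
Qed.

Lemma blipD M f g C D : blip M f C -> blip M g D -> blip M (fun s => f s + g s) (C + D).
Proof.
move=> fC gD s s' t sM s'M t0 st.
have [f1 f2] := fC s s' t sM s'M t0 st; have [g1 g2] := gD s s' t sM s'M t0 st.
split; first by rewrite (le_trans (ler_normD _ _))// lerD.
by rewrite opprD addrACA mulrDl (le_trans (ler_normD _ _))// lerD.
Qed.

Lemma blipM M f g C D : blip M f C -> blip M g D ->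
  blip M (fun s => f s * g s) (2 * (C * D)).
Proof.
move=> fC gD s s' t sM s'M t0 st.
have [f1 f2] := fC s s' t sM s'M t0 st; have [g1 g2] := gD s s' t sM s'M t0 st.
have ts' i : `|s' 0 i - s 0 i| <= t by rewrite distrC.
have [g3 _] := gD s' s t s'M sM t0 ts'.
have C0 : 0 <= C by exact: le_trans f1.
have D0 : 0 <= D by exact: le_trans g1.
have fg : `|f s| * `|g s| <= C * D by rewrite ler_pM.
split; first by rewrite normrM (le_trans fg)// ler_peMl ?mulr_ge0 ?ler1n.
have -> : f s * g s - f s' * g s' = f s * (g s - g s') + (f s - f s') * g s' by ring.
apply: le_trans (ler_normD _ _) _; rewrite !normrM.
have : `|f s| * `|g s - g s'| <= C * (D * t) by rewrite ler_pM.
have : `|f s - f s'| * `|g s'| <= (C * t) * D by rewrite ler_pM.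
lra.
Qed.

Lemma blip_sum M (I : Type) (r : seq I) (P : pred I) (f : I -> 'rV[R]_n -> R) C :
  (forall i, P i -> blip M (f i) (C i)) ->
  blip M (fun s => \sum_(i <- r | P i) f i s) (\sum_(i <- r | P i) C i).
Proof.
move=> fC s s' t sM s'M t0 st; split.
  apply: le_trans (ler_norm_sum _ _ _) _; apply: ler_sum => i Pi.
  by have [] := fC i Pi s s' t sM s'M t0 st.
rewrite -sumrB mulr_suml; apply: le_trans (ler_norm_sum _ _ _) _.
by apply: ler_sum => i Pi; have [] := fC i Pi s s' t sM s'M t0 st.
Qed.

Lemma blip_prod M (I : Type) (r : seq I) (P : pred I) (f : I -> 'rV[R]_n -> R) :
  (forall i, P i -> exists C, blip M (f i) C) ->
  exists C, blip M (fun s => \prod_(i <- r | P i) f i s) C.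
Proof.
move=> fC; elim: r => [|i r [D IHr]].
  by exists `|1| => s s' t; rewrite !big_nil; exact: (@blip_cst M 1 s s' t).
case Pi : (P i); last by exists D => s s' t; rewrite !big_cons Pi; exact: IHr.
have [C fiC] := fC i Pi; exists (2 * (C * D)) => s s' t.
by rewrite !big_cons Pi; exact: (blipM fiC IHr (t := t)).
Qed.

(** This holds for each monomial, and finitely many have degree at most k. *)
Lemma pval_blip k M : exists C, 0 < C /\ forall (q : mpoly.mpoly n R) (B : R),
  (mpoly.msize q <= k.+1)%N -> (forall m, `|cf m q| <= B) -> blip M (pval q) (C * B).
Proof.
have mono (m : mpoly.multinom n) :
    exists C, blip M (fun s => \prod_i s 0 i ^+ m i) C.
  apply: blip_prod => i _.
  have [C hC] : exists C, blip M (fun s => \prod_(j < m i) s 0 i) C.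
    by apply: blip_prod => j _; exists (Num.max M 1); exact: blip_coord.
  by exists C => s s' t; have := hC s s' t; rewrite !prodr_const !card_ord.
have [K HK] := choice mono.
exists (\sum_(m : mpoly.bmultinom n k.+1) `|K m| + 1); split.
  by rewrite ltr_wpDl ?sumr_ge0.
move=> q B qk qB.
have B0 : 0 <= B by apply: le_trans (qB mpoly.mnm0).
have E s : pval q s = \sum_(m : mpoly.bmultinom n k.+1) cf m q * \prod_i s 0 i ^+ m i.
  rewrite /pval (mpoly.mpolywE qk) raddf_sum/=; apply: eq_bigr => m _.
  by rewrite mpoly.mevalZ mpoly.mevalX -(mpoly.mpolywE qk).
have bs : blip M (fun s => \sum_(m : mpoly.bmultinom n k.+1)
    cf m q * \prod_i s 0 i ^+ m i) (\sum_(m : mpoly.bmultinom n k.+1) B * `|K m|).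
  apply: blip_sum => m _ s s' t sM s'M t0 st.
  have [h1 h2] := HK m s s' t sM s'M t0 st; have KK := ler_norm (K m).
  split; rewrite -?mulrBr normrM; first by rewrite ler_pM// (le_trans h1).
  by rewrite -mulrA ler_pM// (le_trans h2)// ler_wpM2r.
have : blip M (pval q) (\sum_(m : mpoly.bmultinom n k.+1) B * `|K m|).
  by move=> s s' t; rewrite !E; exact: bs.
by apply: blip_le; rewrite -mulr_sumr mulrC ler_wpM2r// lerDl.
Qed.

End Lipschitz.

(** * Affine rescaling of polynomials *)

Section Degree.
Context (R : realType).

Lemma degle_coef n (p : mpoly.mpoly n R) k :
  (forall m, (k < mpoly.mdeg m)%N -> cf m p = 0) -> (mpoly.msize p <= k.+1)%N.
Proof.
move=> h; rewrite mpoly.msizeE big_seq; apply/bigmax_leqP_seq => m mp _.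
rewrite ltnS leqNgt; apply/negP => /h/eqP.
by rewrite mpoly.mcoeff_eq0 mp.
Qed.

Lemma degleD n (p q : mpoly.mpoly n R) k : (mpoly.msize p <= k)%N ->
  (mpoly.msize q <= k)%N -> (mpoly.msize (p + q) <= k)%N.
Proof. by move=> h1 h2; apply: leq_trans (mpoly.mmeasureD_le _ _ _) _; rewrite geq_max h1. Qed.

Lemma degle_sum n (I : Type) (r : seq I) (P : pred I) (F : I -> mpoly.mpoly n R) k :
  (forall i, P i -> (mpoly.msize (F i) <= k)%N) ->
  (mpoly.msize (\sum_(i <- r | P i) F i) <= k)%N.
Proof.
move=> h; apply: (big_ind (fun p => (mpoly.msize p <= k)%N)) => //.
  by rewrite mpoly.mmeasure0.
by move=> p q; exact: degleD.
Qed.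

Lemma degleZ n c (p : mpoly.mpoly n R) k : (mpoly.msize p <= k)%N ->
  (mpoly.msize (c *: p) <= k)%N.
Proof. by move=> h; apply: leq_trans (mpoly.msizeZ_le _ _) _. Qed.

Lemma degleM n (p q : mpoly.mpoly n R) k l : (mpoly.msize p <= k.+1)%N ->
  (mpoly.msize q <= l.+1)%N -> (mpoly.msize (p * q) <= (k + l).+1)%N.
Proof.
have [->|p0] := eqVneq p 0; first by rewrite mul0r mpoly.mmeasure0.
have [->|q0] := eqVneq q 0; first by rewrite mulr0 mpoly.mmeasure0.
move=> hp hq; rewrite mpoly.msizeM//.
by have := leq_add hp hq; rewrite addSn addnS; case: (_ + _)%N.
Qed.

Lemma degle_prod n (I : Type) (r : seq I) (F : I -> mpoly.mpoly n R) (d : I -> nat) :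
  (forall i, (mpoly.msize (F i) <= (d i).+1)%N) ->
  (mpoly.msize (\prod_(i <- r) F i) <= (\sum_(i <- r) d i).+1)%N.
Proof.
move=> h; elim: r => [|i r IHr]; first by rewrite !big_nil mpoly.msize1.
by rewrite !big_cons degleM.
Qed.

Lemma degle_exp n (p : mpoly.mpoly n R) k e : (mpoly.msize p <= k.+1)%N ->
  (mpoly.msize (p ^+ e) <= (k * e).+1)%N.
Proof.
move=> hp; elim: e => [|e IHe]; first by rewrite expr0 mpoly.msize1.
by rewrite exprS mulnS degleM.
Qed.

Lemma degleC n (c : R) k : (mpoly.msize (mpoly.mpolyC n c) <= k.+1)%N.
Proof.
apply: degle_coef => m mk; rewrite mpoly.mcoeffC.
by case: eqP mk => [->|]; rewrite ?mpoly.mdeg0// mulr0.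
Qed.

Lemma degleX n (i : 'I_n) : (mpoly.msize (polyX R i) <= 2)%N.
Proof. by rewrite mpoly.msizeX mpoly.mdeg1. Qed.

Lemma degle_deriv n (p : mpoly.mpoly n R) k j : (mpoly.msize p <= k.+1)%N ->
  (mpoly.msize (mpoly.mderiv j p) <= k.+1)%N.
Proof.
move=> hp; apply: degle_coef => m mk; rewrite mpoly.mcoeff_mderiv.
rewrite mpoly.memN_msupp_eq0 ?mul0rn//; apply: mpoly.msize_mdeg_ge.
by rewrite (leq_trans hp)// mpoly.mdegD mpoly.mdeg1 addn1 ltnW.
Qed.

End Degree.

Section Rescale.
Context (R : realType) (n : nat).
Local Notation poly := (mpoly.mpoly n R).

Definition affX (a : 'rV[R]_n) (r : R) (i : 'I_n) : poly :=
  mpoly.mpolyC n (a 0 i) + r *: polyX R i.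

Definition rescale (a : 'rV[R]_n) (r : R) (p : poly) : poly :=
  mpoly.comp_mpoly [tuple affX a r i | i < n] p.

Lemma pval_rescale a r p s : pval (rescale a r p) s = pval p (a + r *: s).
Proof.
rewrite /pval /rescale mpoly.comp_mpoly_meval; apply: mpoly.meval_eq => i.
by rewrite tnth_mktuple mpoly.mevalD mpoly.mevalZ mpoly.mevalC mpoly.mevalXU !mxE.
Qed.

Lemma pval_unscale a r p x : r != 0 -> pval p x = pval (rescale a r p) (unscale a r x).
Proof.
by move=> r0; rewrite pval_rescale /unscale scalerA divff// scale1r addrC subrK.
Qed.

Lemma degle_rescale a r p k : (mpoly.msize p <= k.+1)%N ->
  (mpoly.msize (rescale a r p) <= k.+1)%N.
Proof.
move=> hp; rewrite /rescale mpoly.comp_mpolyEX big_seq; apply: degle_sum => m mp.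
apply: degleZ; rewrite mpoly.comp_mpolyX.
have mk : (mpoly.mdeg m <= k)%N by have := mpoly.msize_mdeg_lt mp; move/leq_trans/(_ hp).
apply: (@leq_trans (\sum_(i < n) 1 * m i).+1).
  apply: degle_prod => i; apply: degle_exp; rewrite tnth_mktuple.
  by apply: degleD; [exact: degleC|apply: degleZ; exact: degleX].
by rewrite ltnS (leq_trans _ mk)// mpoly.mdegE leq_sum// => i _; rewrite mul1n.
Qed.

(** Both sides are derivations along the algebra morphism rescale. *)
Lemma mderiv_rescale a r p j :
  mpoly.mderiv j (rescale a r p) = r *: rescale a r (mpoly.mderiv j p).
Proof.
pose D := fun p => mpoly.mderiv j (rescale a r p) = r *: rescale a r (mpoly.mderiv j p).
have D1 : D 1.
  by rewrite /D /rescale rmorph1 -mpoly.mpolyC1 mpoly.mderivC linear0 scaler0.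
have DM p' q' : D p' -> D q' -> D (p' * q').
  rewrite /D /rescale => hp hq.
  rewrite rmorphM/= [LHS]mpoly.mderivM hp hq mpoly.mderivM rmorphD/= !rmorphM/=.
  by rewrite scalerDr -scalerAl -scalerAr.
have DX i : D (polyX R i).
  rewrite /D /rescale mpoly.comp_mpolyX mpoly.mderivX.
  have E : \prod_(k < n) tnth [tuple affX a r i | i < n] k ^+ mpoly.mnm1 i k = affX a r i.
    rewrite (bigD1 i)//= big1 ?mulr1; last first.
      by move=> k ki; rewrite mpoly.mnm1E eq_sym (negbTE ki).
    by rewrite mpoly.mnm1E eqxx tnth_mktuple.
  rewrite E /affX mpoly.mderivD mpoly.mderivC add0r mpoly.mderivZ mpoly.mderivX.
  rewrite linearZ/= mpoly.mnm1E; case: eqP => [->|_]; last by rewrite !scale0r mpoly.comp_mpoly0 scaler0.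
  rewrite !scale1r; congr (_ *: _).
  have -> : (mpoly.mnm_sub (mpoly.mnm1 j) (mpoly.mnm1 j) = mpoly.mnm0 :> mpoly.multinom n).
    by apply/mpoly.mnmP => k; rewrite mpoly.mnmBE subnn mpoly.mnm0E.
  by rewrite mpoly.mpolyX0 rmorph1.
have Dexp p' e : D p' -> D (p' ^+ e).
  by move=> hp; elim: e => [|e IHe]; rewrite ?expr0// exprS; exact: DM.
have DD p' q' : D p' -> D q' -> D (p' + q').
  rewrite /D /rescale => hp hq; rewrite mpoly.comp_mpolyD mpoly.mderivD hp hq.
  by rewrite mpoly.mderivD mpoly.comp_mpolyD scalerDr.
have DZ c p' : D p' -> D (c *: p').
  rewrite /D /rescale => hp; rewrite mpoly.comp_mpolyZ mpoly.mderivZ hp.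
  by rewrite mpoly.mderivZ mpoly.comp_mpolyZ !scalerA mulrC.
have D0 : D 0 by rewrite -(scale0r 1); exact: DZ.
suff : D p by [].
rewrite (mpoly.mpolyE p); apply: (big_ind D) => // m _; apply: DZ.
rewrite mpoly.mpolyXE_id.
by apply: (big_ind D) => // i _; exact: Dexp.
Qed.

End Rescale.

(** * Korn's inequality for polynomials *)

Section Korn.
Context (R : realType) (n : nat).
Local Notation poly := (mpoly.mpoly n R).
Implicit Types (v : 'I_n -> poly).

(** Twice the symmetric gradient. *)
Definition strain v i j : poly := mpoly.mderiv j (v i) + mpoly.mderiv i (v j).

(** The skew part of the gradient at the origin. *)
Definition spin v i j : R := (cf (mpoly.mnm1 j) (v i) - cf (mpoly.mnm1 i) (v j)) / 2.

(** The infinitesimal rigid motion tangent to v at the origin. *)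
Definition rigid v i : poly :=
  mpoly.mpolyC n (cf mpoly.mnm0 (v i)) + \sum_j spin v i j *: polyX R j.

Lemma spin_skew v i j : spin v i j = - spin v j i.
Proof. by rewrite /spin -mulNr opprB. Qed.

Lemma pval_rigid v i s :
  pval (rigid v i) s = cf mpoly.mnm0 (v i) + \sum_j spin v i j * s 0 j.
Proof.
rewrite /pval mpoly.mevalD mpoly.mevalC; congr (_ + _).
rewrite (big_morph _ (mpoly.mevalD _) (mpoly.meval0 _)).
by apply: eq_bigr => j _; rewrite mpoly.mevalZ mpoly.mevalXU.
Qed.

Lemma mderiv_rigid v i j : mpoly.mderiv j (rigid v i) = mpoly.mpolyC n (spin v i j).
Proof.
rewrite mpoly.mderivD mpoly.mderivC add0r raddf_sum/= (bigD1 j)//= big1 ?addr0.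
  rewrite mpoly.mderivZ mpoly.mderivX mpoly.mnm1E eqxx scale1r.
  have -> : (mpoly.mnm_sub (mpoly.mnm1 j) (mpoly.mnm1 j) = mpoly.mnm0 :> mpoly.multinom n).
    by apply/mpoly.mnmP => k; rewrite mpoly.mnmBE subnn mpoly.mnm0E.
  by rewrite mpoly.mpolyX0 -mpoly.mul_mpolyC mulr1.
by move=> k kj; rewrite mpoly.mderivZ mpoly.mderivX mpoly.mnm1E (negbTE kj) scale0r scaler0.
Qed.

Lemma degle_rigid v i k : (0 < k)%N -> (mpoly.msize (rigid v i) <= k.+1)%N.
Proof.
move=> k0; apply: degleD; first exact: degleC.
by apply: degle_sum => j _; apply: degleZ; apply: leq_trans (degleX _ _) _.
Qed.

(** The second derivatives of v are combinations of first derivatives of its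
    strain, so all coefficients of degree at least two are controlled; the
    coefficients of degree one are the spin plus half the strain. *)
Lemma korn_coef k v (B : R) : (forall i, mpoly.msize (v i) <= k.+1)%N ->
  (forall i j m, `|cf m (strain v i j)| <= B) ->
  forall i m, `|cf m (v i - rigid v i)| <= 2 * k.+1%:R * B.
Proof.
move=> vk vB i m.
have B0 : 0 <= B by apply: le_trans (vB i i m).
have kB0 : 0 <= 2 * k.+1%:R * B by rewrite !mulr_ge0.
have cr : cf m (rigid v i) = cf mpoly.mnm0 (v i) * (m == mpoly.mnm0)%:R +
    \sum_j spin v i j * (mpoly.mnm1 j == m)%:R.
  rewrite mpoly.mcoeffD mpoly.mcoeffC raddf_sum/=; congr (_ + _).
  by apply: eq_bigr => j _; rewrite mpoly.mcoeffZ mpoly.mcoeffX.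
have cd j p m' : cf m' (mpoly.mderiv j p) =
    cf (mpoly.mnm_add m' (mpoly.mnm1 j)) p *+ (m' j).+1 :> R by exact: mpoly.mcoeff_mderiv.
case E : (mpoly.mdeg m) => [|[|e]].
- move/eqP: E; rewrite mpoly.mdeg_eq0 => /eqP m0.
  rewrite mpoly.mcoeffB cr m0 eqxx mulr1 big1 ?addr0 ?subrr ?normr0//.
  move=> j _; rewrite (_ : _ == _ = false) ?mulr0//.
  by apply/eqP => /(congr1 (@mpoly.mdeg n)); rewrite mpoly.mdeg1 mpoly.mdeg0.
- move/eqP: E; rewrite mpoly.mdeg_eq1 => /existsP[j /eqP mj].
  rewrite mpoly.mcoeffB cr mj (_ : _ == _ = false); last first.
    by apply/eqP => /(congr1 (@mpoly.mdeg n)); rewrite mpoly.mdeg1 mpoly.mdeg0.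
  rewrite mulr0 add0r (bigD1 j)//= eqxx mulr1 big1 ?addr0; last first.
    move=> l lj; rewrite (_ : _ == _ = false) ?mulr0//.
    apply/eqP => /(congr1 (fun m : mpoly.multinom n => m l)).
    by rewrite !mpoly.mnm1E eqxx eq_sym (negbTE lj).
  have := vB i j mpoly.mnm0.
  rewrite mpoly.mcoeffD !cd !mpoly.mnm0E !mulr1n.
  have add0 l : mpoly.mnm_add mpoly.mnm0 (mpoly.mnm1 l) = mpoly.mnm1 l :> mpoly.multinom n.
    by apply/mpoly.mnmP => l'; rewrite mpoly.mnmDE mpoly.mnm0E.
  rewrite !add0 => h.
  have -> : cf (mpoly.mnm1 j) (v i) - spin v i j =
      (cf (mpoly.mnm1 j) (v i) + cf (mpoly.mnm1 i) (v j)) / 2 by rewrite /spin; field.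
  rewrite normrM [`|2^-1|]ger0_norm ?invr_ge0//.
  rewrite ler_pdivrMr//; apply: le_trans h _.
  have : B <= k.+1%:R * B by rewrite ler_peMl// ler1n.
  lra.
- have [l ml] : exists l, (0 < m l)%N.
    apply/existsP; apply: contraTT isT; rewrite negb_exists => /forallP h.
    have : mpoly.mdeg m = 0%N.
      by rewrite mpoly.mdegE big1// => l _; apply/eqP; have := h l; rewrite -eqn0Ngt.
    by rewrite E.
  pose m1 := mpoly.mnm_sub m (mpoly.mnm1 l).
  have m1E : m = mpoly.mnm_add m1 (mpoly.mnm1 l).
    by rewrite mpoly.submK// mpoly.lep1mP -lt0n.
  have dm1 : mpoly.mdeg m1 = e.+1.
    by move: E; rewrite m1E mpoly.mdegD mpoly.mdeg1 addn1 => -[].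
  have [h mh] : exists h, (0 < m1 h)%N.
    apply/existsP; apply: contraTT isT; rewrite negb_exists => /forallP hh.
    have : mpoly.mdeg m1 = 0%N.
      by rewrite mpoly.mdegE big1// => l' _; apply/eqP; have := hh l'; rewrite -eqn0Ngt.
    by rewrite dm1.
  pose m2 := mpoly.mnm_sub m1 (mpoly.mnm1 h).
  have m2E : m1 = mpoly.mnm_add m2 (mpoly.mnm1 h).
    by rewrite mpoly.submK// mpoly.lep1mP -lt0n.
  have -> : cf m (v i - rigid v i) = cf m (v i).
    rewrite mpoly.mcoeffB cr (_ : m == _ = false); last first.
      by apply/eqP => m0; move: E; rewrite m0 mpoly.mdeg0.
    rewrite mulr0 add0r big1 ?subr0// => j _; rewrite (_ : _ == _ = false) ?mulr0//.
    by apply/eqP => m0; move: E; rewrite -m0 mpoly.mdeg1.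
  have [mk|mk] := leqP k.+1 (mpoly.mdeg m).
    rewrite mpoly.memN_msupp_eq0 ?normr0//.
    by apply: mpoly.msize_mdeg_ge; rewrite (leq_trans (vk i)).
  (* the same combination as for Christoffel symbols *)
  have d2 : mpoly.mderiv l (strain v i h) + mpoly.mderiv h (strain v i l)
      - mpoly.mderiv i (strain v h l) = mpoly.mderiv h (mpoly.mderiv l (v i)) *+ 2.
    rewrite /strain !mpoly.mderivD.
    rewrite (mpoly.mderiv_comm h l (v i)) (mpoly.mderiv_comm i l (v h)).
    rewrite (mpoly.mderiv_comm i h (v l)) mulr2n.
    by move: (mpoly.mderiv l _) (mpoly.mderiv l _) => x y; ring.
  have bd p j : (forall m', `|cf m' p| <= B) -> `|cf m2 (mpoly.mderiv j p)| <= k.+1%:R * B.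
    move=> hp; rewrite cd normrMn -[leLHS]mulr_natl ler_pM// ler_nat ltnS.
    have : (m2 j <= mpoly.mdeg m2)%N by rewrite mpoly.mdegE (bigD1 j)//= leq_addr.
    move/leq_trans; apply; rewrite -ltnS (leq_trans _ mk)// m1E m2E !mpoly.mdegD.
    by rewrite -addnA ltnS leq_addr.
  have := congr1 (mpoly.mcoeff m2) d2.
  rewrite mpoly.mcoeffB mpoly.mcoeffD mpoly.mcoeffMn.
  rewrite [in RHS]cd [in RHS]cd -m2E -m1E -mulrnA -mulrnA => e2.
  have b1 := bd _ l (vB i h); have b2 := bd _ h (vB i l); have b3 := bd _ i (vB h l).
  have : `|cf m (v i) *+ ((m1 l).+1 * ((m2 h).+1 * 2))| <= 3 * (k.+1%:R * B).
    rewrite -e2; apply: le_trans (ler_normB _ _) _.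
    have := ler_normD (cf m2 (mpoly.mderiv l (strain v i h)))
                      (cf m2 (mpoly.mderiv h (strain v i l))).
    lra.
  rewrite normrMn => hh.
  have : `|cf m (v i)| *+ 2 <= 3 * (k.+1%:R * B).
    apply: le_trans hh; by rewrite ler_wpMn2l// mulnA leq_pmull.
  have := kB0; rewrite mulr2n; lra.
Qed.

End Korn.

(** * Euclidean norm *)

Section EuclideanNorm.
Context (R : realType) (n : nat).
Implicit Types x y : 'rV[R]_n.

Lemma sqr_normr (t : R) : `|t| ^+ 2 = t ^+ 2.
Proof. by rewrite real_normK// num_real. Qed.

Lemma dotv_ge0 x : 0 <= dotv x x.
Proof. by apply: sumr_ge0 => i _; rewrite -expr2 sqr_ge0. Qed.

Lemma enorm_sqr x : enorm x ^+ 2 = dotv x x.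
Proof. by rewrite sqr_sqrtr// dotv_ge0. Qed.

Lemma enorm_ge0 x : 0 <= enorm x. Proof. exact: sqrtr_ge0. Qed.

Lemma coord_sqr_le x i : x 0 i ^+ 2 <= dotv x x.
Proof.
rewrite /dotv (bigD1 i)//= -expr2 lerDl sumr_ge0// => j _.
by rewrite -expr2 sqr_ge0.
Qed.

Lemma coord_le_enorm x i : `|x 0 i| <= enorm x.
Proof.
by rewrite -ler_sqr ?nnegrE ?enorm_ge0// enorm_sqr sqr_normr coord_sqr_le.
Qed.

Lemma dotv_le x B : (forall i, `|x 0 i| <= B) -> dotv x x <= n%:R * B ^+ 2.
Proof.
move=> xB; apply: (@le_trans _ _ (\sum_(i < n) B ^+ 2)).
  apply: ler_sum => i _; rewrite -expr2 -sqr_normr ler_sqr ?nnegrE//.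
  exact: le_trans (xB i).
by rewrite sumr_const card_ord mulr_natl.
Qed.

Lemma dotv_addC x y : dotv (x + y) (x + y) <= 2 * dotv x x + 2 * dotv y y.
Proof.
rewrite /dotv !mulr_sumr -big_split/=; apply: ler_sum => i _; rewrite !mxE.
have := sqr_ge0 (x 0 i - y 0 i); lra.
Qed.

Lemma dotvZ t x y : dotv (t *: x) (t *: y) = t ^+ 2 * dotv x y.
Proof. by rewrite /dotv mulr_sumr; apply: eq_bigr => i _; rewrite !mxE; ring. Qed.

Lemma dotv_eq0 x : (dotv x x == 0) = (x == 0).
Proof.
apply/eqP/eqP => [x0|->]; last first.
  by rewrite /dotv big1// => i _; rewrite mxE mul0r.
apply/rowP => i; rewrite mxE; apply/eqP.
by rewrite -sqrf_eq0 eq_le sqr_ge0 andbT -x0 coord_sqr_le.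
Qed.

Lemma normalize_le1 x i : `|((enorm x)^-1 *: x) 0 i| <= 1.
Proof.
rewrite mxE normrM normfV (ger0_norm (enorm_ge0 x)).
have [->|x0] := eqVneq (enorm x) 0; first by rewrite invr0 mul0r.
have xp : 0 < enorm x by rewrite lt_def x0 enorm_ge0.
by rewrite mulrC ler_pdivrMr// mul1r coord_le_enorm.
Qed.

End EuclideanNorm.

(** * Multilinear maps of the cube *)

Section Multilinear.
Context (R : realType) (n : nat).
Implicit Types (V : {set 'I_n} -> 'rV[R]_n) (x y z : 'rV[R]_n).

Definition cubewt (b : {set 'I_n}) x : R :=
  \prod_i (if i \in b then x 0 i else 1 - x 0 i).

Lemma multilinearE V x j : multilinear V x 0 j = \sum_b cubewt b x * V b 0 j.
Proof. by rewrite summxE; apply: eq_bigr => b _; rewrite mxE. Qed.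

Lemma cubewt_sum x : \sum_b cubewt b x = 1.
Proof.
have := @bigA_distr R 0 1 *%R +%R 'I_n (fun i => x 0 i) (fun i => 1 - x 0 i).
by rewrite /cubewt => <-; rewrite big1// => i _; rewrite /= addrC subrK.
Qed.

Lemma cubewt_ge0 b x : cube x -> 0 <= cubewt b x.
Proof.
move=> hx; apply: prodr_ge0 => i _; have /andP[h1 h2] := hx i.
by case: ifP => // _; rewrite subr_ge0.
Qed.

(** The edges in direction k, arranged as vertex data that do not depend on the
    k-th coordinate: multilinear (dmult k V) is then the k-th partial derivative
    of multilinear V. *)
Definition dmult k V (b : {set 'I_n}) := V (k |: b) - V (b :\ k).

Definition cubevertex (b : {set 'I_n}) : 'rV[R]_n := \row_i (i \in b)%:R.

Lemma cubevertex_in b : cube (cubevertex b).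
Proof. by move=> i; rewrite mxE; case: (i \in b); rewrite lexx ler01. Qed.

Lemma multilinear_vertex V b : multilinear V (cubevertex b) = V b.
Proof.
rewrite /multilinear (bigD1 b)//= [X in _ + X]big1 ?addr0.
  rewrite big1 ?scale1r// => i _; rewrite mxE; case: (i \in b) => //=.
  by rewrite subr0.
move=> c cb; have [i hi] : exists i, (i \in c) != (i \in b).
  apply/existsP; apply: contraNT cb; rewrite negb_exists => /forallP h.
  by apply/eqP/finset.setP => i; have := h i; rewrite negbK => /eqP.
rewrite (bigD1 i)//= mxE; move: hi; case: (i \in c); case: (i \in b) => //= _.
  by rewrite mul0r scale0r.
by rewrite subrr mul0r scale0r.
Qed.

(** Grouping the vertices by edges in the direction k. *)
Lemma multilinear_edges V (k : 'I_n) x : multilinear V x =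
  \sum_(b : {set 'I_n} | k \notin b)
    (\prod_(i | i != k) (if i \in b then x 0 i else 1 - x 0 i)) *:
    ((1 - x 0 k) *: V b + x 0 k *: V (k |: b)).
Proof.
rewrite /multilinear (bigID (fun b : {set 'I_n} => k \in b))/= addrC.
under [RHS]eq_bigr => b _ do rewrite scalerDr.
rewrite [RHS]big_split/=; congr (_ + _).
  by apply: eq_bigr => b kb; rewrite (bigD1 k)//= (negbTE kb) scalerA mulrC.
rewrite (reindex_onto (fun b => k |: b) (fun b => b :\ k))/=; last first.
  by move=> b kb; rewrite finset.setD1K.
apply: eq_big => [b|b /andP[_ /eqP bk]].
  rewrite finset.setU11/=; apply/eqP/idP => [<-|kb]; first by rewrite !inE eqxx.
  by rewrite finset.setU1K.
rewrite (bigD1 k)//= finset.setU11 scalerA mulrC; congr (_ * _ *: _).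
by apply: eq_bigr => i ik; rewrite !inE (negbTE ik).
Qed.

Lemma multilinear_coord V (k : 'I_n) x y : (forall i, i != k -> y 0 i = x 0 i) ->
  multilinear V y - multilinear V x = (y 0 k - x 0 k) *: multilinear (dmult k V) x.
Proof.
move=> xy; rewrite !(multilinear_edges _ k) -sumrB scaler_sumr.
apply: eq_bigr => b kb.
have -> : \prod_(i | i != k) (if i \in b then y 0 i else 1 - y 0 i) =
          \prod_(i | i != k) (if i \in b then x 0 i else 1 - x 0 i).
  by apply: eq_bigr => i /xy ->.
rewrite -scalerBr scalerA [in RHS]mulrC -scalerA; congr (_ *: _).
have E : b :\ k = b by apply/finset.setDidPl; rewrite disjoint_sym finset.disjoints1.
rewrite /dmult E finset.setUA finset.setUid finset.setU1K// -scalerDl subrK scale1r.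
apply/rowP => j; rewrite !mxE; ring.
Qed.

Lemma dmult_close k V (h : R) : (forall b b' j, `|V b 0 j - V b' 0 j| <= h) ->
  forall b b' j, `|dmult k V b 0 j - dmult k V b' 0 j| <= 2 * h.
Proof.
move=> Vh b b' j; rewrite !mxE.
have h1 := Vh (k |: b) (b :\ k) j; have h2 := Vh (k |: b') (b' :\ k) j.
apply: le_trans (ler_normB _ _) _; lra.
Qed.

Lemma multilinear_lip : exists C : R, 0 < C /\ forall V (h : R), 0 <= h ->
  (forall b b' j, `|V b 0 j - V b' 0 j| <= h) ->
  forall x y (t : R), cube x -> cube y -> 0 <= t -> (forall i, `|x 0 i - y 0 i| <= t) ->
  forall j, `|multilinear V x 0 j - multilinear V y 0 j| <= C * h * t.
Proof.
have wl b : exists C : R, blip 1 (cubewt b) C.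
  apply: blip_prod => i _; case: (i \in b).
    by exists (Num.max 1 1); exact: (@blip_coord R n 1 i).
  exists (`|1| + 2 * (`|-1| * Num.max 1 1)).
  have h : blip 1 (fun s : 'rV[R]_n => 1 + (-1) * s 0 i) (`|1| + 2 * (`|-1| * Num.max 1 1)).
    apply: blipD; [exact: blip_cst|apply: blipM; [exact: blip_cst|]].
    exact: (@blip_coord R n 1 i).
  by move=> s s' t a1 a2 a3 a4; have := h s s' t a1 a2 a3 a4; rewrite !mulN1r.
have [C HC] := choice wl.
exists (\sum_b `|C b| + 1); split; first by rewrite ltr_wpDl// sumr_ge0.
move=> V h h0 Vh x y t cx cy t0 xyt j.
have c1 z : cube z -> forall i, `|z 0 i| <= 1.
  by move=> cz i; have /andP[z0 z1] := cz i; rewrite ger0_norm.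
have -> : multilinear V x 0 j - multilinear V y 0 j =
    \sum_b (cubewt b x - cubewt b y) * (V b 0 j - V finset.set0 0 j).
  rewrite !multilinearE -sumrB.
  under [RHS]eq_bigr => b _ do rewrite mulrBr.
  rewrite [RHS]sumrB -mulr_suml [X in _ = _ - X * _]sumrB !cubewt_sum.
  rewrite subrr mul0r subr0.
  by apply: eq_bigr => b _; rewrite mulrBl.
apply: le_trans (ler_norm_sum _ _ _) _.
rewrite -mulrA mulrDl mul1r mulr_suml; apply: (@le_trans _ _ (\sum_b `|C b| * (h * t))).
  apply: ler_sum => b _; rewrite normrM [h * t]mulrC mulrA ler_pM//.
  have [_ /le_trans] := HC b x y t (c1 x cx) (c1 y cy) t0 xyt.
  by apply; rewrite ler_wpM2r// ler_norm.
by rewrite lerDl mulr_ge0.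
Qed.

Definition multjac V x : 'M[R]_n := \matrix_k multilinear (dmult k V) x.

(** First order Taylor estimate, by changing one coordinate at a time. *)
Lemma multilinear_taylor : exists C : R, 0 < C /\ forall V (h : R), 0 <= h ->
  (forall b b' j, `|V b 0 j - V b' 0 j| <= h) ->
  forall x y (t : R), cube x -> cube y -> 0 <= t -> (forall i, `|y 0 i - x 0 i| <= t) ->
  forall j, `|(multilinear V y - multilinear V x - (y - x) *m multjac V x) 0 j|
     <= C * h * t ^+ 2.
Proof.
have [C [C0 HC]] := multilinear_lip.
exists (n%:R * (C * 2) + 1); split.
  by rewrite ltr_wpDl// mulr_ge0// mulr_ge0// ltW.
move=> V h h0 Vh x y t cx cy t0 xyt j.
pose hyb (k : nat) : 'rV[R]_n := \row_i (if (i < k)%N then y 0 i else x 0 i).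
have chyb k : cube (hyb k) by move=> i; rewrite mxE; case: ifP.
have hyb0 : hyb 0%N = x by apply/rowP => i; rewrite mxE.
have hybn : hyb n = y by apply/rowP => i; rewrite mxE ltn_ord.
have step (k : 'I_n) : multilinear V (hyb k.+1) - multilinear V (hyb k) =
    (y 0 k - x 0 k) *: multilinear (dmult k V) (hyb k).
  rewrite (@multilinear_coord V k (hyb k)); last first.
    move=> i ik; have ik' : (i != k :> nat) by exact: ik.
    by rewrite !mxE ltnS leq_eqVlt (negbTE ik').
  by rewrite !mxE ltnS leqnn ltnn.
have -> : multilinear V y - multilinear V x - (y - x) *m multjac V x =
    \sum_k (y 0 k - x 0 k) *: (multilinear (dmult k V) (hyb k) - multilinear (dmult k V) x).
  under [RHS]eq_bigr => k _ do rewrite scalerBr.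
  rewrite sumrB; congr (_ - _).
    rewrite -[in LHS]hybn -[in LHS]hyb0.
    rewrite -(@telescope_sumr _ 0 n (fun k => multilinear V (hyb k)))// big_mkord.
    by apply: eq_bigr => k _; rewrite -step.
  rewrite mulmx_sum_row; apply: eq_bigr => k _; rewrite !mxE; congr (_ *: _).
  by rewrite rowK.
rewrite summxE; apply: le_trans (ler_norm_sum _ _ _) _.
apply: (@le_trans _ _ (\sum_(k < n) C * 2 * (h * t ^+ 2))).
  apply: ler_sum => k _; rewrite !mxE normrM.
  have -> : C * 2 * (h * t ^+ 2) = t * (C * (2 * h) * t) by ring.
  rewrite ler_pM//; apply: HC => //.
  - by rewrite mulr_ge0.
  - exact: dmult_close.
  - by move=> i; rewrite mxE; case: ifP => _ //; rewrite subrr normr0.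
have ht : 0 <= h * t ^+ 2 by rewrite mulr_ge0// sqr_ge0.
rewrite sumr_const card_ord -[leLHS]mulr_natl; lra.
Qed.

Lemma differentiable_multilinear V x : differentiable (multilinear V) x.
Proof.
have dw b : differentiable (cubewt b) x.
  rewrite /cubewt; elim: index_enum => [|i s IHs].
    rewrite (_ : (fun _ => _) = cst 1); first exact: differentiable_cst.
    by apply/funext => y; rewrite big_nil.
  rewrite (_ : (fun _ => _) = (fun y : 'rV[R]_n => if i \in b then y 0 i else 1 - y 0 i) *
     (fun y : 'rV[R]_n => \prod_(i <- s) (if i \in b then y 0 i else 1 - y 0 i))); last first.
    by apply/funext => y; rewrite big_cons fctE.
  apply: differentiableM => //; case: (i \in b); first exact: differentiable_coord.
  rewrite (_ : (fun _ => _) = cst 1 - (fun y : 'rV[R]_n => y 0 i : R)); last first.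
    by apply/funext => y; rewrite fctE.
  by apply: differentiableB; [exact: differentiable_cst|exact: differentiable_coord].
rewrite /multilinear; elim: index_enum => [|b s IHs].
  rewrite (_ : (fun _ => _) = cst 0); first exact: differentiable_cst.
  by apply/funext => y; rewrite big_nil.
rewrite (_ : (fun _ => _) = (fun y : 'rV[R]_n => cubewt b y *: V b) +
   (fun y => \sum_(b <- s) cubewt b y *: V b)); last first.
  by apply/funext => y; rewrite big_cons fctE.
by apply: differentiableD => //; exact: differentiableZl.
Qed.

Lemma continuous_multilinear V : continuous (multilinear V).
Proof. by move=> x; exact: (differentiable_continuous (differentiable_multilinear V x)). Qed.

Lemma jacobian_multilinear V x : jacobian (multilinear V) x = multjac V x.
Proof.
apply/row_matrixP => k; rewrite [RHS]rowK rowE -deriveEjacobian; last first.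
  exact: differentiable_multilinear.
rewrite /derive; apply: cvg_lim; first exact: norm_hausdorff.
apply: cvg_trans (cvg_cst (multilinear (dmult k V) x)).
apply: near_eq_cvg; near=> h; rewrite /=.
have h0 : h != 0 by near: h; exact: nbhs_dnbhs_neq.
rewrite (@multilinear_coord V k x); last first.
  by move=> i ik; rewrite !mxE eqxx (negbTE ik) mulr0 add0r.
by rewrite !mxE !eqxx mulr1 addrK scalerA mulVf// scale1r.
Unshelve. all: end_near || exact: (dnbhs_filter _). Qed.

End Multilinear.

(** * Elements: compactness, diameter, measurability, inscribed boxes *)

Section Diameter.
Context (R : realType) (n : nat).
Implicit Types (X : set 'rV[R]_n).

Definition coord_bounded X := exists B, forall x, X x -> forall i, `|x 0 i| <= B.

Lemma enorm_le (x : 'rV[R]_n) B : 0 <= B -> (forall i, `|x 0 i| <= B) ->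
  enorm x <= n%:R * B.
Proof.
move=> B0 xB; rewrite -ler_sqr ?nnegrE ?enorm_ge0 ?mulr_ge0//.
rewrite enorm_sqr (le_trans (dotv_le xB))// exprMn ler_wpM2r ?sqr_ge0//.
by rewrite -natrX ler_nat; case: (n) => // m; rewrite leq_pmull.
Qed.

Lemma dotv_subC (x y : 'rV[R]_n) : dotv (x - y) (x - y) = dotv (y - x) (y - x).
Proof. by rewrite -[x - y]opprB -scaleN1r dotvZ sqrrN expr1n mul1r. Qed.

Lemma enorm_le_diam X x y : coord_bounded X -> X x -> X y -> enorm (x - y) <= diam X.
Proof.
move=> [B XB] Xx Xy; apply: ub_le_sup; last by exists (x, y).
exists (n%:R * (`|B| + `|B|)) => _ [[u v] [/= Xu Xv] <-].
apply: enorm_le; first by rewrite addr_ge0.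
move=> i; rewrite !mxE (le_trans (ler_normB _ _))// lerD//.
  exact: le_trans (XB _ Xu i) (ler_norm _).
exact: le_trans (XB _ Xv i) (ler_norm _).
Qed.

Lemma diam_ge0 X x : coord_bounded X -> X x -> 0 <= diam X.
Proof. by move=> bX Xx; apply: le_trans (enorm_le_diam bX Xx Xx); exact: enorm_ge0. Qed.

End Diameter.

Section Element.
Context (R : realType) (n : nat).
Implicit Types (V : {set 'I_n} -> 'rV[R]_n) (x y z : 'rV[R]_n).

(** The element with vertices V. *)
Definition mel V : set 'rV[R]_n := multilinear V @` @cube R n.

Lemma cube_compact : compact (@cube R n).
Proof.
rewrite (_ : @cube R n = [set v : 'rV[R]_n | forall i, [set` `[(0 : R), 1]] (v ord0 i)]).
  by apply: (@rV_compact R n (fun=> [set` `[(0 : R), 1]])) => i; exact: segment_compact.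
by apply/seteqP; split => x /= h i; have := h i; rewrite /= in_itv.
Qed.

Lemma mel_closed V : closed (mel V).
Proof.
apply: compact_closed; first exact: norm_hausdorff.
apply: continuous_compact; last exact: cube_compact.
by apply: continuous_subspaceT; exact: continuous_multilinear.
Qed.

Lemma cubewt_le1 b x : cube x -> `|cubewt b x| <= 1.
Proof.
move=> cx; rewrite ger0_norm ?cubewt_ge0// -(cubewt_sum x) (bigD1 b)//= lerDl.
by apply: sumr_ge0 => c _; exact: cubewt_ge0.
Qed.

Lemma mel_bounded V : coord_bounded (mel V).
Proof.
exists (\sum_b \sum_i `|V b 0 i|) => _ [x cx <-] i.
rewrite multilinearE (le_trans (ler_norm_sum _ _ _))// ler_sum// => b _.
rewrite normrM (bigD1 i)//= (@le_trans _ _ `|V b 0 i|)//.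
  by rewrite ler_piMl// cubewt_le1.
by rewrite lerDl sumr_ge0.
Qed.

Lemma mel_vertex V b : mel V (V b).
Proof. by exists (cubevertex R b); [exact: cubevertex_in|exact: multilinear_vertex]. Qed.

Lemma mel_diam_ge0 V : 0 <= diam (mel V).
Proof. exact: diam_ge0 (mel_bounded V) (mel_vertex V finset.set0). Qed.

Lemma mel_close V x y j : mel V x -> mel V y -> `|x 0 j - y 0 j| <= diam (mel V).
Proof.
move=> Vx Vy; apply: le_trans (enorm_le_diam (mel_bounded V) Vx Vy).
by have := coord_le_enorm (x - y) j; rewrite !mxE.
Qed.

Lemma vertex_close V b b' j : `|V b 0 j - V b' 0 j| <= diam (mel V).
Proof. by apply: mel_close; exact: mel_vertex. Qed.

Lemma cube_grid (k : nat) x : cube x -> exists f : {ffun 'I_n -> 'I_k.+2},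
  cube (\row_i ((f i)%:R / k.+1%:R) : 'rV[R]_n) /\
  forall i, `|x 0 i - (\row_i ((f i)%:R / k.+1%:R) : 'rV[R]_n) 0 i| <= k.+1%:R^-1.
Proof.
move=> cx.
have k0 : 0 < k.+1%:R :> R by rewrite ltr0n.
have ge0 i : 0 <= x 0 i * k.+1%:R by rewrite mulr_ge0//; have /andP[] := cx i.
have tr i : (Num.truncn (x 0 i * k.+1%:R)%R < k.+2)%N.
  have : (Num.truncn (x 0 i * k.+1%:R))%:R <= k.+1%:R :> R.
    apply: le_trans (_ : x 0 i * k.+1%:R <= _).
      by have /andP[] := truncn_itv (ge0 i).
    by rewrite ger_pMl//; have /andP[] := cx i.
  by rewrite ler_nat.
exists [ffun i => Ordinal (tr i)]; split => i; rewrite mxE ffunE/=.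
  rewrite divr_ge0//= ler_pdivrMr// mul1r ler_nat -ltnS; exact: tr.
have /andP[t1 t2] := truncn_itv (ge0 i).
rewrite -[X in `|X - _|](mulfK (lt0r_neq0 k0)) -mulrBl normrM.
have ki : 0 <= k.+1%:R^-1 :> R by rewrite invr_ge0 ler0n.
rewrite [`|_^-1|]ger0_norm// ler_piMl// ger0_norm ?subr_ge0// lerBlDl natr1.
exact: ltW.
Qed.

(** An element is the intersection over k of finite unions of small boxes
    around the images of a grid of mesh width 1 / (k + 1). *)
Lemma mel_measurable V : measurable (tset (mel V)).
Proof.
have [C [C0 HC]] := multilinear_lip R n.
pose L := C * diam (mel V).
pose g k (f : {ffun 'I_n -> 'I_k.+2}) : 'rV[R]_n := \row_i ((f i)%:R / k.+1%:R).
pose bx k f := box (multilinear V (g k f) - const_mx (L / k.+1%:R)) (L / k.+1%:R *+ 2).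
have bxE k f x : bx k f x <-> forall i, `|x 0 i - multilinear V (g k f) 0 i| <= L / k.+1%:R.
  by split => h i; have := h i; rewrite !mxE ler_distl mulr2n addrA subrK.
rewrite (_ : tset _ = \bigcap_k \bigcup_(f in [set f | cube (g k f)]) tset (bx k f)).
  apply: bigcapT_measurable => k; apply: fin_bigcup_measurable => // f _.
  exact: measurable_tbox.
apply/seteqP; split => t /=.
  move=> [z cz zt] k _; have [f [cf zf]] := cube_grid k cz.
  exists f => //; apply/bxE => i; rewrite -zt.
  by apply: HC => //; [exact: mel_diam_ge0|exact: vertex_close].
move=> h; rewrite /tset/= (closure_id (mel V)).1; last exact: mel_closed.
move=> A /nbhs_ballP[e /= e0 eA].
have L0 : 0 <= L by rewrite mulr_ge0// ?mel_diam_ge0// ltW.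
pose k := Num.truncn (L / e).
have [f cf /bxE hf] := h k I.
exists (multilinear V (g k f)); split; first by exists (g k f).
apply: eA; split => // i j; rewrite ord1 /ball/=.
apply: le_lt_trans (hf j) _; rewrite ltr_pdivrMr ?ltr0n// mulrC -ltr_pdivrMr//.
exact: truncnS_gt.
Qed.

Lemma mel_bounded_mset V : bounded_mset (mel V).
Proof. by split; [exact: mel_measurable|exact: mel_bounded]. Qed.

(** The first order condition for a minimum of a quadratic polynomial in t, here
    at an interior point t = 0. *)
Lemma quadratic_min (b c e : R) : 0 < e -> 0 <= c ->
  (forall t, `|t| <= e -> 0 <= 2 * t * b + t ^+ 2 * c) -> b = 0.
Proof.
move=> e0 c0 h; apply/eqP; apply: contraT => b0.
pose s := Num.min (c + 1)^-1 (e / `|b|).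
have nb : 0 < `|b| by rewrite normr_gt0.
have c1 : 0 < c + 1 by rewrite ltr_wpDl.
have s0 : 0 < s by rewrite lt_min invr_gt0 c1 divr_gt0.
have sc : s * c <= 1.
  apply: (@le_trans _ _ ((c + 1)^-1 * c)).
    by rewrite ler_wpM2r// ge_min lexx.
  by rewrite mulrC ler_pdivrMr// mul1r lerDl.
have := h (- s * b).
rewrite normrM normrN (ger0_norm (ltW s0)).
have -> : s * `|b| <= e by rewrite -ler_pdivlMr// ge_min lexx orbT.
move=> /(_ isT).
have -> : 2 * (- s * b) * b + (- s * b) ^+ 2 * c = s * b ^+ 2 * (s * c - 2) by ring.
rewrite pmulr_rge0; last by rewrite mulr_gt0// exprn_even_gt0.
lra.
Qed.

Lemma multjac_unit V x (s : R) : 0 < diam (mel V) ->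
  (forall xi, diam (mel V) * enorm xi <= s * enorm (xi *m multjac V x)) ->
  multjac V x \in unitmx.
Proof.
move=> h0 h; rewrite unitmxE unitfE; apply/det0P => -[v v0 vJ].
have := h v; rewrite vJ.
have -> : enorm (0 : 'rV[R]_n) = 0.
  by apply/eqP; rewrite -sqrf_eq0 enorm_sqr dotv_eq0.
rewrite mulr0 pmulr_rle0// => hv.
have : enorm v == 0 by rewrite eq_le hv enorm_ge0.
by rewrite -sqrf_eq0 enorm_sqr dotv_eq0 (negbTE v0).
Qed.

Definition center : 'rV[R]_n := const_mx 2^-1.

Lemma center_in : cube center.
Proof. by move=> i; rewrite mxE invr_ge0 ler0n/= invf_le1// ler1n. Qed.

(** A quantitative inverse function theorem: for y close to the image of the
    center, the squared distance to y has a minimum on a small cube; it is not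
    on the boundary, where the linear part dominates the Taylor remainder, and
    at an interior minimum the invertible Jacobian forces F(z) = y. *)
Lemma mel_box (sigma : R) : 0 < sigma -> exists rho : R, 0 < rho /\
  forall V, 0 < diam (mel V) ->
  (forall x, cube x -> forall xi,
     diam (mel V) * enorm xi <= sigma * enorm (xi *m multjac V x)) ->
  forall y, (forall j, `|y 0 j - multilinear V center 0 j| <= rho * diam (mel V)) ->
  mel V y.
Proof.
move=> s0; have [C [C0 HC]] := multilinear_taylor R n.
pose N : R := n.+1%:R.
have N0 : 0 < N by rewrite ltr0n.
have nN : n%:R <= N by rewrite ler_nat.
have N1 : 1 <= N by rewrite ler1n.
(* on the cube of half side r the Taylor remainder C h r^2 is small against the
   linear part, at least h r / sigma *)
pose r := Num.min (2^-1) (2 * sigma * C * N)^-1.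
have r0 : 0 < r by rewrite lt_min !invr_gt0 ltr0n/= !mulr_gt0.
have r2 : r <= 2^-1 by rewrite ge_min lexx.
have rC : n%:R * C ^+ 2 * r ^+ 2 <= (4 * sigma ^+ 2)^-1.
  apply: (@le_trans _ _ (N ^+ 2 * C ^+ 2 * r ^+ 2)).
    rewrite ler_wpM2r ?sqr_ge0// ler_wpM2r ?sqr_ge0// (le_trans nN)//.
    by rewrite expr2 ler_peMl// ltW.
  have : r <= (2 * sigma * C * N)^-1 by rewrite ge_min lexx orbT.
  rewrite -ler_sqr ?nnegrE ?invr_ge0 ?(ltW r0) ?mulr_ge0 ?(ltW s0) ?(ltW C0) ?(ltW N0)//.
  move=> /(ler_wpM2l (_ : 0 <= N ^+ 2 * C ^+ 2)) => /(_ _)/le_trans; apply.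
    by rewrite mulr_ge0// sqr_ge0.
  rewrite le_eqVlt; apply/orP; left; apply/eqP; field.
  by rewrite !gt_eqF.
pose rho := r / (8 * sigma * N).
have rho0 : 0 < rho by rewrite divr_gt0// !mulr_gt0.
exists rho; split => // V; set h := diam _ => h0 Jh y yc.
set F := multilinear V; set c := center.
pose K := [set z : 'rV[R]_n | forall i, [set` `[2^-1 - r, 2^-1 + r]] (z ord0 i)].
have Kco : compact K.
  apply: (@rV_compact R n (fun=> [set` `[2^-1 - r, 2^-1 + r]])) => i.
  exact: segment_compact.
have KE z : K z <-> forall i, `|z 0 i - 2^-1| <= r.
  by split => hz i; have := hz i; rewrite /= in_itv/= ler_distl.
have Kc : K c by apply/KE => i; rewrite mxE subrr normr0 ltW.
have Kcube z : K z -> cube z.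
  by move=> /KE hz i; have := hz i; rewrite ler_distl; lra.
pose phi z := dotv (F z - y) (F z - y).
have cj j : continuous (fun u : 'rV[R]_n => (F u - y) 0 j).
  move=> u; rewrite (_ : (fun _ => _) = (fun u => F u 0 j) - cst (y 0 j)); last first.
    by apply/funext => v; rewrite !mxE.
  apply: continuousB; last exact: cst_continuous.
  apply: (@continuous_comp _ _ _ F (fun M : 'rV[R]_n => M 0 j)).
    exact: continuous_multilinear.
  exact: coord_continuous.
have cs (s : seq 'I_n) : continuous (fun u => \sum_(j <- s) (F u - y) 0 j * (F u - y) 0 j).
  elim: s => [|j s IHs] u.
    rewrite (_ : (fun _ => _) = cst 0); first exact: cst_continuous.
    by apply/funext => v; rewrite big_nil.
  rewrite (_ : (fun _ => _) = (fun u => (F u - y) 0 j) * (fun u => (F u - y) 0 j) +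
     (fun u => \sum_(i <- s) (F u - y) 0 i * (F u - y) 0 i)).
    by apply: continuousD; [apply: continuousM; exact: cj|exact: IHs].
  by apply/funext => v; rewrite big_cons.
have cphi : continuous phi by exact: cs.
have [z] : exists2 z, z \in K & forall t, t \in K -> phi z <= phi t.
  apply: compact_EVT_min => //; first by exists c.
  exact: continuous_subspaceT.
rewrite inE => Kz zmin.
have phic : phi c <= n%:R * (rho * h) ^+ 2.
  by apply: dotv_le => j; rewrite !mxE distrC.
have phiz : phi z <= n%:R * (rho * h) ^+ 2 by apply: le_trans phic; apply: zmin; rewrite inE.
have interior i : `|z 0 i - 2^-1| < r.
  rewrite lt_neqAle (KE z).1// andbT; apply/negP => /eqP zr.
  pose w := (z - c) *m multjac V c; pose u := F z - F c.
  have e2 : dotv (u - w) (u - w) <= n%:R * (C * h * r ^+ 2) ^+ 2.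
    apply: dotv_le => j; apply: HC => //; first exact: ltW.
    - exact: vertex_close.
    - exact: center_in.
    - exact: Kcube.
    - exact: ltW.
    - by move=> k; rewrite mxE; exact: (KE z).1.
  have w2 : h ^+ 2 * r ^+ 2 <= sigma ^+ 2 * dotv w w.
    apply: (@le_trans _ _ ((h * enorm (z - c)) ^+ 2)).
      rewrite exprMn ler_wpM2l ?sqr_ge0// enorm_sqr -zr sqr_normr.
      by have := coord_sqr_le (z - c) i; rewrite !mxE.
    rewrite -enorm_sqr -exprMn ler_sqr ?nnegrE ?mulr_ge0 ?enorm_ge0 ?(ltW h0) ?(ltW s0)//.
    by apply: Jh; exact: center_in.
  have w3 : dotv w w <= 2 * dotv u u + 2 * dotv (u - w) (u - w).
    by have := dotv_addC u (w - u); rewrite addrC subrK (dotv_subC w).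
  have u2 : dotv u u <= 2 * phi z + 2 * phi c.
    by have := dotv_addC (F z - y) (y - F c); rewrite addrA subrK (dotv_subC y).
  have h2 : 0 < h ^+ 2 by rewrite exprn_gt0.
  have s2 : 0 < sigma ^+ 2 by rewrite exprn_gt0.
  have rr : 0 < h ^+ 2 * r ^+ 2 by rewrite mulr_gt0// exprn_gt0.
  have q1 : n%:R * (C * h * r ^+ 2) ^+ 2 <= h ^+ 2 * r ^+ 2 * (4 * sigma ^+ 2)^-1.
    have -> : n%:R * (C * h * r ^+ 2) ^+ 2 = h ^+ 2 * r ^+ 2 * (n%:R * C ^+ 2 * r ^+ 2) by ring.
    by rewrite ler_pM2l.
  have q2 : n%:R * (rho * h) ^+ 2 <= h ^+ 2 * r ^+ 2 * (64 * sigma ^+ 2)^-1.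
    have -> : n%:R * (rho * h) ^+ 2 = h ^+ 2 * r ^+ 2 * (64 * sigma ^+ 2)^-1 * (n%:R / N ^+ 2).
      by rewrite /rho; field; rewrite !gt_eqF.
    rewrite ler_piMr//.
      by rewrite mulr_ge0 ?ltW// invr_gt0 mulr_gt0.
    rewrite ler_pdivrMr ?exprn_gt0// mul1r (le_trans nN)// expr2 ler_peMl// ltW.
  pose Z := h ^+ 2 * r ^+ 2 * (64 * sigma ^+ 2)^-1.
  have Z0 : 0 < Z by rewrite mulr_gt0// invr_gt0 mulr_gt0.
  have E1 : h ^+ 2 * r ^+ 2 * (4 * sigma ^+ 2)^-1 = 16 * Z.
    by rewrite /Z; field; rewrite gt_eqF.
  have E2 : h ^+ 2 * r ^+ 2 = sigma ^+ 2 * (64 * Z).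
    by rewrite /Z; field; rewrite gt_eqF.
  rewrite E2 ler_pM2l// in w2; rewrite E1 in q1; rewrite -/Z in q2.
  lra.
pose e := \big[Num.min/r]_i (r - `|z 0 i - 2^-1|).
have e0 : 0 < e.
  by apply: lt_bigmin => // i _; rewrite subr_gt0.
have ei i : e <= r - `|z 0 i - 2^-1| by exact: bigmin_le_cond.
have u0 k : \sum_j (F z - y) 0 j * multjac V z k j = 0.
  pose D := multilinear (dmult k V) z.
  apply: (@quadratic_min _ (dotv D D) e e0); first exact: dotv_ge0.
  move=> t te.
  pose z' := z + t *: delta_mx 0 k : 'rV[R]_n.
  have Kz' : K z'.
    apply/KE => i; rewrite !mxE eqxx/=; case: eqP => [->|_]; last first.
      by rewrite mulr0 addr0; exact: (KE z).1.
    rewrite mulr1 addrAC (le_trans (ler_normD _ _))//.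
    by have := ei k; lra.
  have := zmin z'; rewrite inE => /(_ Kz').
  have FE : F z' = F z + t *: D.
    have := @multilinear_coord _ _ V k z z'.
    rewrite !mxE !eqxx mulr1 addrAC subrr add0r => <-; first by rewrite addrC subrK.
    by move=> i ik; rewrite !mxE eqxx (negbTE ik) mulr0 addr0.
  have -> : phi z' = phi z + (2 * t * (\sum_j (F z - y) 0 j * multjac V z k j) + t ^+ 2 * dotv D D).
    rewrite /phi FE /dotv !mulr_sumr -!big_split/=; apply: eq_bigr => j _.
    by rewrite !mxE; ring.
  by rewrite lerDl.
exists z; first exact: Kcube.
have Ju : multjac V z \in unitmx.
  by apply: (multjac_unit h0) => xi; apply: Jh; exact: Kcube.
apply/eqP; rewrite -subr_eq0.
have : (F z - y) *m (multjac V z)^T = 0.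
  apply/rowP => k; rewrite mxE [RHS]mxE -[RHS](u0 k); apply: eq_bigr => j _.
  by rewrite [_^T _ _]mxE.
move=> /(congr1 (mulmx^~ (invmx (multjac V z)^T))).
by rewrite mul0mx mulmxK ?unitmx_tr// => ->.
Qed.

End Element.

(** * Facets: parametrization, area element, unit normal *)

Section FacetPoint.
Context (R : realType) (n : nat).
Implicit Types (V : {set 'I_n} -> 'rV[R]_n).

Lemma facet_point_in i s (y : 'rV[R]_n.-1) : cube y -> cube (facet_point i s y).
Proof.
move=> cy j; rewrite mxE; case: unliftP => [k _|_]; first exact: cy.
by case: s; rewrite ?lexx ?ler01.
Qed.

Lemma facet_point_lift i s (y : 'rV[R]_n.-1) k : facet_point i s y 0 (lift i k) = y 0 k.
Proof. by rewrite mxE liftK. Qed.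

(** The components of a multilinear map restricted to a facet. *)
Definition facet_poly V (i : 'I_n) (s : bool) (j : 'I_n) : mpoly.mpoly n.-1 R :=
  \sum_(b : {set 'I_n}) V b 0 j *: \prod_l
    (let X := if unlift i l is Some k then polyX R k else mpoly.mpolyC n.-1 s%:R in
     if l \in b then X else 1 - X).

Lemma pval_facet_poly V i s j y :
  pval (facet_poly V i s j) y = multilinear V (facet_point i s y) 0 j.
Proof.
rewrite multilinearE /pval /facet_poly.
rewrite (big_morph _ (mpoly.mevalD _) (mpoly.meval0 _)).
apply: eq_bigr => b _; rewrite mpoly.mevalZ mulrC; congr (_ * _).
rewrite /cubewt (big_morph _ (mpoly.mevalM _) (mpoly.meval1 _)).
apply: eq_bigr => l _; rewrite mxE.
case: (unlift i l) => [k|]; case: (l \in b).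
- by rewrite mpoly.mevalXU.
- by rewrite mpoly.mevalB mpoly.meval1 mpoly.mevalXU.
- by rewrite mpoly.mevalC.
- by rewrite mpoly.mevalB mpoly.meval1 mpoly.mevalC.
Qed.

Lemma degle_facet_poly V i s j : (mpoly.msize (facet_poly V i s j) <= n.+1)%N.
Proof.
apply: degle_sum => b _; apply: degleZ.
apply: (@leq_trans (\sum_(l < n) 1).+1); last by rewrite sum1_card card_ord.
apply: degle_prod => l /=.
have hX : (mpoly.msize (if unlift i l is Some k then polyX R k
    else mpoly.mpolyC n.-1 s%:R : mpoly.mpoly n.-1 R) <= 2)%N.
  by case: (unlift i l) => [k|]; [exact: degleX|exact: degleC].
case: (l \in b) => //; apply: degleD; first by rewrite -mpoly.mpolyC1 degleC.
by rewrite -scaleN1r degleZ.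
Qed.

Lemma bmeas_facet X V i s j : bounded_mset X ->
  bmeas X (fun y => multilinear V (facet_point i s y) 0 j).
Proof.
move=> bX; apply: bmeas_ext (bmeas_pval (facet_poly V i s j) bX) => y _.
exact: pval_facet_poly.
Qed.

Lemma cubeE : @cube R n = box 0 1.
Proof. by apply/seteqP; split => x /= h i; have := h i; rewrite mxE add0r. Qed.

Lemma bounded_mset_cube : bounded_mset (@cube R n).
Proof. by rewrite cubeE; exact: bounded_mset_box. Qed.

Lemma cube_vol : fine (lebesgue_tuple R n (tset (@cube R n))) = 1.
Proof. by rewrite cubeE lebesgue_tuple_box// expr1n. Qed.

End FacetPoint.

Section Measurability.
Context (R : realType) (n : nat).
Implicit Types (X : set 'rV[R]_n) (f : 'rV[R]_n -> R).

Definition tmeas X f := measurable_fun (tset X) (fun t => f (tuple_row t)).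

Lemma tmeas_inv X f : tmeas X f -> tmeas X (fun x => (f x)^-1).
Proof.
(* 1 / f = f (f^2)^(-1), where the real power is measurable and inverts numbers
   that are nonnegative *)
move=> mf; rewrite /tmeas (_ : (fun _ => _) = (fun t =>
    f (tuple_row t) * (f (tuple_row t) ^+ 2) `^ (-1))).
  apply: measurable_funM => //.
  apply: (@measurableT_comp _ _ _ _ _ _ (fun x : R => x `^ (-1))).
    exact: measurable_powR.
  exact: measurable_funX.
apply/funext => t; rewrite powR_inv1 ?sqr_ge0// expr2.
have [->|f0] := eqVneq (f (tuple_row t)) 0; first by rewrite invr0 mul0r.
by rewrite invfM mulrA divff// mul1r.
Qed.

Lemma tmeas_sqrt X f : tmeas X f -> tmeas X (fun x => Num.sqrt (f x)).
Proof.
move=> mf; apply: (@measurableT_comp _ _ _ _ _ _ (@Num.sqrt R)) => //.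
by apply: continuous_measurable_fun; exact: sqrt_continuous.
Qed.

Lemma bmeas_det X k (A : 'rV[R]_n -> 'M[R]_k) :
  (forall i j, bmeas X (fun x => A x i j)) -> bmeas X (fun x => \det (A x)).
Proof.
move=> bA; apply: bmeas_sum => s _; apply: bmeasM; first exact: bmeas_cst.
by apply: bmeas_prod => i _; exact: bA.
Qed.

Lemma bmeas_adj X k (A : 'rV[R]_n -> 'M[R]_k) i j :
  (forall i j, bmeas X (fun x => A x i j)) -> bmeas X (fun x => (\adj (A x)) i j).
Proof.
move=> bA; apply: (@bmeas_ext _ _ _ (fun x => cofactor (A x) j i)).
  by move=> x _; rewrite mxE.
apply: bmeasM; first exact: bmeas_cst.
apply: bmeas_det => k' l'.
by apply: bmeas_ext (bA (lift j k') (lift i l')) => x _; rewrite !mxE.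
Qed.

End Measurability.

(** The determinant for two vectors is the squared length of the first one times
    that of the component of the second one orthogonal to it. *)
Lemma gram_det_bounds (R : realType) m (Gm : 'M[R]_m) (a b : R) :
  m = 1%N \/ m = 2%N -> 0 < a -> Gm^T = Gm ->
  (forall xi : 'rV[R]_m, a ^+ 2 * dotv xi xi <= bil Gm xi^T xi^T) ->
  (forall k, 0 <= Gm k k <= b ^+ 2) ->
  (a ^+ m) ^+ 2 <= \det Gm <= (b ^+ m) ^+ 2.
Proof.
move=> m12 a0 Gs; have {}Gs k l : Gm k l = Gm l k by rewrite -[in LHS]Gs mxE.
case: m12 => mE; subst m => G Gd.
  rewrite det_mx11 !expr1; have /andP[g1 ->] := Gd 0; rewrite andbT.
  by have := G (const_mx 1); rewrite bilE /dotv !big_ord1 !mxE !mulr1 mul1r.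
have -> : \det Gm = Gm 0 0 * Gm 1 1 - Gm 0 1 ^+ 2.
  rewrite (expand_det_row _ 0) !big_ord_recl big_ord0 addr0 /cofactor !det_mx11 !mxE /=.
  have e0 : ord0 = 0 :> 'I_2 by [].
  have e1 : lift ord0 ord0 = 1 :> 'I_2 by apply: ord_inj.
  have e2 : lift 1 0 = 0 :> 'I_2 by apply: ord_inj.
  have e3 : lift 0 0 = 1 :> 'I_2 by apply: ord_inj.
  by rewrite ?e0 ?e1 ?e2 ?e3 (Gs 1 0) /bump/= expr0 addn0 expr1; ring.
have /andP[p0 p1] := Gd 0; have /andP[r0 r1] := Gd 1.
set p := Gm 0 0 in p0 p1 *; set r := Gm 1 1 in r0 r1 *; set q := Gm 0 1.
have pa : a ^+ 2 <= p.
  have := G (delta_mx 0 0); rewrite bilE /dotv !big_ord_recl !big_ord0 !mxE /=.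
  by rewrite -/p !(mulr0, mul0r, mulr1, mul1r, addr0).
(* the combination of the two vectors orthogonal to the first one *)
have := G (\row_j if j == 0 then - q else p).
rewrite bilE /dotv !big_ord_recl !big_ord0 !mxE /=.
have e1 : lift ord0 ord0 = 1 :> 'I_2 by apply: ord_inj.
have e0 : ord0 = 0 :> 'I_2 by [].
rewrite ?e1 ?e0 (Gs 1 0) -/p -/q -/r !addr0 => hh.
have a2 : 0 < a ^+ 2 by rewrite exprn_gt0.
have pp : 0 < p by exact: lt_le_trans pa.
have h2 : a ^+ 2 * (q ^+ 2 + p ^+ 2) <= p * (p * r - q ^+ 2).
  by apply: le_trans (le_trans _ hh) _; lra.
have h3 : a ^+ 2 * p <= p * r - q ^+ 2.
  rewrite -(ler_pM2l pp); apply: le_trans h2.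
  have : 0 <= a ^+ 2 * q ^+ 2 by rewrite mulr_ge0 ?sqr_ge0.
  lra.
apply/andP; split.
  apply: le_trans h3; rewrite [leLHS](_ : _ = a ^+ 2 * a ^+ 2); last by ring.
  by rewrite ler_wpM2l// ltW.
have : p * r <= b ^+ 2 * b ^+ 2 by rewrite ler_pM.
have := sqr_ge0 q; rewrite [(b ^+ 2) ^+ 2](_ : _ = b ^+ 2 * b ^+ 2); last by ring.
lra.
Qed.

Section Facet.
Context (R : realType) (n : nat) (sigma : R).
Hypothesis sigma0 : 0 < sigma.
Variable V : {set 'I_n} -> 'rV[R]_n.
Local Notation h := (diam (mel V)).
Hypothesis h0 : 0 < h.
Hypothesis Jbound : forall x, cube x -> forall xi : 'rV[R]_n,
  enorm (xi *m multjac V x) <= sigma * h * enorm xi /\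
  h * enorm xi <= sigma * enorm (xi *m multjac V x).

(** The geometry of a facet of the element with vertices V, with the Jacobian in
    closed form. *)
Definition mfacet_jac i s (y : 'rV[R]_n.-1) : 'M[R]_n := multjac V (facet_point i s y).

Definition mfacet_area i s y : R :=
  let t := row' i (mfacet_jac i s y) in Num.sqrt (\det (t *m t^T)).

Definition mfacet_normal i (s : bool) y : 'rV[R]_n :=
  let nhat := (if s then 1 else -1) *: delta_mx 0 i : 'rV[R]_n in
  let nu := nhat *m (invmx (mfacet_jac i s y))^T in
  (enorm nu)^-1 *: nu.

Let Jb x (cx : cube x) xi := Jbound cx xi.

Lemma multjac_sqr x (cx : cube x) xi :
  dotv (xi *m multjac V x) (xi *m multjac V x) <= (sigma * h) ^+ 2 * dotv xi xi /\
  h ^+ 2 * dotv xi xi <= sigma ^+ 2 * dotv (xi *m multjac V x) (xi *m multjac V x).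
Proof.
have [h1 h2] := Jb cx xi; rewrite -!enorm_sqr -!exprMn.
by split; rewrite ler_sqr// nnegrE ?mulr_ge0 ?enorm_ge0 ?(ltW h0) ?(ltW sigma0).
Qed.

Lemma multjac_unitmx x : cube x -> multjac V x \in unitmx.
Proof. by move=> cx; apply: (multjac_unit h0) => xi; exact: (Jb cx xi).2. Qed.

Lemma dotv_delta (k : 'I_n) : dotv (delta_mx 0 k : 'rV[R]_n) (delta_mx 0 k) = 1.
Proof.
rewrite /dotv (bigD1 k)//= big1 ?addr0; first by rewrite mxE !eqxx mulr1.
by move=> j jk; rewrite mxE (negbTE jk) andbF mulr0.
Qed.

Lemma multjac_entry x k j : cube x -> `|multjac V x k j| <= sigma * h.
Proof.
move=> cx; have [+ _] := multjac_sqr cx (delta_mx 0 k).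
rewrite -rowE dotv_delta mulr1 => hk.
rewrite -ler_sqr ?nnegrE ?mulr_ge0 ?(ltW h0) ?(ltW sigma0)// sqr_normr.
by apply: le_trans hk; have := coord_sqr_le (row k (multjac V x)) j; rewrite mxE.
Qed.

Lemma invjac_entry x k j : cube x -> `|invmx (multjac V x) k j| <= sigma / h.
Proof.
move=> cx; have [_] := multjac_sqr cx (row k (invmx (multjac V x))).
rewrite -row_mul mulVmx ?multjac_unitmx// row1 dotv_delta mulr1 => hk.
rewrite ler_pdivlMr// -ler_sqr ?nnegrE ?mulr_ge0 ?(ltW h0) ?(ltW sigma0)//.
rewrite exprMn sqr_normr mulrC (le_trans _ hk)// ler_wpM2l ?sqr_ge0//.
by have := coord_sqr_le (row k (invmx (multjac V x))) j; rewrite mxE.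
Qed.

Lemma bmeas_facet_jac X i s k j : bounded_mset X ->
  bmeas X (fun y => mfacet_jac i s y k j).
Proof.
move=> bX; apply: bmeas_ext (bmeas_facet (dmult k V) i s j bX) => y _.
by rewrite [RHS]mxE.
Qed.

Lemma bmeas_facet_area i s : bmeas (@cube R n.-1) (mfacet_area i s).
Proof.
have bX := bounded_mset_cube R n.-1.
have [md [B dB]] : bmeas (@cube R n.-1) (fun y => \det (row' i (mfacet_jac i s y) *m
    (row' i (mfacet_jac i s y))^T)).
  apply: bmeas_det => k l.
  apply: (@bmeas_ext _ _ _ (fun y => \sum_j mfacet_jac i s y (lift i k) j *
      mfacet_jac i s y (lift i l) j)).
    by move=> y _; rewrite [RHS]mxE; apply: eq_bigr => j _; rewrite !mxE.
  by apply: bmeas_sum => j _; apply: bmeasM; exact: bmeas_facet_jac.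
split; first exact: (@tmeas_sqrt _ _ _ (fun y => \det (row' i (mfacet_jac i s y) *m (row' i (mfacet_jac i s y))^T)) md).
exists (Num.sqrt B) => y cy; rewrite ger0_norm ?sqrtr_ge0// ler_wsqrtr//.
by apply: le_trans (dB y cy); exact: ler_norm.
Qed.

(** On the cube the Jacobian is invertible, so its inverse is the adjugate divided
    by the determinant. *)
Lemma bmeas_facet_normal i s j :
  bmeas (@cube R n.-1) (fun y => mfacet_normal i s y 0 j).
Proof.
have bX := bounded_mset_cube R n.-1.
split; last by exists 1 => y cy; exact: normalize_le1.
have minv k l : tmeas (@cube R n.-1) (fun y => invmx (mfacet_jac i s y) k l).
  have [md _] := @bmeas_det _ _ (@cube R n.-1) _ (mfacet_jac i s)
    (fun k l => bmeas_facet_jac i s k l bX).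
  have [ma _] := @bmeas_adj _ _ (@cube R n.-1) _ (mfacet_jac i s) k l
    (fun k l => bmeas_facet_jac i s k l bX).
  apply: eq_measurable_fun (measurable_funM
    (@tmeas_inv _ _ _ (fun y => \det (mfacet_jac i s y)) md) ma) => t /set_mem ct.
  rewrite /invmx multjac_unitmx; last exact: facet_point_in.
  by rewrite [RHS]mxE.
pose nu y := (if s then 1 else -1) *: (delta_mx 0 i : 'rV[R]_n) *m (invmx (mfacet_jac i s y))^T.
have mnu l : tmeas (@cube R n.-1) (fun y => nu y 0 l).
  apply: eq_measurable_fun (measurable_funM (measurable_cst (if s then 1 else -1 : R)) (minv l i)) => t _.
  by rewrite /nu -scalemxAl -rowE !mxE.
have mdot : tmeas (@cube R n.-1) (fun y => dotv (nu y) (nu y)).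
  apply: (@measurable_sum _ _ R _ _ _ (fun l t => nu (tuple_row t) 0 l * nu (tuple_row t) 0 l)).
  by move=> l; apply: measurable_funM; exact: mnu.
apply: eq_measurable_fun (measurable_funM (@tmeas_inv _ _ _ (fun y => enorm (nu y))
  (@tmeas_sqrt _ _ _ (fun y => dotv (nu y) (nu y)) mdot)) (mnu j)) => t _.
by rewrite [RHS]mxE.
Qed.

(** A tangent vector of the facet is the image of a vector of the cube with i-th
    coordinate zero. *)
Lemma facet_gram i s y (xi : 'rV[R]_n.-1) : cube y ->
  h ^+ 2 * dotv xi xi <=
    sigma ^+ 2 * dotv (xi *m row' i (mfacet_jac i s y)) (xi *m row' i (mfacet_jac i s y)).
Proof.
move=> cy; set t := row' i _; pose xi' := xi *m row' i 1%:M.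
have tE : xi *m t = xi' *m mfacet_jac i s y.
  by rewrite -mulmxA !row'Esub mul_rowsub_mx mul1mx.
have -> : dotv xi xi = dotv xi' xi'.
  have xl k : xi' 0 (lift i k) = xi 0 k.
    rewrite mxE (bigD1 k)//= big1 ?addr0; first by rewrite !mxE eqxx mulr1.
    by move=> l lk; rewrite !mxE (inj_eq lift_inj) (negbTE lk) mulr0.
  have xi0 : xi' 0 i = 0.
    by rewrite mxE big1// => l _; rewrite !mxE eq_sym (negbTE (neq_lift _ _)) mulr0.
  rewrite /dotv [RHS](bigD1_ord i)//= xi0 mul0r add0r.
  by apply: eq_bigr => k _; rewrite xl.
by rewrite tE; have [] := multjac_sqr (facet_point_in i s cy) xi'.
Qed.

Lemma mfacet_area_ge0 i s y : 0 <= mfacet_area i s y.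
Proof. exact: sqrtr_ge0. Qed.

(** The squared area element is the Gram determinant of the n - 1 tangent vectors. *)
Lemma facet_area_bounds i s y : n = 2%N \/ n = 3%N -> cube y ->
  (h / sigma) ^+ n.-1 <= mfacet_area i s y <= (sigma * h) ^+ n.-1.
Proof.
move=> n23 cy; rewrite /mfacet_area; set t := row' i _; set Gm := t *m t^T.
have G xi : h ^+ 2 * dotv xi xi <= sigma ^+ 2 * bil Gm xi^T xi^T.
  rewrite (_ : bil _ _ _ = dotv (xi *m t) (xi *m t)); first exact: facet_gram.
  rewrite /bil trmxK /Gm mulmxA -mulmxA -trmx_mul mxE.
  by apply: eq_bigr => j _; rewrite [X in _ * X]mxE.
have Gd k : 0 <= Gm k k <= (sigma * h) ^+ 2.
  have -> : Gm k k = dotv (row k t) (row k t).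
    by rewrite mxE; apply: eq_bigr => j _; rewrite !mxE.
  rewrite dotv_ge0/=.
  have := (multjac_sqr (facet_point_in i s cy) (delta_mx 0 (lift i k))).1.
  rewrite dotv_delta mulr1 -rowE.
  by have -> : row (lift i k) (multjac V (facet_point i s y)) = row k t by apply/rowP => j; rewrite !mxE.
have sh0 : 0 <= (sigma * h) by rewrite mulr_ge0// ltW.
have hs0 : 0 <= h / sigma by rewrite divr_ge0// ltW.
suff : ((h / sigma) ^+ n.-1) ^+ 2 <= \det Gm <= ((sigma * h) ^+ n.-1) ^+ 2.
  move=> /andP[d1 d2].
  have -> : (h / sigma) ^+ n.-1 = Num.sqrt (((h / sigma) ^+ n.-1) ^+ 2).
    by rewrite sqrtr_sqr ger0_norm// exprn_ge0.
  have -> : (sigma * h) ^+ n.-1 = Num.sqrt (((sigma * h) ^+ n.-1) ^+ 2).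
    by rewrite sqrtr_sqr ger0_norm// exprn_ge0.
  by rewrite !ler_wsqrtr.
apply: gram_det_bounds.
- by case: n23 => ->; [left|right].
- by rewrite divr_gt0.
- by rewrite trmx_mul trmxK.
- move=> xi; have s2 : 0 < sigma ^+ 2 by rewrite exprn_gt0.
  rewrite -(ler_pM2l s2); apply: le_trans (G xi).
  by rewrite le_eqVlt; apply/orP; left; apply/eqP; field; rewrite gt_eqF.
- exact: Gd.
Qed.

End Facet.

(** * Control of infinitesimal rotations by their values on a facet *)

Section SpinFacet.
Context (R : realType) (n : nat) (sigma rho : R).
Hypotheses (sigma0 : 0 < sigma) (rho0 : 0 < rho).

(** Let e_k be the edge vectors at a vertex of the facet.  Differences of the rigid
    motion between vertices of the facet are W e_k for the tangential e_k.  The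
    matrix J W J^T with entries e_l W e_k is skew-symmetric, so this also controls
    its row and its column of the remaining index i, and hence W.  The values at
    the vertices are bounded by the mean square on the facet because the rigid
    motion is a polynomial of degree at most n on the reference facet. *)
Lemma spin_facet_control : exists C : R, 0 < C /\
  forall V : {set 'I_n} -> 'rV[R]_n, 0 < diam (mel V) ->
  (forall x, cube x -> forall xi : 'rV[R]_n,
    enorm (xi *m multjac V x) <= sigma * diam (mel V) * enorm xi /\
    diam (mel V) * enorm xi <= sigma * enorm (xi *m multjac V x)) ->
  forall (i : 'I_n) (s : bool) (W : 'I_n -> 'I_n -> R) (a : 'I_n -> R) (x0 : 'rV[R]_n),
  (forall l j, W l j = - W j l) ->
  forall l j, W l j ^+ 2 <= C * \sum_l int_on (@cube R n.-1) (fun y =>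
    (a l + \sum_j W l j *
       unscale x0 (rho * diam (mel V)) (multilinear V (facet_point i s y)) 0 j) ^+ 2).
Proof.
have [C1 [C10 HC1]] := coef_box_bound R n.-1 n.
have [C2 [C20 HC2]] := @pval_blip R n.-1 n 1.
pose K := n%:R ^+ 3 * sigma ^+ 3 * rho * C2.
exists (K ^+ 2 * C1 + 1); split.
  by rewrite ltr_wpDl// mulr_ge0 ?sqr_ge0// ltW.
move=> V h0 Jb i s W a x0 Wskew.
set h := diam (mel V) in h0 *; set r := rho * h.
have r0 : 0 < r by rewrite mulr_gt0.
pose g l y := a l + \sum_j W l j * unscale x0 r (multilinear V (facet_point i s y)) 0 j.
set I := \sum_l _.
(* the rigid motion as a polynomial on the reference facet *)
pose q l : mpoly.mpoly n.-1 R := mpoly.mpolyC n.-1 (a l - \sum_j W l j * x0 0 j / r) +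
  \sum_j (W l j / r) *: facet_poly V i s j.
have gE l y : pval (q l) y = g l y.
  rewrite /pval mpoly.mevalD mpoly.mevalC (big_morph _ (mpoly.mevalD _) (mpoly.meval0 _)).
  rewrite /g -addrA; congr (_ + _); rewrite addrC -sumrB; apply: eq_bigr => j _.
  rewrite mpoly.mevalZ unscaleE.
  have := pval_facet_poly V i s j y; rewrite /pval => ->; ring.
have qdeg l : (mpoly.msize (q l) <= n.+1)%N.
  apply: degleD; first exact: degleC.
  by apply: degle_sum => j _; apply: degleZ; exact: degle_facet_poly.
have I0 l : 0 <= int_on (@cube R n.-1) (fun y => g l y ^+ 2).
  by apply: int_on_ge0 => y _; exact: sqr_ge0.
have Il l : int_on (@cube R n.-1) (fun y => g l y ^+ 2) <= I.
  by rewrite /I (bigD1 l)//= lerDl sumr_ge0// => j _; exact: I0.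
have Ipos : 0 <= I by apply: sumr_ge0 => j _; exact: I0.
pose B := Num.sqrt (C1 * I).
have B0 : 0 <= B by exact: sqrtr_ge0.
have qB l m : `|cf m (q l)| <= B.
  rewrite -ler_sqr ?nnegrE// sqr_normr sqr_sqrtr ?mulr_ge0 ?(ltW C10)//.
  have := HC1 0 1 (q l) ltr01 (qdeg l) m; rewrite expr1n mulr1 => /le_trans; apply.
  rewrite ler_wpM2l ?(ltW C10)//; apply: le_trans (Il l).
  rewrite cubeE le_eqVlt; apply/orP; left; apply/eqP.
  by apply: eq_int_on => y _; rewrite /unscale invr1 scale1r subr0 gE.
pose z0 := facet_point i s (0 : 'rV[R]_n.-1).
have c0 : cube (0 : 'rV[R]_n.-1) by move=> k; rewrite mxE lexx ler01.
have cz0 : cube z0 by exact: facet_point_in.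
pose J := multjac V z0.
have edge l k : `|\sum_j W l j * J (lift i k) j| <= r * (C2 * B).
  pose y1 : 'rV[R]_n.-1 := delta_mx 0 k.
  have c1 : cube y1 by move=> m; rewrite mxE eqxx; case: (m == k); rewrite lexx ler01.
  have cb y : cube y -> forall m, `|y 0 m| <= 1 :> R.
    by move=> cy m; have /andP[p0 p1] := cy m; rewrite ger0_norm.
  have db m : `|y1 0 m - (0 : 'rV[R]_n.-1) 0 m| <= 1.
    by rewrite [X in _ - X]mxE subr0; exact: cb.
  have [_] := HC2 (q l) B (qdeg l) (qB l) y1 0 1 (cb _ _ c1) (cb _ _ c0) ler01 db.
  rewrite mulr1 !gE => hb.
  have -> : \sum_j W l j * J (lift i k) j = r * (g l y1 - g l 0).
    rewrite /g opprD addrACA subrr add0r -sumrB mulr_sumr; apply: eq_bigr => j _.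
    rewrite !unscaleE.
    have e : multilinear V (facet_point i s y1) - multilinear V z0 =
        multilinear (dmult (lift i k) V) z0.
      rewrite (@multilinear_coord _ _ V (lift i k) z0).
        by rewrite !facet_point_lift !mxE !eqxx subr0 scale1r.
      move=> m; case: (unliftP i m) => [m' ->|-> _].
        rewrite (inj_eq lift_inj) !facet_point_lift !mxE => mk.
        by rewrite (negbTE mk) andbF.
      by rewrite !mxE unlift_none.
    have -> : J (lift i k) j = multilinear V (facet_point i s y1) 0 j - multilinear V z0 0 j.
      by rewrite mxE -e !mxE.
    by rewrite /z0; field; rewrite gt_eqF.
  by rewrite normrM (ger0_norm (ltW r0)) ler_wpM2l ?(ltW r0).
pose Wm : 'M[R]_n := \matrix_(l, j) W l j.
pose U := Wm *m J^T.
have UE l k : U l k = \sum_j W l j * J k j.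
  by rewrite mxE; apply: eq_bigr => j _; rewrite !mxE.
(* M = J W J^T, bounded in all columns but the i-th one *)
pose M := J *m U.
have Jn l j : `|J l j| <= sigma * h by exact: (multjac_entry sigma0 h0 Jb).
have sh0 : 0 <= sigma * h by rewrite mulr_ge0 ?(ltW sigma0) ?(ltW h0).
pose BM := n%:R * (sigma * h * (r * (C2 * B))).
have BM0 : 0 <= BM.
  by rewrite !mulr_ge0 ?ler0n ?(ltW sigma0) ?(ltW h0) ?(ltW rho0) ?(ltW C20).
have Mk m k : `|M m (lift i k)| <= BM.
  rewrite mxE (le_trans (ler_norm_sum _ _ _))//.
  apply: (@le_trans _ _ (\sum_(l < n) sigma * h * (r * (C2 * B)))).
    by apply: ler_sum => l _; rewrite normrM ler_pM// UE.
  by rewrite sumr_const card_ord -[leLHS]mulr_natl.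
have Mskew m k : M m k = - M k m.
  have : M^T = - M.
    rewrite /M /U !trmx_mul trmxK -mulmxA.
    have -> : Wm^T = - Wm by apply/matrixP => l j; rewrite !mxE Wskew.
    by rewrite mulNmx mulmxN.
  by move=> /(congr1 (fun A : 'M[R]_n => A k m)); rewrite !mxE.
have MB m k : `|M m k| <= BM.
  case: (unliftP i k) => [k' ->|->]; first exact: Mk.
  case: (unliftP i m) => [m' ->|->]; first by rewrite Mskew normrN; exact: Mk.
  have := Mskew i i; move: BM0; set x := M i i => b0 xx.
  have x00 : x = 0 by lra.
  by rewrite x00 normr0.
have Ju : J \in unitmx by exact: (multjac_unitmx h0 Jb cz0).
have WE l j : W l j = \sum_m \sum_k invmx J l m * (M m k * invmx J j k).
  have -> : W l j = (invmx J *m (M *m (invmx J)^T)) l j.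
    rewrite /M -(mulmxA J) mulKmx// /U -mulmxA -trmx_mul mulVmx// trmx1 mulmx1.
    by rewrite mxE.
  rewrite mxE; apply: eq_bigr => m _; rewrite mxE mulr_sumr.
  by apply: eq_bigr => k _; rewrite !mxE.
have Jin l j : `|invmx J l j| <= sigma / h by exact: (invjac_entry sigma0 h0 Jb).
have sih0 : 0 <= sigma / h by rewrite divr_ge0 ?(ltW sigma0) ?(ltW h0).
move=> l j.
have WB : `|W l j| <= K * B.
  rewrite WE (le_trans (ler_norm_sum _ _ _))//.
  apply: (@le_trans _ _ (\sum_(m < n) \sum_(k < n) (sigma / h) * (BM * (sigma / h)))).
    apply: ler_sum => m _; rewrite (le_trans (ler_norm_sum _ _ _))//.
    by apply: ler_sum => k _; rewrite !normrM ler_pM// ?mulr_ge0// ler_pM.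
  rewrite sumr_const card_ord sumr_const card_ord -!mulrnA -[leLHS]mulr_natl natrM.
  rewrite le_eqVlt; apply/orP; left; apply/eqP; rewrite /BM /K /r; field.
  by rewrite gt_eqF.
have K0 : 0 <= K.
  by rewrite !mulr_ge0 ?exprn_ge0 ?ler0n ?(ltW sigma0) ?(ltW rho0) ?(ltW C20).
rewrite -sqr_normr (@le_trans _ _ ((K * B) ^+ 2))//.
  by rewrite ler_sqr ?nnegrE// mulr_ge0.
rewrite exprMn sqr_sqrtr ?mulr_ge0 ?(ltW C10)// mulrDl mul1r mulrA.
by rewrite lerDl.
Qed.

End SpinFacet.

Ltac nonneg := repeat first
  [ done | exact: ler0n | exact: ltW | exact: sqr_ge0 | apply: addr_ge0
  | apply: divr_ge0 | apply: mulr_ge0 | apply: exprn_ge0 | rewrite invr_ge0 ].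

(** * The consistency error of the velocity extension on one facet *)

Lemma sqr_le_norm (R : realType) (a b : R) : `|a| <= b -> a ^+ 2 <= b ^+ 2.
Proof.
move=> ab; rewrite -sqr_normr ler_sqr// nnegrE.
exact: le_trans ab.
Qed.

Section Composition.
Context (R : realType) (n m : nat).

Lemma bmeas_pval_comp (X : set 'rV[R]_m) (p : mpoly.mpoly n R) (g : 'rV[R]_m -> 'rV[R]_n) :
  (forall j, bmeas X (fun y => g y 0 j)) -> bmeas X (fun y => pval p (g y)).
Proof.
move=> bg; apply: (@bmeas_ext _ _ _ (fun y => \sum_(mm <- mpoly.msupp p)
    cf mm p * \prod_j g y 0 j ^+ mm j)).
  by move=> y _; rewrite pvalE.
apply: bmeas_sum => mm _; apply: bmeasM; first exact: bmeas_cst.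
by apply: bmeas_prod => j _; apply: bmeasX; exact: bg.
Qed.

Lemma bmeas_dotv (X : set 'rV[R]_m) (f g : 'rV[R]_m -> 'rV[R]_n) :
  (forall j, bmeas X (fun y => f y 0 j)) -> (forall j, bmeas X (fun y => g y 0 j)) ->
  bmeas X (fun y => dotv (f y) (g y)).
Proof. by move=> bf bg; apply: bmeas_sum => j _; apply: bmeasM. Qed.

Lemma coef_deriv_le (p : mpoly.mpoly n R) k (B : R) j : (mpoly.msize p <= k.+1)%N ->
  (forall mm, `|cf mm p| <= B) -> forall mm, `|cf mm (mpoly.mderiv j p)| <= k.+1%:R * B.
Proof.
move=> pk pB mm; have B0 : 0 <= B by apply: le_trans (pB mpoly.mnm0).
rewrite mpoly.mcoeff_mderiv; have [h|h] := leqP k.+1 (mpoly.mdeg mm).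
  rewrite mpoly.memN_msupp_eq0 ?mul0rn ?normr0 ?mulr_ge0//.
  apply: mpoly.msize_mdeg_ge; rewrite (leq_trans pk)// mpoly.mdegD.
  by rewrite (leq_trans h) ?leq_addr.
rewrite normrMn -[leLHS]mulr_natl ler_pM// ler_nat.
by rewrite (leq_trans _ h)// ltnS mpoly.mdegE (bigD1 j)//= leq_addr.
Qed.

End Composition.

Section Extensions.
Context (R : realType) (n : nat).
Implicit Types (v : 'I_n -> mpoly.mpoly n R).

Lemma vvalE v x i : vval v x 0 i = pval (v i) x. Proof. by rewrite mxE. Qed.

Lemma vextFE dv v x i : vextF dv v x 0 i = pval (v i) (x + dv x).
Proof. by rewrite mxE. Qed.

Lemma vextTE dv v x i : vextT dv v x 0 i =
  pval (v i) x + \sum_j dv x 0 j * pval (mpoly.mderiv j (v i)) x.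
Proof.
by rewrite !mxE; congr (_ + _); apply: eq_bigr => j _; rewrite !mxE.
Qed.

Lemma pval_strain v i j x : pval (strain v i j) x = 2 * vsymgrad v x i j.
Proof.
by rewrite /pval mpoly.mevalD /vsymgrad !mxE /pval; field.
Qed.

Lemma sym_le_frob (A : 'M[R]_n) i j : A i j ^+ 2 <= frob A A.
Proof.
rewrite /frob (bigD1 i)//= (bigD1 j)//= -expr2 -addrA lerDl addr_ge0//.
  by apply: sumr_ge0 => k _; rewrite -expr2 sqr_ge0.
by apply: sumr_ge0 => k _; apply: sumr_ge0 => l _; rewrite -expr2 sqr_ge0.
Qed.

Lemma bmeas_vsymgrad X v i j : bounded_mset X -> bmeas X (fun x => vsymgrad v x i j).
Proof.
move=> bX; apply: (@bmeas_ext _ _ _ (fun x => 2^-1 * pval (strain v i j) x)).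
  by move=> x _; rewrite pval_strain mulrA mulVf ?mul1r.
by apply: bmeasM; [exact: bmeas_cst|exact: bmeas_pval].
Qed.

Lemma bmeas_frob_sym X v : bounded_mset X ->
  bmeas X (fun x => frob (vsymgrad v x) (vsymgrad v x)).
Proof.
move=> bX; apply: bmeas_sum => i _; apply: bmeas_sum => j _.
by apply: bmeasM; exact: bmeas_vsymgrad.
Qed.

Lemma frob_ge0 (A : 'M[R]_n) : 0 <= frob A A.
Proof. by apply: sumr_ge0 => k _; apply: sumr_ge0 => l _; rewrite -expr2 sqr_ge0. Qed.

End Extensions.

Section FacetEstimate.
Context (R : realType) (n k : nat) (sigma cd : R).
Hypotheses (n23 : n = 2%N \/ n = 3%N) (sigma0 : 0 < sigma) (cd0 : 0 < cd).

Let sq4 (a b c e : R) : (a + b + c + e) ^+ 2 <= 4 * (a ^+ 2 + b ^+ 2 + c ^+ 2 + e ^+ 2).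
Proof.
have := sqr_ge0 (a - b); have := sqr_ge0 (a - c); have := sqr_ge0 (a - e).
have := sqr_ge0 (b - c); have := sqr_ge0 (b - e); have := sqr_ge0 (c - e); lra.
Qed.

(** In the coordinates of the box inscribed in the element, v is an infinitesimal
    rigid motion with spin W plus a remainder e controlled by the strain.  The
    Taylor trace of v on the facet differs from the rigid motion by terms in e
    and by W times the shift; the latter is small, so W is controlled by the
    trace and the strain.  The integrand is W and the gradient of e applied to
    the shift, which yields the factor tau. *)
Lemma facet_consistency : exists C eta : R, [/\ 0 < C, 0 < eta & eta <= 1 /\
  forall V : {set 'I_n} -> 'rV[R]_n, 0 < diam (mel V) ->
  (forall x, cube x -> forall xi : 'rV[R]_n,
    enorm (xi *m multjac V x) <= sigma * diam (mel V) * enorm xi /\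
    diam (mel V) * enorm xi <= sigma * enorm (xi *m multjac V x)) ->
  forall (i : 'I_n) (s : bool) (dv : 'rV[R]_n -> 'rV[R]_n) (tau : R),
  let x := fun y => multilinear V (facet_point i s y) in
  0 <= tau <= eta ->
  (forall y, cube y -> enorm (dv (x y)) <= cd * diam (mel V) * tau) ->
  (forall j, bmeas (@cube R n.-1) (fun y => dv (x y) 0 j)) ->
  forall (v : 'I_n -> mpoly.mpoly n R) (q : mpoly.mpoly n R),
  (forall j, (mpoly.msize (v j) <= k.+2)%N) -> (mpoly.msize q <= k.+2)%N ->
  int_on (@cube R n.-1) (fun y =>
     dotv (mfacet_normal V i s y) (vextF dv v (x y) - vval v (x y)) * pval q (x y) *
     mfacet_area V i s y) ^+ 2 <=
  C * tau ^+ 2 *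
   ((diam (mel V))^-1 * int_on (@cube R n.-1) (fun y =>
       dotv (vextT dv v (x y)) (vextT dv v (x y)) * mfacet_area V i s y) +
    int_on (mel V) (fun x => frob (vsymgrad v x) (vsymgrad v x))) *
  int_on (mel V) (fun x => pval q x ^+ 2)].
Proof.
have [rho [rho0 Hrho]] := @mel_box R n sigma sigma0.
have [Cr [Cr0 HCr]] := @spin_facet_control R n sigma rho sigma0 rho0.
have [Cb [Cb0 HCb]] := coef_box_bound R n k.+1.
pose M := (1 + cd) / rho.
have [Ce [Ce0 HCe]] := @pval_blip R n k.+1 M.
pose N : R := n%:R.
have N0 : 0 <= N by rewrite ler0n.
(* the shift in the coordinates of the box is at most kap tau *)
pose kap := cd / rho.
have kap0 : 0 <= kap by nonneg.
pose kap2 : R := k.+2%:R * (2 * k.+2%:R).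
have kap20 : 0 <= kap2 by nonneg.
pose a1 := 8 * N ^+ 2 * Cr.
pose a2 := 8 * N ^+ 3 * Cr * (1 + N ^+ 2 * kap ^+ 2) * Ce ^+ 2.
have a10 : 0 <= a1 by nonneg.
have a20 : 0 <= a2.
  by nonneg.
pose D := N ^+ 2 * a1 + N ^+ 2 * a2 + Ce ^+ 2.
have D0 : 0 <= D by nonneg.
pose D2 := sigma ^+ n.-1 + 4 * kap2 ^+ 2 * Cb * rho ^+ 2 / rho ^+ n.
have D20 : 0 <= D2.
  by nonneg.
pose CC := 2 * N ^+ 2 * kap ^+ 2 * D * D2 * Ce ^+ 2 * Cb * (sigma ^+ n.-1) ^+ 2 / rho ^+ n.
have CC0 : 0 <= CC.
  by nonneg.
pose Z := 8 * N ^+ 5 * Cr * kap ^+ 2.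
have Z0 : 0 <= Z by nonneg.
pose eta := (Z + 1)^-1.
have eta0 : 0 < eta by rewrite invr_gt0 ltr_wpDl.
have eta1 : eta <= 1 by rewrite invf_le1 ?lerDr// ltr_wpDl.
exists (CC + 1), eta; split => //; first by rewrite ltr_wpDl.
split=> // V h0 Jb i s dv tau x /andP[tau0 taue] dvb bdv v q vk qk.
set h := diam (mel V) in h0 Jb dvb *.
pose r := rho * h.
have r0 : 0 < r by rewrite mulr_gt0.
have rn0 : r != 0 by rewrite gt_eqF.
pose x0 := multilinear V (center R n).
have bT := mel_bounded_mset V.
have bB := bounded_mset_box x0 r.
have bQ := bounded_mset_cube R n.-1.
have boxT : box x0 r `<=` mel V.
  move=> z hz; apply: Hrho => //; first by move=> z' cz' xi; exact: (Jb z' cz' xi).2.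
  move=> j; have /andP[z1 z2] := hz j; rewrite ger0_norm ?subr_ge0// lerBlDl.
  exact: z2.
have tau1 : tau <= 1 by exact: le_trans eta1.
have xin y : cube y -> mel V (x y) by move=> cy; exists (facet_point i s y) => //; exact: facet_point_in.
pose sc y := unscale x0 r (x y).
pose dl y : 'rV[R]_n := r^-1 *: dv (x y).
have rE : rho^-1 = h / r by rewrite /r; field; rewrite !gt_eqF.
have scB y : cube y -> forall j, `|sc y 0 j| <= rho^-1.
  move=> cy j; rewrite unscaleE normrM normfV (ger0_norm (ltW r0)) rE.
  rewrite ler_wpM2r ?invr_ge0 ?(ltW r0)//.
  apply: mel_close; first exact: xin.
  by exists (center R n) => //; exact: center_in.
have dlB y : cube y -> forall j, `|dl y 0 j| <= kap * tau.
  move=> cy j; rewrite mxE normrM normfV (ger0_norm (ltW r0)).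
  have -> : kap * tau = r^-1 * (cd * h * tau) by rewrite /kap /r; field; rewrite !gt_eqF.
  rewrite ler_wpM2l ?invr_ge0 ?(ltW r0)//.
  by apply: le_trans (coord_le_enorm _ _) (dvb y cy).
have kt0 : 0 <= kap * tau by rewrite mulr_ge0.
have scM y : cube y -> forall j, `|sc y 0 j| <= M.
  move=> cy j; apply: le_trans (scB y cy j) _.
  by rewrite /M -[leLHS]mul1r ler_wpM2r ?invr_ge0 ?(ltW rho0)// lerDl ltW.
have sdM y : cube y -> forall j, `|(sc y + dl y) 0 j| <= M.
  move=> cy j; rewrite mxE (le_trans (ler_normD _ _))// /M mulrDl mul1r lerD ?scB//.
  by rewrite (le_trans (dlB y cy j))// -/kap ler_piMr.
pose vh l := rescale x0 r (v l).
have vhk l : (mpoly.msize (vh l) <= k.+2)%N by exact: degle_rescale.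
set Ie := int_on (mel V) (fun x => frob _ _).
set Iq := int_on (mel V) (fun x => pval q x ^+ 2).
set A2 := int_on (@cube R n.-1) (fun y => dotv (vextT _ _ _) _ * _).
have rr0 : 0 < r ^+ n by rewrite exprn_gt0.
have Ie0 : 0 <= Ie by apply: int_on_ge0 => z _; exact: frob_ge0.
have Iq0 : 0 <= Iq by apply: int_on_ge0 => z _; exact: sqr_ge0.
have A20 : 0 <= A2.
  by apply: int_on_ge0 => y _; rewrite mulr_ge0 ?dotv_ge0 ?mfacet_area_ge0.
have coefB p mm : (mpoly.msize p <= k.+2)%N ->
    cf mm (rescale x0 r p) ^+ 2 * r ^+ n <= Cb * int_on (box x0 r) (fun z => pval p z ^+ 2).
  move=> pk; have := HCb x0 r _ r0 (degle_rescale x0 r pk) mm.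
  rewrite (eq_int_on (g := fun z => pval p z ^+ 2))// => z _.
  by rewrite -pval_unscale.
pose E := Num.sqrt (Cb * (4 * Ie) / r ^+ n).
have E0 : 0 <= E by exact: sqrtr_ge0.
have E2 : E ^+ 2 = Cb * (4 * Ie) / r ^+ n.
  by rewrite sqr_sqrtr// divr_ge0 ?(ltW rr0)// !mulr_ge0// ltW.
have strainB l j mm : `|cf mm (strain vh l j)| <= r * E.
  have -> : strain vh l j = r *: rescale x0 r (strain v l j).
    by rewrite /strain !mderiv_rescale -scalerDr /rescale mpoly.comp_mpolyD.
  rewrite mpoly.mcoeffZ normrM (ger0_norm (ltW r0)) ler_wpM2l ?(ltW r0)//.
  rewrite -ler_sqr ?nnegrE// sqr_normr E2 ler_pdivlMr//.
  have sk : (mpoly.msize (strain v l j) <= k.+2)%N by apply: degleD; exact: degle_deriv.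
  apply: le_trans (coefB _ _ sk) _; rewrite ler_wpM2l ?(ltW Cb0)//.
  apply: (@le_trans _ _ (int_on (mel V) (fun z => pval (strain v l j) z ^+ 2))).
    apply: int_on_subset => //; last by move=> z _; exact: sqr_ge0.
    by apply: bmeasX; exact: bmeas_pval.
  rewrite -int_onZ//; last exact: bmeas_frob_sym.
  apply: le_int_on => //.
  - by apply: bmeasX; exact: bmeas_pval.
  - by apply: bmeasM; [exact: bmeas_cst|exact: bmeas_frob_sym].
  - move=> z _; rewrite pval_strain exprMn.
    by have := sym_le_frob (vsymgrad v z) l j; lra.
pose e l := vh l - rigid vh l.
have ek l : (mpoly.msize (e l) <= k.+2)%N.
  apply: degleD; first exact: vhk.
  by rewrite -scaleN1r degleZ// degle_rigid.
pose B2 := kap2 * (r * E).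
have rE0 : 0 <= r * E by rewrite mulr_ge0// ltW.
have B20 : 0 <= B2 by rewrite mulr_ge0.
have eB1 l mm : `|cf mm (e l)| <= 2 * k.+2%:R * (r * E) by exact: korn_coef.
have deB l j mm : `|cf mm (mpoly.mderiv j (e l))| <= B2.
  by have := coef_deriv_le j (ek l) (eB1 l) mm; rewrite mulrA.
have eB l mm : `|cf mm (e l)| <= B2.
  apply: le_trans (eB1 l mm) _; rewrite /B2 /kap2 -[leRHS]mulrA ler_peMl ?ler1n//.
  by rewrite mulr_ge0// mulr_ge0.
pose W := spin vh.
pose av l := cf mpoly.mnm0 (vh l).
pose w2 := \sum_l \sum_j W l j ^+ 2.
have w20 : 0 <= w2 by apply: sumr_ge0 => l _; apply: sumr_ge0 => j _; exact: sqr_ge0.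
pose w := Num.sqrt w2.
have w0 : 0 <= w by exact: sqrtr_ge0.
have w2E : w ^+ 2 = w2 by rewrite sqr_sqrtr.
have Ww l j : `|W l j| <= w.
  rewrite -ler_sqr ?nnegrE// sqr_normr w2E /w2 (bigD1 l)//= (bigD1 j)//= -addrA lerDl.
  rewrite addr_ge0//; first by apply: sumr_ge0 => ? _; exact: sqr_ge0.
  by apply: sumr_ge0 => ? _; apply: sumr_ge0 => ? _; exact: sqr_ge0.
have vhE l t : pval (vh l) t = av l + \sum_j W l j * t 0 j + pval (e l) t.
  rewrite -pval_rigid /e /pval mpoly.mevalB; ring.
have vxE l y : pval (v l) (x y) = pval (vh l) (sc y) by exact: pval_unscale.
have vxdE l y : pval (v l) (x y + dv (x y)) = pval (vh l) (sc y + dl y).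
  rewrite (pval_unscale x0 (v l) (x y + dv (x y)) rn0); congr (pval _ _).
  by rewrite /sc /dl /unscale -scalerDr addrAC.
have dvE l j y : dv (x y) 0 j * pval (mpoly.mderiv j (v l)) (x y) =
    dl y 0 j * (W l j + pval (mpoly.mderiv j (e l)) (sc y)).
  have -> : pval (mpoly.mderiv j (v l)) (x y) = r^-1 * pval (mpoly.mderiv j (vh l)) (sc y).
    rewrite mderiv_rescale (pval_unscale x0 _ (x y) rn0) -/(sc y).
    by rewrite [in RHS]/pval mpoly.mevalZ mulrA mulVf// mul1r.
  have -> : pval (mpoly.mderiv j (vh l)) (sc y) = W l j + pval (mpoly.mderiv j (e l)) (sc y).
    by rewrite /e mpoly.mderivB mderiv_rigid /pval mpoly.mevalB mpoly.mevalC addrC subrK.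
  by rewrite mxE; ring.
have bx j : bmeas (@cube R n.-1) (fun y => x y 0 j) by exact: bmeas_facet.
have bvT l : bmeas (@cube R n.-1) (fun y => vextT dv v (x y) 0 l).
  apply: (@bmeas_ext _ _ _ (fun y => pval (v l) (x y) +
     \sum_j dv (x y) 0 j * pval (mpoly.mderiv j (v l)) (x y))).
    by move=> y _; rewrite vextTE.
  apply: bmeasD; first exact: bmeas_pval_comp.
  by apply: bmeas_sum => j _; apply: bmeasM => //; exact: bmeas_pval_comp.
have bvT2 : bmeas (@cube R n.-1) (fun y => dotv (vextT dv v (x y)) (vextT dv v (x y))).
  exact: bmeas_dotv.
pose X2 := int_on (@cube R n.-1) (fun y => dotv (vextT dv v (x y)) (vextT dv v (x y))).
(* the rigid motion at a facet point: the Taylor trace up to terms in the shift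
   and in e *)
pose g l y := av l + \sum_j W l j * sc y 0 j.
have sumB (F G : 'I_n -> R) a b : (forall j, `|F j| <= a) -> (forall j, `|G j| <= b) ->
    `|\sum_j F j * G j| <= N * (a * b).
  move=> Fa Gb; rewrite (le_trans (ler_norm_sum _ _ _))//.
  apply: (@le_trans _ _ (\sum_(j < n) a * b)).
    by apply: ler_sum => j _; rewrite normrM ler_pM.
  by rewrite sumr_const card_ord -[leLHS]mulr_natl.
have eblip l : blip M (pval (e l)) (Ce * B2) by exact: HCe.
have deblip l j : blip M (pval (mpoly.mderiv j (e l))) (Ce * B2).
  by apply: HCe => //; exact: degle_deriv.
have CB0 : 0 <= Ce * B2 by rewrite mulr_ge0// ltW.
have zz (t : 'rV[R]_n) (j : 'I_n) : `|t 0 j - t 0 j| <= 0 :> R by rewrite subrr normr0.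
have g2 l y : cube y -> g l y ^+ 2 <= 4 * vextT dv v (x y) 0 l ^+ 2 +
    4 * (N ^+ 2 * kap ^+ 2) * tau ^+ 2 * w2 + 4 * (1 + N ^+ 2 * kap ^+ 2) * (Ce * B2) ^+ 2.
  move=> cy.
  have gE : g l y = vextT dv v (x y) 0 l + (- \sum_j W l j * dl y 0 j) + (- pval (e l) (sc y))
      + (- \sum_j dl y 0 j * pval (mpoly.mderiv j (e l)) (sc y)).
    rewrite vextTE vxE vhE -/(g l y).
    under eq_bigr => j _ do rewrite dvE mulrDr [dl y 0 j * W l j]mulrC.
    by rewrite big_split/=; ring.
  have b1 : `|\sum_j W l j * dl y 0 j| <= N * (w * (kap * tau)).
    by apply: sumB => j; [exact: Ww|exact: dlB].
  have [b2 _] := eblip l (sc y) (sc y) 0 (scM y cy) (scM y cy) (lexx 0) (zz (sc y)).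
  have b3 : `|\sum_j dl y 0 j * pval (mpoly.mderiv j (e l)) (sc y)| <= N * (kap * tau * (Ce * B2)).
    apply: sumB => j; first exact: dlB.
    by have [] := deblip l j (sc y) (sc y) 0 (scM y cy) (scM y cy) (lexx 0) (zz (sc y)).
  have q1 : (\sum_j W l j * dl y 0 j) ^+ 2 <= N ^+ 2 * kap ^+ 2 * tau ^+ 2 * w2.
    rewrite -w2E (_ : _ * w ^+ 2 = (N * (w * (kap * tau))) ^+ 2); last by ring.
    exact: sqr_le_norm.
  have q2 : pval (e l) (sc y) ^+ 2 <= (Ce * B2) ^+ 2 by exact: sqr_le_norm.
  have q3 : (\sum_j dl y 0 j * pval (mpoly.mderiv j (e l)) (sc y)) ^+ 2 <=
      N ^+ 2 * kap ^+ 2 * (Ce * B2) ^+ 2.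
    apply: (@le_trans _ _ ((N * (kap * tau * (Ce * B2))) ^+ 2)).
      exact: sqr_le_norm.
    rewrite (_ : N ^+ 2 * _ * _ = (N * (kap * (Ce * B2))) ^+ 2); last by ring.
    apply: sqr_le_norm; rewrite ger0_norm; last by nonneg.
    by apply: ler_wpM2l => //; apply: ler_wpM2r => //; rewrite ler_piMr.
  rewrite gE; apply: le_trans (sq4 _ _ _ _) _; rewrite !sqrrN; lra.
have bg l : bmeas (@cube R n.-1) (fun y => g l y).
  apply: bmeasD; first exact: bmeas_cst.
  apply: bmeas_sum => j _; apply: bmeasM; first exact: bmeas_cst.
  apply: (@bmeas_ext _ _ _ (fun y => (x y 0 j - x0 0 j) / r)).
    by move=> y _; rewrite /sc unscaleE.
  apply: bmeasM; last exact: bmeas_cst.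
  by apply: bmeasB => //; exact: bmeas_cst.
pose T1 := 4 * (N ^+ 2 * kap ^+ 2) * tau ^+ 2 * w2.
pose T2 := 4 * (1 + N ^+ 2 * kap ^+ 2) * (Ce * B2) ^+ 2.
have sumg : \sum_l int_on (@cube R n.-1) (fun y => g l y ^+ 2) <= 4 * X2 + N * (T1 + T2).
  apply: (@le_trans _ _ (\sum_l (4 * int_on (@cube R n.-1)
      (fun y => vextT dv v (x y) 0 l ^+ 2) + (T1 + T2)))).
    apply: ler_sum => l _.
    have -> : T1 + T2 = int_on (@cube R n.-1) (fun=> T1 + T2).
      by rewrite int_on_cst// cube_vol mulr1.
    have b4 : bmeas (@cube R n.-1) (fun y => vextT dv v (x y) 0 l ^+ 2) by exact: bmeasX.
    have b5 : bmeas (@cube R n.-1) (fun y => 4 * vextT dv v (x y) 0 l ^+ 2).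
      by apply: bmeasM => //; exact: bmeas_cst.
    rewrite -int_onZ// -int_onD//; last exact: bmeas_cst.
    apply: le_int_on => //; first exact: bmeasX.
      by apply: bmeasD => //; exact: bmeas_cst.
    by move=> y cy; rewrite addrA; exact: g2.
  rewrite big_split/= sumr_const card_ord -[X in _ + X <= _]mulr_natl lerD2r.
  rewrite -mulr_sumr ler_wpM2l//.
  rewrite -int_on_sum//; last by move=> l _; exact: bmeasX.
have Wc := HCr V h0 Jb i s W av x0 (spin_skew vh).
have w2le : w2 <= N ^+ 2 * Cr * (4 * X2 + N * (T1 + T2)).
  apply: (@le_trans _ _ (\sum_(l < n) \sum_(j < n) Cr * (4 * X2 + N * (T1 + T2)))).
    apply: ler_sum => l _; apply: ler_sum => j _; apply: le_trans (Wc l j) _.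
    by rewrite ler_wpM2l ?(ltW Cr0).
  rewrite sumr_const card_ord sumr_const card_ord -mulrnA -[leLHS]mulr_natl natrM.
  by rewrite -/N; lra.
(* the bound for w2 contains w2 itself, with a factor that is at most 1 / 2 by
   the choice of eta *)
have small : N ^+ 2 * Cr * (N * T1) <= w2 / 2.
  have -> : N ^+ 2 * Cr * (N * T1) = (Z * tau ^+ 2) * (w2 / 2) by rewrite /T1 /Z; field.
  rewrite ler_piMl ?divr_ge0//.
  apply: (@le_trans _ _ (Z * eta)).
    rewrite ler_wpM2l// (le_trans _ taue)// expr2 ler_piMl//.
  by rewrite /eta ler_pdivrMr ?mul1r ?lerDl// ltr_wpDl.
have w2b : w2 <= a1 * X2 + a2 * B2 ^+ 2.
  have : N ^+ 2 * Cr * (N * T2) = a2 * B2 ^+ 2 / 2 by rewrite /T2 /a2; field.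
  have : a1 * X2 = 2 * (N ^+ 2 * Cr * (4 * X2)) by rewrite /a1; ring.
  lra.
have X20 : 0 <= X2 by apply: int_on_ge0 => y _; exact: dotv_ge0.
have wB : N ^+ 2 * w2 + Ce ^+ 2 * B2 ^+ 2 <= D * (X2 + B2 ^+ 2).
  have h1 : N ^+ 2 * w2 <= N ^+ 2 * (a1 * X2 + a2 * B2 ^+ 2) by rewrite ler_wpM2l// sqr_ge0.
  have h2 : 0 <= (N ^+ 2 * a2 + Ce ^+ 2) * X2 + N ^+ 2 * a1 * B2 ^+ 2.
    by nonneg.
  by rewrite /D; lra.
pose P := h ^+ n.-1.
have P0 : 0 < P by rewrite exprn_gt0.
have np : n = n.-1.+1 by case: n23 => ->.
have rnE : r ^+ n = rho ^+ n * (h * P) by rewrite exprMn; congr (_ * _); rewrite [in LHS]np exprS.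
have barea := bmeas_facet_area V i s.
have X2A : X2 <= sigma ^+ n.-1 * A2 / P.
  rewrite mulrAC -[X2]mul1r -(_ : sigma ^+ n.-1 / P * (h / sigma) ^+ n.-1 = 1); last first.
    by rewrite expr_div_n /P mulrA divfK ?divff// ?expf_neq0// gt_eqF.
  rewrite -mulrA ler_wpM2l//; first by nonneg.
  rewrite -int_onZ//; apply: le_int_on => //.
  - by apply: bmeasM => //; exact: bmeas_cst.
  - by apply: bmeasM.
  - move=> y cy; rewrite mulrC ler_wpM2l ?dotv_ge0//.
    by have /andP[] := facet_area_bounds sigma0 h0 Jb i s n23 cy.
have B2E : B2 ^+ 2 = 4 * kap2 ^+ 2 * Cb * rho ^+ 2 / rho ^+ n * (h * Ie / P).
  rewrite (_ : B2 ^+ 2 = kap2 ^+ 2 * (r ^+ 2 * E ^+ 2)); last by rewrite /B2; ring.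
  by rewrite E2 rnE /r; field; rewrite !gt_eqF// exprn_gt0.
have XB : X2 + B2 ^+ 2 <= D2 * ((A2 + h * Ie) / P).
  have hI : 0 <= h * Ie / P by nonneg.
  have AP : 0 <= A2 / P by nonneg.
  have c1 : 0 <= sigma ^+ n.-1 * (h * Ie / P) by nonneg.
  have c2 : 0 <= 4 * kap2 ^+ 2 * Cb * rho ^+ 2 / rho ^+ n * (A2 / P).
    by nonneg.
  rewrite B2E /D2; move: X2A c1 c2; rewrite -mulrA mulrDl; lra.
pose Bq := Num.sqrt (Cb * Iq / r ^+ n).
have Bq0 : 0 <= Bq by exact: sqrtr_ge0.
have Bq2 : Bq ^+ 2 = Cb * Iq / r ^+ n.
  by rewrite sqr_sqrtr//; nonneg.
have qB y : cube y -> `|pval q (x y)| <= Ce * Bq.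
  move=> cy; rewrite (pval_unscale x0 q (x y) rn0).
  have hq mm : `|cf mm (rescale x0 r q)| <= Bq.
    rewrite -ler_sqr ?nnegrE// sqr_normr Bq2 ler_pdivlMr//.
    apply: le_trans (coefB _ mm qk) _; rewrite ler_wpM2l ?(ltW Cb0)//.
    apply: int_on_subset => //; last by move=> z _; exact: sqr_ge0.
    by apply: bmeasX; exact: bmeas_pval.
  have [] := HCe _ Bq (degle_rescale x0 r qk) hq (sc y) (sc y) 0 (scM y cy) (scM y cy) (lexx 0) (zz (sc y)).
  by [].
have vFvE l y : (vextF dv v (x y) - vval v (x y)) 0 l =
    pval (v l) (x y + dv (x y)) - pval (v l) (x y) by rewrite !mxE.
pose Bd := kap * tau * (N * w + Ce * B2).
have Bd0 : 0 <= Bd by nonneg.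
have vB y l : cube y -> `|(vextF dv v (x y) - vval v (x y)) 0 l| <= Bd.
  move=> cy; rewrite vFvE vxdE vxE !vhE.
  have -> : av l + \sum_j W l j * (sc y + dl y) 0 j + pval (e l) (sc y + dl y) -
      (av l + \sum_j W l j * sc y 0 j + pval (e l) (sc y)) =
      \sum_j W l j * dl y 0 j + (pval (e l) (sc y + dl y) - pval (e l) (sc y)).
    have -> : \sum_j W l j * (sc y + dl y) 0 j = \sum_j W l j * sc y 0 j + \sum_j W l j * dl y 0 j.
      by rewrite -big_split/=; apply: eq_bigr => j _; rewrite mxE mulrDr.
    ring.
  rewrite (le_trans (ler_normD _ _))// /Bd mulrDr lerD//.
    have : `|\sum_j W l j * dl y 0 j| <= N * (w * (kap * tau)).
      by apply: sumB => j; [exact: Ww|exact: dlB].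
    by move/le_trans; apply; rewrite le_eqVlt; apply/orP; left; apply/eqP; ring.
  have dd j : `|(sc y + dl y) 0 j - sc y 0 j| <= kap * tau.
    by rewrite mxE addrAC subrr add0r; exact: dlB.
  have [_] := eblip l _ _ _ (sdM y cy) (scM y cy) kt0 dd.
  by rewrite mulrC.
have bint : bmeas (@cube R n.-1) (fun y => dotv (mfacet_normal V i s y)
    (vextF dv v (x y) - vval v (x y)) * pval q (x y) * mfacet_area V i s y).
  apply: bmeasM => //; apply: bmeasM; last exact: bmeas_pval_comp.
  apply: bmeas_dotv => j; first exact: (bmeas_facet_normal h0 Jb).
  apply: (@bmeas_ext _ _ _ (fun y => pval (v j) (x y + dv (x y)) - pval (v j) (x y))).
    by move=> y _; rewrite vFvE.
  apply: bmeasB; last exact: bmeas_pval_comp.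
  apply: bmeas_pval_comp => l.
  apply: (@bmeas_ext _ _ _ (fun y => x y 0 l + dv (x y) 0 l)).
    by move=> y _; rewrite [RHS]mxE.
  exact: bmeasD.
pose TT := N * Bd * (Ce * Bq) * (sigma * h) ^+ n.-1.
have TT0 : 0 <= TT.
  by nonneg.
have intB : `|int_on (@cube R n.-1) (fun y => dotv (mfacet_normal V i s y)
    (vextF dv v (x y) - vval v (x y)) * pval q (x y) * mfacet_area V i s y)| <= TT.
  have := @int_on_norm_le _ _ _ bQ _ TT bint; rewrite cube_vol mulr1; apply.
  move=> y cy; rewrite !normrM /TT ler_pM ?mulr_ge0//.
    rewrite ler_pM ?qB//.
    have -> : N * Bd = N * (1 * Bd) by rewrite mul1r.
    apply: sumB => j; first exact: normalize_le1.
    exact: vB.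
  rewrite ger0_norm ?mfacet_area_ge0//.
  by have /andP[] := facet_area_bounds sigma0 h0 Jb i s n23 cy.
rewrite -sqr_normr (@le_trans _ _ (TT ^+ 2))//.
  by rewrite ler_sqr ?nnegrE.
have TT2 : TT ^+ 2 <= CC * tau ^+ 2 * (h^-1 * A2 + Ie) * Iq.
  have e1 : TT ^+ 2 = N ^+ 2 * kap ^+ 2 * tau ^+ 2 * Ce ^+ 2 * Bq ^+ 2 * (sigma ^+ n.-1) ^+ 2 *
      P ^+ 2 * (N * w + Ce * B2) ^+ 2 
    by rewrite /TT /Bd [(sigma * h) ^+ _]exprMn -/P; ring.
  have e2 : (N * w + Ce * B2) ^+ 2 <= 2 * (D * (D2 * ((A2 + h * Ie) / P))).
    have : D * (X2 + B2 ^+ 2) <= D * (D2 * ((A2 + h * Ie) / P)) by rewrite ler_wpM2l.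
    have := sqr_ge0 (N * w - Ce * B2); move: wB; rewrite -w2E; lra.
  rewrite e1; apply: le_trans (ler_wpM2l _ e2) _.
    by nonneg.
  rewrite le_eqVlt; apply/orP; left; apply/eqP; rewrite Bq2 rnE /CC; field.
  by rewrite !gt_eqF// exprn_gt0.
apply: le_trans TT2 _.
have : 0 <= tau ^+ 2 * (h^-1 * A2 + Ie) * Iq by nonneg.
set t := tau ^+ 2; set u := h^-1 * A2 + Ie; lra.
Qed.

End FacetEstimate.

(** * Matrix representation of the discrete forms *)

Section Bilinear.
Context (R : realType).

Lemma dotv_sum (I J : finType) n (a : I -> R) (b : J -> R) (X : I -> 'rV[R]_n)
    (Y : J -> 'rV[R]_n) :
  dotv (\sum_i a i *: X i) (\sum_j b j *: Y j) =
  \sum_i \sum_j a i * b j * dotv (X i) (Y j).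
Proof.
rewrite /dotv; under eq_bigr => k _.
  rewrite !summxE big_distrl/=; under eq_bigr => i _.
    rewrite big_distrr/=; under eq_bigr => j _ do rewrite !mxE mulrACA.
    over.
  over.
rewrite exchange_big/=; apply: eq_bigr => i _.
by rewrite exchange_big/=; apply: eq_bigr => j _; rewrite -mulr_sumr.
Qed.

Lemma frob_sum (I J : finType) m n (a : I -> R) (b : J -> R) (X : I -> 'M[R]_(m, n))
    (Y : J -> 'M[R]_(m, n)) :
  frob (\sum_i a i *: X i) (\sum_j b j *: Y j) =
  \sum_i \sum_j a i * b j * frob (X i) (Y j).
Proof.
have rowf (A B : 'M[R]_(m, n)) : frob A B = \sum_k dotv (row k A) (row k B).
  by apply: eq_bigr => k _; apply: eq_bigr => l _; rewrite !mxE.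
rewrite rowf; under eq_bigr => k _.
  rewrite !raddf_sum/=; under eq_bigr => i _ do rewrite linearZ.
  under [X in dotv _ X]eq_bigr => j _ do rewrite linearZ.
  rewrite dotv_sum; over.
rewrite exchange_big/=; apply: eq_bigr => i _.
rewrite exchange_big/=; apply: eq_bigr => j _.
by rewrite -mulr_sumr rowf.
Qed.

End Bilinear.

Section LinearCombination.
Context (R : realType) (d : nat) (S : sbm R d).
Implicit Types (v : 'cV[R]_(nV S)) (q : 'cV[R]_(nQ S)).

Lemma pval_sum (I : finType) (a : I -> R) (p : I -> mpoly.mpoly d R) x :
  pval (\sum_i a i *: p i) x = \sum_i a i * pval (p i) x.
Proof.
rewrite /pval (big_morph _ (mpoly.mevalD _) (mpoly.meval0 _)).
by apply: eq_bigr => i _; rewrite mpoly.mevalZ.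
Qed.

Lemma pval_pres q T x : pval (pres q T) x = \sum_i q i 0 * pval (psi i T) x.
Proof. exact: pval_sum. Qed.

Lemma vval_vel v T x : vval (vel v T) x = \sum_i v i 0 *: vval (@phi R d S i T) x.
Proof.
apply/rowP => j; rewrite mxE summxE pval_sum.
by apply: eq_bigr => i _; rewrite !mxE.
Qed.

Lemma vextF_vel dv v T x :
  vextF dv (vel v T) x = \sum_i v i 0 *: vextF dv (@phi R d S i T) x.
Proof. exact: vval_vel. Qed.

Lemma vgrad_vel v T x : vgrad (vel v T) x = \sum_i v i 0 *: vgrad (@phi R d S i T) x.
Proof.
apply/matrixP => j k; rewrite mxE summxE /vel.
rewrite (big_morph _ (mpoly.mderivD k) (mpoly.mderiv0 _ k)).
under eq_bigr => i _ do rewrite mpoly.mderivZ.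
by rewrite pval_sum; apply: eq_bigr => i _; rewrite !mxE.
Qed.

Lemma nabla_s_vel sym v T x :
  nabla_s sym (vel v T) x = \sum_i v i 0 *: nabla_s sym (@phi R d S i T) x.
Proof.
rewrite /nabla_s /vsymgrad vgrad_vel; case: sym; last first.
  by rewrite scaler_sumr; apply: eq_bigr => i _; rewrite !scalerA mulrC.
rewrite raddf_sum -big_split scaler_sumr; apply: eq_bigr => i _ /=.
by rewrite linearZ/= -scalerDr !scalerA mulrC.
Qed.

Lemma vextT_vel dv v T x :
  vextT dv (vel v T) x = \sum_i v i 0 *: vextT dv (@phi R d S i T) x.
Proof.
rewrite /vextT vval_vel vgrad_vel raddf_sum mulmx_sumr -big_split.
by apply: eq_bigr => i _ /=; rewrite linearZ/= -scalemxAr -scalerDr.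
Qed.

Lemma vdiv_vel v T x : vdiv (vel v T) x = \sum_i v i 0 * vdiv (@phi R d S i T) x.
Proof.
rewrite /vdiv vgrad_vel raddf_sum; apply: eq_bigr => i _ /=.
by rewrite mxtraceZ.
Qed.

Lemma normal_stress_vel sym (mu : R) (n : 'rV[R]_d) v T x :
  mu *: (n *m (nabla_s sym (vel v T) x)^T) =
  \sum_i v i 0 *: (mu *: (n *m (nabla_s sym (@phi R d S i T) x)^T)).
Proof.
rewrite nabla_s_vel raddf_sum mulmx_sumr scaler_sumr; apply: eq_bigr => i _ /=.
by rewrite linearZ/= -scalemxAr !scalerA mulrC.
Qed.

End LinearCombination.

Section DiscreteForms.
Context (R : realType) (d : nat) (Omega : set 'rV[R]_d) (mu : R) (sym : bool).
Context (S : sbm R d) (sigma cd zeta : R) (GammaD : set 'rV[R]_d).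
Hypotheses (d0 : (0 < d)%N) (regular : shape_regular S sigma).
Hypothesis sboundary : surrogate_boundary Omega S GammaD.
Hypothesis resolution : geometric_resolution S cd zeta.
Local Notation facet := (cell S * ('I_d * bool))%type.
Implicit Types (T : cell S) (F : facet).

Lemma bounded_mset_elem T : bounded_mset (elem T).
Proof. exact: mel_bounded_mset. Qed.

Lemma refmap_bound T x : cube x -> forall xi : 'rV[R]_d,
  enorm (xi *m multjac (vertex T) x) <= sigma * diam (mel (vertex T)) * enorm xi /\
  diam (mel (vertex T)) * enorm xi <= sigma * enorm (xi *m multjac (vertex T) x).
Proof.
move=> cx xi; rewrite -jacobian_multilinear.
by have [_ /(_ x cx xi)] := regular T.
Qed.

Lemma diam_elem_gt0 T : 0 < diam_elem T.
Proof.
have [inj _] := regular T.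
pose x0 : 'rV[R]_d := 0; pose x1 : 'rV[R]_d := const_mx 1.
have c0 : x0 \in @cube R d by rewrite inE => i; rewrite mxE lexx ler01.
have c1 : x1 \in @cube R d by rewrite inE => i; rewrite mxE lexx ler01.
have ne : refmap T x0 != refmap T x1.
  apply/eqP => /(inj _ _ c0 c1)/rowP/(_ (Ordinal d0)).
  by rewrite !mxE => /esym/eqP; rewrite oner_eq0.
rewrite inE in c0; rewrite inE in c1.
apply: (@lt_le_trans _ _ (enorm (refmap T x0 - refmap T x1))).
  rewrite sqrtr_gt0 lt_neqAle dotv_ge0 andbT eq_sym.
  by rewrite dotv_eq0 subr_eq0.
apply: enorm_le_diam; first exact: mel_bounded.
  by exists x0.
by exists x1.
Qed.

Lemma facet_areaE F y : facet_area F y = mfacet_area (vertex F.1) F.2.1 F.2.2 y.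
Proof. by rewrite /facet_area /facet_jac jacobian_multilinear. Qed.

Lemma facet_normalE F y : facet_normal F y = mfacet_normal (vertex F.1) F.2.1 F.2.2 y.
Proof. by rewrite /facet_normal /facet_jac jacobian_multilinear. Qed.

Local Notation Q := (@cube R d.-1).

Lemma bmeas_area F : bmeas Q (facet_area F).
Proof.
apply: bmeas_ext (bmeas_facet_area (vertex F.1) F.2.1 F.2.2) => y _.
by rewrite facet_areaE.
Qed.

Lemma bmeas_normal F j : bmeas Q (fun y => facet_normal F y 0 j).
Proof.
apply: bmeas_ext (bmeas_facet_normal (diam_elem_gt0 F.1) (@refmap_bound F.1) F.2.1 F.2.2 j).
by move=> y _; rewrite facet_normalE.
Qed.

Lemma bmeas_param F j : bmeas Q (fun y => facet_param F y 0 j).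
Proof. by apply: bmeas_facet; exact: bounded_mset_cube. Qed.

Lemma bmeas_shift F j : F \in gamma' S -> bmeas Q (fun y => Defs.shift S (facet_param F y) 0 j).
Proof.
move=> FG; have [_ _ _ m] := sboundary FG; split; first exact: m.
exists (cd * diam_elem F.1 * (diam_elem F.1 / charlen S) `^ zeta) => y cy.
apply: le_trans (coord_le_enorm _ _) _; apply: resolution => //.
by exists y.
Qed.

Lemma bmeas_vval F v j : bmeas Q (fun y => vval v (facet_param F y) 0 j).
Proof.
apply: (@bmeas_ext _ _ _ (fun y => pval (v j) (facet_param F y))).
  by move=> y _; rewrite vvalE.
by apply: bmeas_pval_comp => k; exact: bmeas_param.
Qed.

Lemma bmeas_vextF F v j : F \in gamma' S ->
  bmeas Q (fun y => vextF (Defs.shift S) v (facet_param F y) 0 j).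
Proof.
move=> FG; apply: (@bmeas_ext _ _ _
  (fun y => pval (v j) (facet_param F y + Defs.shift S (facet_param F y)))).
  by move=> y _; rewrite vextFE.
apply: bmeas_pval_comp => k; apply: (@bmeas_ext _ _ _
  (fun y => facet_param F y 0 k + Defs.shift S (facet_param F y) 0 k)).
  by move=> y _; rewrite [RHS]mxE.
by apply: bmeasD; [exact: bmeas_param|exact: bmeas_shift].
Qed.

Lemma bmeas_vgrad n (X : set 'rV[R]_n) (x : 'rV[R]_n -> 'rV[R]_d) v i j :
  (forall k, bmeas X (fun y => x y 0 k)) -> bmeas X (fun y => vgrad v (x y) i j).
Proof.
move=> bx; apply: (@bmeas_ext _ _ _ (fun y => pval (mpoly.mderiv j (v i)) (x y))).
  by move=> y _; rewrite mxE.
exact: bmeas_pval_comp.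
Qed.

Lemma bmeas_nabla_s n (X : set 'rV[R]_n) (x : 'rV[R]_n -> 'rV[R]_d) v i j :
  (forall k, bmeas X (fun y => x y 0 k)) -> bmeas X (fun y => nabla_s sym v (x y) i j).
Proof.
move=> bx; have bg k l := @bmeas_vgrad _ _ _ v k l bx.
rewrite /nabla_s; case: sym; last first.
  apply: (@bmeas_ext _ _ _ (fun y => 2^-1 * vgrad v (x y) i j)).
    by move=> y _; rewrite [RHS]mxE.
  by apply: bmeasM => //; exact: bmeas_cst.
apply: (@bmeas_ext _ _ _ (fun y => 2^-1 * (vgrad v (x y) i j + vgrad v (x y) j i))).
  by move=> y _; rewrite [RHS]mxE [X in _ = _ * X]mxE [X in _ = _ * (_ + X)]mxE.
by apply: bmeasM; [exact: bmeas_cst|exact: bmeasD].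
Qed.

Lemma bmeas_vextT F v j : F \in gamma' S ->
  bmeas Q (fun y => vextT (Defs.shift S) v (facet_param F y) 0 j).
Proof.
move=> FG; apply: (@bmeas_ext _ _ _ (fun y => vval v (facet_param F y) 0 j +
    \sum_k Defs.shift S (facet_param F y) 0 k * vgrad v (facet_param F y) j k)).
  move=> y _; rewrite [RHS]mxE; congr (_ + _).
  by rewrite mxE; apply: eq_bigr => k _; rewrite [in RHS]mxE.
apply: bmeasD; first exact: bmeas_vval.
apply: bmeas_sum => k _; apply: bmeasM; first exact: bmeas_shift.
by apply: bmeas_vgrad => l; exact: bmeas_param.
Qed.

Lemma bmeas_stress F v j :
  bmeas Q (fun y => (2 * mu *: (facet_normal F y *m
                                  (nabla_s sym v (facet_param F y))^T)) 0 j).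
Proof.
apply: (@bmeas_ext _ _ _ (fun y => 2 * mu * \sum_k facet_normal F y 0 k *
    nabla_s sym v (facet_param F y) j k)).
  move=> y _; rewrite [RHS]mxE; congr (_ * _).
  by rewrite mxE; apply: eq_bigr => k _; congr (_ * _); rewrite [RHS]mxE.
apply: bmeasM; first exact: bmeas_cst.
apply: bmeas_sum => k _; apply: bmeasM; first exact: bmeas_normal.
by apply: bmeas_nabla_s => l; exact: bmeas_param.
Qed.

(** The basis functions are polynomials and the shift, the normal and the area
    element are bounded and measurable, so the integrals are finite and commute
    with the finite sums over the basis. *)
Lemma int_Omega'_bilinear (I J : finType) (a : I -> R) (b : J -> R)
    (f : cell S -> 'rV[R]_d -> R) (g : I -> J -> cell S -> 'rV[R]_d -> R) :
  (forall i j T, bmeas (elem T) (g i j T)) ->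
  (forall T x, f T x = \sum_i \sum_j a i * b j * g i j T x) ->
  int_Omega' Omega f = \sum_i \sum_j a i * b j * int_Omega' Omega (g i j).
Proof.
move=> bg fE; rewrite /int_Omega'.
under eq_bigr => T _.
  rewrite (eq_int_on (g := fun x => \sum_i \sum_j a i * b j * g i j T x)); last by [].
  have bZ i j : bmeas (elem T) (fun x => a i * b j * g i j T x).
    by apply: bmeasM => //; exact: bmeas_cst.
  have bT := bounded_mset_elem T.
  rewrite int_on_sum//; last by move=> i _; exact: bmeas_sum.
  under eq_bigr => i _.
    rewrite int_on_sum//.
    under eq_bigr => j _ do rewrite int_onZ//.
    over.
  over.
rewrite exchange_big/=; apply: eq_bigr => i _.
rewrite exchange_big/=; apply: eq_bigr => j _.
by rewrite mulr_sumr.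
Qed.

Lemma int_Gamma'_bilinear (I J : finType) (a : I -> R) (b : J -> R)
    (f : facet -> 'rV[R]_d -> 'rV[R]_d -> R)
    (g : I -> J -> facet -> 'rV[R]_d -> 'rV[R]_d -> R) :
  (forall i j F, F \in gamma' S ->
     bmeas Q (fun y => g i j F (facet_param F y) (facet_normal F y))) ->
  (forall F x n, f F x n = \sum_i \sum_j a i * b j * g i j F x n) ->
  int_Gamma' f = \sum_i \sum_j a i * b j * int_Gamma' (g i j).
Proof.
move=> bg fE; rewrite /int_Gamma'.
have bQ := bounded_mset_cube R d.-1.
under eq_bigr => F FG.
  rewrite (eq_int_on (g := fun y => \sum_i \sum_j a i * b j *
     (g i j F (facet_param F y) (facet_normal F y) * facet_area F y))); last first.
    move=> y _; rewrite fE big_distrl; apply: eq_bigr => i _ /=.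
    by rewrite big_distrl; apply: eq_bigr => j _ /=; rewrite mulrA.
  have bga i j : bmeas Q (fun y => g i j F (facet_param F y) (facet_normal F y) * facet_area F y).
    by apply: bmeasM; [exact: bg|exact: bmeas_area].
  have bZ i j : bmeas Q (fun y => a i * b j * (g i j F (facet_param F y) (facet_normal F y) * facet_area F y)).
    by apply: bmeasM => //; exact: bmeas_cst.
  rewrite int_on_sum//; last by move=> i _; exact: bmeas_sum.
  under eq_bigr => i _.
    rewrite int_on_sum//.
    under eq_bigr => j _ do rewrite int_onZ//.
    over.
  over.
rewrite exchange_big/=; apply: eq_bigr => i _.
rewrite exchange_big/=; apply: eq_bigr => j _.
by rewrite mulr_sumr.
Qed.


Let dotv_sum1 (J : finType) n (b : J -> R) (X : 'rV[R]_n) (Y : J -> 'rV[R]_n) :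
  dotv X (\sum_j b j *: Y j) = \sum_j b j * dotv X (Y j).
Proof.
rewrite /dotv [RHS](eq_bigr (fun j => \sum_k X 0 k * (b j * Y j 0 k))).
  by rewrite exchange_big; apply: eq_bigr => k _; rewrite summxE mulr_sumr;
    apply: eq_bigr => j _; rewrite !mxE.
by move=> j _; rewrite mulr_sumr; apply: eq_bigr => k _; rewrite mulrCA.
Qed.

Lemma form_a_bil u v :
  form_a Omega mu sym (vel u) (vel v) = bil (mxA Omega mu sym S) u v.
Proof.
rewrite bilE /form_a.
rewrite (@int_Omega'_bilinear _ _ (fun i => v i 0) (fun j => u j 0) _
  (fun i j T x => 2 * mu * frob (nabla_s sym (@phi R d S j T) x) (vgrad (phi i T) x))).
- rewrite (@int_Gamma'_bilinear _ _ (fun i => v i 0) (fun j => u j 0) _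
    (fun i j F x n => dotv (2 * mu *: (n *m (nabla_s sym (@phi R d S j F.1) x)^T))
       (vval (phi i F.1) x))).
  + rewrite (@int_Gamma'_bilinear _ _ (fun i => v i 0) (fun j => u j 0) _
      (fun i j F x n => dotv (2 * mu *: (n *m (nabla_s sym (@phi R d S i F.1) x)^T))
         (vextF (Defs.shift S) (phi j F.1) x))).
    * rewrite (@int_Gamma'_bilinear _ _ (fun i => v i 0) (fun j => u j 0) _
        (fun i j F x n => alpha F * dotv (vextF (Defs.shift S) (@phi R d S j F.1) x)
           (vextT (Defs.shift S) (phi i F.1) x))).
      -- rewrite -!sumrB -big_split; apply: eq_bigr => i _.
         rewrite -!sumrB -big_split; apply: eq_bigr => j _ /=.
         by rewrite mxE /form_a -!mulrBr -mulrDr.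
      -- move=> i j F FG; apply: bmeasM; first exact: bmeas_cst.
         by apply: bmeas_dotv => k; [exact: bmeas_vextF|exact: bmeas_vextT].
      -- move=> F x n; rewrite vextF_vel vextT_vel dotv_sum exchange_big mulr_sumr.
         apply: eq_bigr => i _; rewrite mulr_sumr; apply: eq_bigr => j _ /=.
         by rewrite mulrCA [u j 0 * _]mulrC.
    * move=> i j F FG; apply: bmeas_dotv => k; [exact: bmeas_stress|exact: bmeas_vextF].
    * by move=> F x n; rewrite normal_stress_vel vextF_vel dotv_sum.
  + by move=> i j F FG; apply: bmeas_dotv => k; [exact: bmeas_stress|exact: bmeas_vval].
  + move=> F x n; rewrite normal_stress_vel vval_vel dotv_sum exchange_big.
    by apply: eq_bigr => i _; apply: eq_bigr => j _; rewrite [u j 0 * _]mulrC.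
- move=> i j T; apply: bmeasM; first exact: bmeas_cst.
  have bx k : bmeas (elem T) (fun x => x 0 k) by apply: bmeas_coord; exact: bounded_mset_elem.
  apply: bmeas_sum => k _; apply: bmeas_sum => l _.
  by apply: bmeasM; [exact: bmeas_nabla_s|exact: bmeas_vgrad].
- move=> T x; rewrite nabla_s_vel vgrad_vel frob_sum exchange_big mulr_sumr.
  apply: eq_bigr => i _; rewrite mulr_sumr; apply: eq_bigr => j _ /=.
  by rewrite mulrCA [u j 0 * _]mulrC.
Qed.

Lemma bmeas_pval_facet F p : bmeas Q (fun y => pval p (facet_param F y)).
Proof. by apply: bmeas_pval_comp => k; exact: bmeas_param. Qed.

Let div_bilinear (v : 'cV[R]_(nV S)) (q : 'cV[R]_(nQ S)) :
  int_Omega' Omega (fun T x => vdiv (vel v T) x * pval (pres q T) x) =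
  \sum_i \sum_j q i 0 * v j 0 *
    int_Omega' Omega (fun T x => vdiv (@phi R d S j T) x * pval (psi i T) x).
Proof.
apply: int_Omega'_bilinear => [i j T|T x].
  apply: bmeasM; last by apply: bmeas_pval; exact: bounded_mset_elem.
  have bx k : bmeas (elem T) (fun x => x 0 k) by apply: bmeas_coord; exact: bounded_mset_elem.
  by apply: bmeas_sum => k _; exact: bmeas_vgrad.
rewrite vdiv_vel pval_pres mulrC big_distrl; apply: eq_bigr => i _ /=.
by rewrite big_distrr; apply: eq_bigr => j _ /=; rewrite [vdiv _ _ * _]mulrC mulrACA.
Qed.

Lemma form_b1_bil v q :
  form_b1 Omega (vel v) (pres q) = bil (mxB1 Omega S) v q.
Proof.
rewrite bilE /form_b1 div_bilinear (@int_Gamma'_bilinear _ _ (fun i => q i 0)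
  (fun j => v j 0) _ (fun i j F x n => dotv n (vval (@phi R d S j F.1) x) * pval (psi i F.1) x)).
- rewrite -sumrN -big_split; apply: eq_bigr => i _.
  rewrite -sumrN -big_split; apply: eq_bigr => j _ /=.
  by rewrite mxE /form_b1 mulrDr mulrN.
- move=> i j F FG; apply: bmeasM; last exact: bmeas_pval_facet.
  by apply: bmeas_dotv => k; [exact: bmeas_normal|exact: bmeas_vval].
- move=> F x n; rewrite vval_vel pval_pres dotv_sum1 mulrC big_distrl; apply: eq_bigr => i _ /=.
  by rewrite big_distrr; apply: eq_bigr => j _ /=; rewrite [dotv _ _ * _]mulrC mulrACA.
Qed.

Lemma form_b2_bil v q :
  form_b2 Omega (vel v) (pres q) = bil (mxB2 Omega S) v q.
Proof.
rewrite bilE /form_b2 div_bilinear (@int_Gamma'_bilinear _ _ (fun i => q i 0)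
  (fun j => v j 0) _ (fun i j F x n =>
    dotv n (vextF (Defs.shift S) (@phi R d S j F.1) x) * pval (psi i F.1) x)).
- rewrite -sumrN -big_split; apply: eq_bigr => i _.
  rewrite -sumrN -big_split; apply: eq_bigr => j _ /=.
  by rewrite mxE /form_b2 mulrDr mulrN.
- move=> i j F FG; apply: bmeasM; last exact: bmeas_pval_facet.
  by apply: bmeas_dotv => k; [exact: bmeas_normal|exact: bmeas_vextF].
- move=> F x n; rewrite vextF_vel pval_pres dotv_sum1 mulrC big_distrl; apply: eq_bigr => i _ /=.
  by rewrite big_distrr; apply: eq_bigr => j _ /=; rewrite [dotv _ _ * _]mulrC mulrACA.
Qed.

Lemma ipQ_bil p q : ipQ Omega mu (pres p) (pres q) = bil (mxM Omega mu S) p q.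
Proof.
rewrite bilE /ipQ (@int_Omega'_bilinear _ _ (fun i => q i 0) (fun j => p j 0) _
  (fun i j T x => (pval (@psi R d S j T) x / Num.sqrt (2 * mu)) *
                  (pval (psi i T) x / Num.sqrt (2 * mu)))).
- by apply: eq_bigr => i _; apply: eq_bigr => j _; rewrite mxE.
- by move=> i j T; apply: bmeasM; apply: bmeasM; (try exact: bmeas_cst);
    apply: bmeas_pval; exact: bounded_mset_elem.
- move=> T x; rewrite !pval_pres mulrC.
  rewrite !big_distrl/=; apply: eq_bigr => i _ /=.
  by rewrite big_distrr; apply: eq_bigr => j _ /=; ring.
Qed.

Lemma mxM_sym : (mxM Omega mu S)^T = mxM Omega mu S.
Proof.
apply/matrixP => i j; rewrite !mxE; apply: eq_bigr => T _; apply: eq_int_on => x _.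
by rewrite mulrC.
Qed.

(** The volume terms cancel, which leaves the extension error of the velocity. *)
Lemma form_b_diff (v : cell S -> 'I_d -> mpoly.mpoly d R) q :
  form_b2 Omega v q - form_b1 Omega v q = \sum_(F in gamma' S) int_on Q (fun y =>
    dotv (mfacet_normal (vertex F.1) F.2.1 F.2.2 y)
      (vextF (Defs.shift S) (v F.1) (facet_param F y) - vval (v F.1) (facet_param F y)) *
    pval (q F.1) (facet_param F y) * mfacet_area (vertex F.1) F.2.1 F.2.2 y).
Proof.
rewrite /form_b2 /form_b1 opprD addrACA subrr add0r -sumrB; apply: eq_bigr => F FG.
have bQ := bounded_mset_cube R d.-1.
rewrite -int_onB//.
- apply: eq_int_on => y _; rewrite -facet_normalE -facet_areaE -!mulrBl; congr (_ * _ * _).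
  by rewrite /dotv -sumrB; apply: eq_bigr => k _; rewrite -mulrBr;
    congr (_ * _); rewrite [RHS]mxE [X in _ = _ + X]mxE.
- apply: bmeasM; last exact: bmeas_area.
  apply: bmeasM; last exact: bmeas_pval_facet.
  by apply: bmeas_dotv => k; [exact: bmeas_normal|exact: bmeas_vextF].
- apply: bmeasM; last exact: bmeas_area.
  apply: bmeasM; last exact: bmeas_pval_facet.
  by apply: bmeas_dotv => k; [exact: bmeas_normal|exact: bmeas_vval].
Qed.

End DiscreteForms.

(** * The consistency error of the velocity extension on the surrogate boundary *)

(** Only the squares of the a_i are bounded, so that no square roots of X_i and Y_i
    have to be taken. *)
Lemma discrete_cauchy_schwarz (R : realType) (I : Type) (s : seq I) (P : pred I)
    (c : R) (a X Y : I -> R) : 0 <= c ->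
  (forall i, P i -> [/\ 0 <= X i, 0 <= Y i & a i ^+ 2 <= c * X i * Y i]) ->
  (\sum_(i <- s | P i) a i) ^+ 2 <=
  c * (\sum_(i <- s | P i) X i) * (\sum_(i <- s | P i) Y i).
Proof.
move=> c0 aP.
suff [] : [/\ 0 <= \sum_(i <- s | P i) X i, 0 <= \sum_(i <- s | P i) Y i &
  (\sum_(i <- s | P i) a i) ^+ 2 <= c * (\sum_(i <- s | P i) X i) * (\sum_(i <- s | P i) Y i)] by [].
elim: s => [|i s [X0 Y0 IH]]; first by rewrite !big_nil expr0n/= !mulr0 !lexx.
rewrite !big_cons; case: ifP => // Pi; have [Xi Yi ai] := aP i Pi.
set A := \sum_(j <- s | P j) a j in IH *; set XX := \sum_(j <- s | P j) X j in X0 IH *.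
set YY := \sum_(j <- s | P j) Y j in Y0 IH *.
split; [by rewrite addr_ge0..|].
have cr0 : 0 <= c * (X i * YY + XX * Y i) by rewrite mulr_ge0// addr_ge0// mulr_ge0.
have cross : 2 * (a i * A) <= c * (X i * YY + XX * Y i).
  rewrite (le_trans (ler_norm _))// -ler_sqr ?nnegrE// sqr_normr.
  rewrite (_ : _ ^+ 2 = 4 * (a i ^+ 2 * A ^+ 2)); last by ring.
  apply: (@le_trans _ _ (4 * ((c * X i * Y i) * (c * XX * YY)))).
    by rewrite ler_wpM2l// ler_pM// sqr_ge0.
  by have := sqr_ge0 (c * (X i * YY - XX * Y i)); lra.
by rewrite sqrrD; move: ai IH cross; rewrite -[X in _ + X + _]mulr_natl; lra.
Qed.

Section Frobenius.
Context (R : realType) (n : nat).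

Lemma frob_sym_le (A : 'M[R]_n) :
  frob (2^-1 *: (A + A^T)) (2^-1 *: (A + A^T)) <= frob A A.
Proof.
have tr : frob A A = \sum_i \sum_j A j i * A j i by rewrite /frob exchange_big.
have -> : frob A A = 2^-1 * (frob A A + frob A A) by field.
rewrite [X in _ <= _ * (_ + X)]tr -big_split mulr_sumr; apply: ler_sum => i _.
rewrite -big_split mulr_sumr; apply: ler_sum => j _ /=.
by rewrite !mxE; have := sqr_ge0 (A i j - A j i); lra.
Qed.

End Frobenius.

Section MeshFamily.
Context (R : realType) (d : nat) (Omega : set 'rV[R]_d).

Lemma coord_bounded_bigcup (I : finType) (D : set I) (X : I -> set 'rV[R]_d) :
  (forall i, coord_bounded (X i)) -> coord_bounded (\bigcup_(i in D) X i).
Proof.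
move=> bX; have [B HB] := choice bX.
exists (\sum_i `|B i|) => x [i _ Xx] j.
rewrite (le_trans (HB i x Xx j))// (le_trans (ler_norm _))//.
by rewrite (bigD1 i)//= lerDl sumr_ge0.
Qed.

Lemma surrogate_coord_bounded (S : sbm R d) : coord_bounded (surrogate Omega S).
Proof. by apply: coord_bounded_bigcup => T; exact: mel_bounded. Qed.

Lemma diam_elem_le (S : sbm R d) (T : cell S) : diam_elem T <= meshsize S.
Proof. exact: le_bigmax. Qed.

(** On fine meshes the surrogate domain does not degenerate: a fixed ball in
    Omega is covered by elements, and those near its centre are active. *)
Lemma surrogate_wide : (0 < d)%N -> open Omega -> Omega !=set0 ->
  exists w : R, 0 < w /\ forall S : sbm R d, Omega `<=` \bigcup_(T : cell S) elem T ->
    meshsize S <= w -> w <= diam (surrogate Omega S).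
Proof.
move=> d0 oO [x0 Ox0].
have /nbhs_ballP[r /= r0 hr] : nbhs x0 Omega by exact: open_nbhs_nbhs.
have inO (x : 'rV[R]_d) : (forall j, `|x0 0 j - x 0 j| < r) -> Omega x.
  by move=> xr; apply: hr; split=> // i j; rewrite /ball/= !ord1; exact: xr.
pose w := r / 4; exists w; split; first by rewrite divr_gt0.
move=> S cover hw.
pose j0 := Ordinal d0.
pose x1 : 'rV[R]_d := x0 + (r / 2) *: delta_mx 0 j0.
have x01 j : `|x0 0 j - x1 0 j| <= r / 2.
  rewrite !mxE eqxx/= opprD addrA subrr add0r normrN.
  case: eqP => _; rewrite ?mulr1 ?mulr0 ?normr0 ?ger0_norm//; nra.
have act T z : elem T z -> (forall j, `|x0 0 j - z 0 j| <= r / 2) -> @active R d Omega S T.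
  move=> Tz xz; apply/asboolP => y /interior_subset Ty; apply: inO => j.
  have := mel_close j Tz Ty; have := diam_elem_le T; rewrite /diam_elem => h1 h2.
  have -> : x0 0 j - y 0 j = (x0 0 j - z 0 j) + (z 0 j - y 0 j) by ring.
  rewrite (le_lt_trans (ler_normD _ _))//; have := xz j.
  by move: h1 h2 hw; rewrite /elem /refmap /mel /w; lra.
have [T0 _ T0x] := cover x0 Ox0.
have Ox1 : Omega x1.
  by apply: inO => j; rewrite (le_lt_trans (x01 j))//; lra.
have [T1 _ T1x] := cover x1 Ox1.
have S0 : surrogate Omega S x0.
  by exists T0 => //=; apply: (act _ x0) => // j; rewrite subrr normr0 divr_ge0// ltW.
have S1 : surrogate Omega S x1 by exists T1 => //=; apply: (act _ x1).
apply: le_trans (enorm_le_diam (@surrogate_coord_bounded S) S0 S1).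
apply: le_trans (coord_le_enorm _ j0).
rewrite !mxE !eqxx/= mulr1 opprD addrA subrr add0r normrN ger0_norm /w; nra.
Qed.

End MeshFamily.

Section Consistency.
Context (R : realType) (d : nat) (Omega GammaD : set 'rV[R]_d) (mu : R) (sym : bool).
Context (sigma cl Cl cd zeta : R) (kV kQ : nat).
Hypotheses (d23 : d = 2%N \/ d = 3%N) (mu0 : 0 < mu) (sigma0 : 0 < sigma).
Hypotheses (cl0 : 0 < cl) (cd0 : 0 < cd) (zeta0 : 0 < zeta).

Let d0 : (0 < d)%N. Proof. by case: d23 => ->. Qed.
Let mu20 : 0 < 2 * mu. Proof. by rewrite mulr_gt0. Qed.

Section OneMesh.
Variable S : sbm R d.
Hypotheses (regular : shape_regular S sigma).
Hypothesis sboundary : surrogate_boundary Omega S GammaD.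
Hypothesis resolution : geometric_resolution S cd zeta.
Hypothesis anorm : energy_norm Omega mu sym S.
Implicit Types (F : cell S * ('I_d * bool)) (T : cell S).
Local Notation Q := (@cube R d.-1).

(** An element has 2 d facets. *)
Lemma sum_facet_le (E : cell S -> R) : (forall T, 0 <= E T) ->
  \sum_(F in gamma' S) E F.1 <= (2 * d)%:R * \sum_(T | active Omega T) E T.
Proof.
move=> E0; apply: (@le_trans _ _ (\sum_(F : cell S * ('I_d * bool) | active Omega F.1) E F.1)).
  rewrite [leLHS]big_mkcond [leRHS]big_mkcond; apply: ler_sum => F _.
  case: ifP => [FG|_]; last by case: ifP.
  by have [-> _ _ _] := sboundary FG.
have -> : \sum_(F : cell S * ('I_d * bool) | active Omega F.1) E F.1 =
    \sum_(T | active Omega T) \sum_(p : 'I_d * bool) E T.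
  by rewrite pair_big; apply: eq_bigl => F; rewrite andbT.
rewrite mulr_sumr.
apply: ler_sum => T _.
by rewrite sumr_const card_prod card_ord card_bool -[leLHS]mulr_natl [(d * 2)%N]mulnC.
Qed.

Let trace F (v : cell S -> 'I_d -> mpoly.mpoly d R) := int_on Q (fun y =>
  dotv (vextT (Defs.shift S) (v F.1) (facet_param F y))
       (vextT (Defs.shift S) (v F.1) (facet_param F y)) *
  mfacet_area (vertex F.1) F.2.1 F.2.2 y).

Let strainE T (v : cell S -> 'I_d -> mpoly.mpoly d R) :=
  int_on (elem T) (fun x => frob (vsymgrad (v T) x) (vsymgrad (v T) x)).

Let trace_ge0 F v : 0 <= trace F v.
Proof. by apply: int_on_ge0 => y _; rewrite mulr_ge0 ?dotv_ge0 ?mfacet_area_ge0. Qed.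

Let strain_ge0 T v : 0 <= strainE T v.
Proof. by apply: int_on_ge0 => y _; exact: frob_ge0. Qed.

Lemma norma_ge0 (v : 'cV[R]_(nV S)) : 0 <= norma v.
Proof. by have [_ _ _ /(_ v)] := anorm; apply: le_trans; exact: sqrtr_ge0. Qed.

Lemma trace_le_norma (v : 'cV[R]_(nV S)) :
  2 * mu * \sum_(F in gamma' S) (diam_elem F.1)^-1 * trace F (vel v) <= norma v ^+ 2.
Proof.
have [_ _ _ /(_ v) tv] := anorm.
have bQ := bounded_mset_cube R d.-1.
apply: (@le_trans _ _ (taylor_trace mu (vel v) ^+ 2)); last first.
  by rewrite ler_sqr ?nnegrE ?norma_ge0 ?sqrtr_ge0.
have e : 2 * mu * (\sum_(F in gamma' S) (diam_elem F.1)^-1 * trace F (vel v)) =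
    int_Gamma' (fun F x _ => let w := Num.sqrt (2 * mu / diam_elem F.1) *:
      vextT (Defs.shift S) (vel v F.1) x in dotv w w).
  rewrite /int_Gamma' mulr_sumr; apply: eq_bigr => F FG.
  rewrite mulrA /trace -int_onZ//.
    apply: eq_int_on => y _; rewrite -facet_areaE mulrA; congr (_ * _).
    rewrite [RHS]dotvZ sqr_sqrtr//.
    by rewrite divr_ge0 ?(ltW mu20)//; exact: (ltW (diam_elem_gt0 d0 regular _)).
  apply: bmeasM; last exact: bmeas_facet_area.
  by apply: bmeas_dotv => k; exact: (bmeas_vextT sboundary resolution).
rewrite /taylor_trace -e sqr_sqrtr// mulr_ge0 ?(ltW mu20)// sumr_ge0// => F _.
by rewrite mulr_ge0// invr_ge0 ltW// (diam_elem_gt0 d0 regular).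
Qed.

Lemma strain_le_norma (v : 'cV[R]_(nV S)) :
  2 * mu * \sum_(T | active Omega T) strainE T (vel v) <= norma v ^+ 2.
Proof.
have [_ _ /(_ v) sv _] := anorm.
apply: (@le_trans _ _ (visc_seminorm Omega mu sym (vel v) ^+ 2)); last first.
  by rewrite ler_sqr ?nnegrE ?norma_ge0// mulr_ge0 ?sqrtr_ge0.
rewrite /visc_seminorm exprMn !sqr_sqrtr ?(ltW mu20)//.
  rewrite ler_wpM2l ?(ltW mu20)//; apply: ler_sum => T _.
  case: sym; first exact: lexx.
  have bT := bounded_mset_elem T.
  have bx k : bmeas (elem T) (fun x => x 0 k) by exact: bmeas_coord.
  apply: le_int_on => //; first exact: bmeas_frob_sym.
    apply: bmeas_sum => i _; apply: bmeas_sum => j _.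
    by apply: bmeasM; exact: bmeas_vgrad.
  by move=> x _; exact: frob_sym_le.
by apply: sumr_ge0 => T _; apply: int_on_ge0 => x _; case: sym; exact: frob_ge0.
Qed.

Lemma normQ_sqr (q : cell S -> mpoly.mpoly d R) :
  \sum_(T | active Omega T) int_on (elem T) (fun x => pval (q T) x ^+ 2) =
  2 * mu * normQ Omega mu q ^+ 2.
Proof.
have sm : 0 < Num.sqrt (2 * mu) by rewrite sqrtr_gt0.
rewrite /normQ sqr_sqrtr; last first.
  by apply: sumr_ge0 => T _; apply: int_on_ge0 => x _; rewrite -expr2 sqr_ge0.
rewrite /ipQ /int_Omega' mulr_sumr; apply: eq_bigr => T _.
have bT := bounded_mset_elem T.
rewrite -int_onZ//.
  apply: eq_int_on => x _; rewrite -[X in X * _](sqr_sqrtr (ltW mu20)).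
  by field; rewrite gt_eqF.
by apply: bmeasM; apply: bmeasM; (try exact: bmeas_cst); exact: bmeas_pval.
Qed.

Variables (C t : R).
Hypothesis C0 : 0 < C.
Hypothesis facetwise : forall F, F \in gamma' S ->
  forall (v : 'I_d -> mpoly.mpoly d R) (q : mpoly.mpoly d R),
  (forall j, (mpoly.msize (v j) <= (maxn kV kQ).+2)%N) ->
  (mpoly.msize q <= (maxn kV kQ).+2)%N ->
  int_on Q (fun y =>
     dotv (mfacet_normal (vertex F.1) F.2.1 F.2.2 y)
       (vextF (Defs.shift S) v (facet_param F y) - vval v (facet_param F y)) *
     pval q (facet_param F y) * mfacet_area (vertex F.1) F.2.1 F.2.2 y) ^+ 2 <=
  C * t ^+ 2 *
   ((diam_elem F.1)^-1 * int_on Q (fun y =>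
       dotv (vextT (Defs.shift S) v (facet_param F y))
            (vextT (Defs.shift S) v (facet_param F y)) *
       mfacet_area (vertex F.1) F.2.1 F.2.2 y) +
    int_on (elem F.1) (fun x => frob (vsymgrad v x) (vsymgrad v x))) *
  int_on (elem F.1) (fun x => pval q x ^+ 2).

Hypothesis spaceV : velocity_space Omega S kV.
Hypothesis spaceQ : pressure_space Omega S kQ.

(** The facetwise traces add up to the trace part of the energy norm, and the
    strains to its viscous part, where an element is counted once per facet. *)
Lemma consistency_sum (v : 'cV[R]_(nV S)) (q : 'cV[R]_(nQ S)) :
  (form_b2 Omega (vel v) (pres q) - form_b1 Omega (vel v) (pres q)) ^+ 2 <=
  C * ((1 + (2 * d)%:R) * (2 * d)%:R) * t ^+ 2 *
  (norma v * normQ Omega mu (pres q)) ^+ 2.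
Proof.
have h0 F := diam_elem_gt0 d0 regular F.1.
have [degV _ _] := spaceV; have [degQ _] := spaceQ.
rewrite (form_b_diff d0 regular sboundary resolution).
pose X F := (diam_elem F.1)^-1 * trace F (vel v) + strainE F.1 (vel v).
pose Y F := int_on (elem F.1) (fun x => pval (pres q F.1) x ^+ 2).
have Ct0 : 0 <= C * t ^+ 2 by rewrite mulr_ge0 ?sqr_ge0 ?(ltW C0).
have Y0 T : 0 <= int_on (elem T) (fun x => pval (pres q T) x ^+ 2).
  by apply: int_on_ge0 => x _; exact: sqr_ge0.
apply: (@le_trans _ _ (C * t ^+ 2 * (\sum_(F in gamma' S) X F) * (\sum_(F in gamma' S) Y F))).
  apply: discrete_cauchy_schwarz => // F FG; split => //.
    by rewrite addr_ge0// mulr_ge0// invr_ge0 ltW.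
    exact: Y0.
  have [aF _ _ _] := sboundary FG.
  apply: (facetwise FG (v := vel v F.1) (q := pres q F.1)).
    move=> j; apply: degle_sum => i _; apply: degleZ.
    by rewrite (leq_trans (degV i F.1 j aF))// !ltnS (leq_trans (leq_maxl kV kQ)).
  apply: degle_sum => i _; apply: degleZ.
  by rewrite (leq_trans (degQ i F.1 aF))// !ltnS (leq_trans (leq_maxr kV kQ)).
have XN : 2 * mu * \sum_(F in gamma' S) X F <= (1 + (2 * d)%:R) * norma v ^+ 2.
  rewrite big_split/= [leLHS]mulrDr [leRHS]mulrDl mul1r lerD ?trace_le_norma//.
  apply: (@le_trans _ _ ((2 * d)%:R * (2 * mu * \sum_(T | active Omega T) strainE T (vel v)))).
    by rewrite mulrCA ler_wpM2l ?(ltW mu20)// sum_facet_le.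
  by rewrite ler_wpM2l// strain_le_norma.
have YN : \sum_(F in gamma' S) Y F <= (2 * d)%:R * (2 * mu * normQ Omega mu (pres q) ^+ 2).
  by rewrite -normQ_sqr; apply: sum_facet_le.
have X0 : 0 <= \sum_(F in gamma' S) X F.
  by apply: sumr_ge0 => F _; rewrite addr_ge0// mulr_ge0// invr_ge0 ltW.
rewrite -mulrA; set x := \sum_(F in _) X F in XN X0 *; set y := \sum_(F in _) Y F in YN *.
have xy : x * y <= (1 + (2 * d)%:R) * (2 * d)%:R * (norma v * normQ Omega mu (pres q)) ^+ 2.
  apply: (@le_trans _ _ (x * ((2 * d)%:R * (2 * mu * normQ Omega mu (pres q) ^+ 2)))).
    by rewrite ler_wpM2l.
  rewrite (_ : x * _ = (2 * mu * x) * ((2 * d)%:R * normQ Omega mu (pres q) ^+ 2)); last by ring.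
  rewrite (_ : _ * (2 * d)%:R * _ = (1 + (2 * d)%:R) * norma v ^+ 2 *
    ((2 * d)%:R * normQ Omega mu (pres q) ^+ 2)); last by ring.
  by rewrite ler_wpM2r// mulr_ge0// sqr_ge0.
by apply: le_trans (ler_wpM2l Ct0 xy) _; rewrite le_eqVlt; apply/orP; left; apply/eqP; ring.
Qed.

End OneMesh.

(** The relative element size tends to zero with the mesh size, because the
    surrogate domain does not degenerate; so does the factor tau of the
    facetwise estimate. *)
Lemma consistency_small (delta : R) : 0 < delta -> open Omega -> Omega !=set0 ->
  exists h0 : R, 0 < h0 /\ forall S : sbm R d,
    background_mesh Omega S sigma -> surrogate_boundary Omega S GammaD ->
    characteristic_length Omega S cl Cl -> velocity_space Omega S kV ->
    pressure_space Omega S kQ -> energy_norm Omega mu sym S ->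
    geometric_resolution S cd zeta -> meshsize S <= h0 ->
    forall (v : 'cV[R]_(nV S)) (q : 'cV[R]_(nQ S)),
    `|form_b2 Omega (vel v) (pres q) - form_b1 Omega (vel v) (pres q)| <=
    delta * (norma v * normQ Omega mu (pres q)).
Proof.
move=> delta0 oO O0; have [w [w0 wide]] := surrogate_wide d0 oO O0.
have [C [eta [C0 eta0 [_ Hc]]]] := @facet_consistency R d (maxn kV kQ) sigma cd d23 sigma0 cd0.
pose K := C * ((1 + (2 * d)%:R) * (2 * d)%:R).
have K0 : 0 <= K by rewrite mulr_ge0 ?(ltW C0).
have K10 : 0 < K + 1 by rewrite ltr_wpDl.
pose t := Num.min eta (delta / (K + 1)).
have t0 : 0 < t by rewrite lt_min eta0 divr_gt0.
have Kt : K * t ^+ 2 <= delta ^+ 2.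
  apply: (@le_trans _ _ (K * (delta / (K + 1)) ^+ 2)).
    by rewrite ler_wpM2l// ler_sqr ?nnegrE ?(ltW t0) ?ge_min ?lexx ?orbT// divr_ge0 ?ltW.
  rewrite expr_div_n mulrA ler_pdivrMr ?exprn_gt0// mulrC ler_wpM2l ?sqr_ge0//.
  by have := sqr_ge0 K; lra.
pose h0 := Num.min w (cl * w * t `^ zeta^-1).
have clw0 : 0 < cl * w by rewrite mulr_gt0.
exists h0; split; first by rewrite lt_min w0 mulr_gt0// powR_gt0.
move=> S [cover _ regular] sb [/andP[clen _] _] sV sQ an res.
rewrite le_min => /andP[hw ht] v q.
have len0 : cl * w <= charlen S.
  by apply: le_trans clen; rewrite ler_wpM2l ?(ltW cl0)// wide.
have len : 0 < charlen S by exact: lt_le_trans len0.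
pose tau (F : cell S * ('I_d * bool)) := (diam_elem F.1 / charlen S) `^ zeta.
have taut F : tau F <= t.
  have -> : t = (t `^ zeta^-1) `^ zeta by rewrite -powRrM mulVf ?gt_eqF// powRr1// ltW.
  apply: ge0_ler_powR; rewrite ?nnegrE ?powR_ge0 ?(ltW zeta0)//.
    by rewrite divr_ge0 ?(ltW len)//; exact: (ltW (diam_elem_gt0 d0 regular _)).
  rewrite ler_pdivrMr//; apply: le_trans (diam_elem_le _) _.
  by apply: le_trans ht _; rewrite mulrC ler_wpM2l// powR_ge0.
have NQ0 : 0 <= norma v * normQ Omega mu (pres q).
  by rewrite mulr_ge0 ?sqrtr_ge0// (norma_ge0 an).
rewrite -ler_sqr ?nnegrE//; last by rewrite mulr_ge0// ltW.
rewrite sqr_normr exprMn.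
apply: (@le_trans _ _ (K * t ^+ 2 * (norma v * normQ Omega mu (pres q)) ^+ 2)); last first.
  by rewrite ler_wpM2r ?sqr_ge0.
apply: (consistency_sum regular sb res an C0 _ sV sQ) => F FG v' q' dv' dq'.
set X := _ + _; set Y := int_on (elem F.1) (fun x => pval q' x ^+ 2).
have X0 : 0 <= X.
  rewrite addr_ge0//.
    rewrite mulr_ge0 ?invr_ge0 ?(ltW (diam_elem_gt0 d0 regular _))//.
    by apply: int_on_ge0 => y _; rewrite mulr_ge0 ?dotv_ge0 ?mfacet_area_ge0.
  by apply: int_on_ge0 => y _; exact: frob_ge0.
have Y0 : 0 <= Y by apply: int_on_ge0 => y _; exact: sqr_ge0.
apply: (@le_trans _ _ (C * tau F ^+ 2 * X * Y)); last first.
  rewrite ler_wpM2r// ler_wpM2r// ler_wpM2l ?(ltW C0)//.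
  by rewrite ler_sqr ?nnegrE ?powR_ge0 ?(ltW t0).
apply: (Hc (vertex F.1) (diam_elem_gt0 d0 regular F.1)) => //.
- by move=> x cx xi; exact: refmap_bound regular _ _ cx xi.
- by rewrite powR_ge0/= (le_trans (taut F))// ge_min lexx.
- by move=> y cy; apply: res => //; exists y.
- by move=> j; exact: (bmeas_shift sb res).
Qed.

End Consistency.

(** * Mesh-independent convergence of the preconditioned iteration *)

Section WellPosed.
Context (R : realType) (d : nat) (Omega GammaD : set 'rV[R]_d) (mu : R) (sym : bool).
Context (S : sbm R d) (Ca CA beta Cb sigma cd zeta : R).
Hypotheses (d0 : (0 < d)%N) (beta0 : 0 < beta).
Hypothesis regular : shape_regular S sigma.
Hypothesis sboundary : surrogate_boundary Omega S GammaD.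
Hypothesis resolution : geometric_resolution S cd zeta.
Hypothesis anorm : energy_norm Omega mu sym S.
Hypothesis wellposed : well_posed Omega mu sym S Ca CA beta Cb.
Implicit Types (v : 'cV[R]_(nV S)) (q : 'cV[R]_(nQ S)).

Lemma norma_gt0 v : v != 0 -> 0 < norma v.
Proof.
move=> v0; rewrite lt_neqAle (norma_ge0 anorm) andbT eq_sym.
by have [[_ _ /(_ v) h] _ _ _] := anorm; apply: contra v0 => /eqP/h ->.
Qed.

Let sup_le q c : q != 0 ->
  (forall v, v != 0 ->
     form_b2 Omega (vel v) (pres q) / (norma v * normQ Omega mu (pres q)) <= c) ->
  beta <= c.
Proof.
move=> q0 hc; have [_ _ isup _] := wellposed.
rewrite -lee_fin; apply: le_trans isup _.
apply: le_trans (ereal_inf_lbound _) _; first by exists q.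
by apply: ge_ereal_sup => _ [v v0 <-]; rewrite lee_fin; exact: hc.
Qed.

(** A pressure of zero norm would make every quotient of the inf-sup condition
    zero, by the convention x / 0 = 0. *)
Lemma normQ_gt0 q : q != 0 -> 0 < normQ Omega mu (pres q).
Proof.
move=> q0; rewrite lt_neqAle sqrtr_ge0 andbT eq_sym; apply/eqP => Q0.
have : beta <= 0 by apply: (sup_le q0) => v _; rewrite Q0 mulr0 invr0 mulr0.
by rewrite leNgt beta0.
Qed.

Lemma infsup_le q t : 0 <= t ->
  (forall v, form_b2 Omega (vel v) (pres q) <= t * norma v) ->
  beta * normQ Omega mu (pres q) <= t.
Proof.
move=> t0 ht; have [->|q0] := eqVneq q 0.
  by rewrite /normQ ipQ_bil /bil mulmx0 mxE sqrtr0 mulr0.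
have Q0 := normQ_gt0 q0.
rewrite -ler_pdivlMr//; apply: (sup_le q0) => v /norma_gt0 v0.
rewrite ler_pdivrMr ?mulr_gt0// (le_trans (ht v))//.
by rewrite [norma v * _]mulrC mulrA divfK ?gt_eqF.
Qed.

Lemma mxM_posdef : posdef (mxM Omega mu S).
Proof.
by move=> q /normQ_gt0; rewrite /normQ sqrtr_gt0 ipQ_bil.
Qed.

End WellPosed.

Theorem theorem1 (R : realType) (Ca CA beta Cb : R)
    (Ca_gt0 : 0 < Ca) (CA_gt0 : 0 < CA) (beta_gt0 : 0 < beta) (Cb_gt0 : 0 < Cb) :
  exists g G : R, 0 < g <= G /\
  forall (d : nat) (d23 : d = 2%N \/ d = 3%N)
    (Omega GammaD : set 'rV[R]_d)
    (Omega_open : open Omega) (Omega_connected : connected Omega)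
    (Omega_neq0 : Omega !=set0) (Omega_bounded : bounded_set Omega)
    (GammaD_sub : GammaD `<=` bdry Omega)
    (mu : R) (mu_gt0 : 0 < mu) (sym : bool)
    (I : Type) (S : I -> sbm R d)
    (sigma cl Cl cd zeta calpha : R) (kV kQ : nat)
    (sigma_gt0 : 0 < sigma) (cl_gt0 : 0 < cl) (Cl_gt0 : 0 < Cl)
    (cd_gt0 : 0 < cd) (zeta_gt0 : 0 < zeta) (calpha_gt0 : 0 < calpha)
    (mesh : forall i, background_mesh Omega (S i) sigma)
    (sboundary : forall i, surrogate_boundary Omega (S i) GammaD)
    (clength : forall i, characteristic_length Omega (S i) cl Cl)
    (alpha_gt0 : forall i F, F \in gamma' (S i) -> 0 < alpha F)
    (spaceV : forall i, velocity_space Omega (S i) kV)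
    (spaceQ : forall i, pressure_space Omega (S i) kQ)
    (anorm : forall i, energy_norm Omega mu sym (S i))
    (wellposed : forall i, well_posed Omega mu sym (S i) Ca CA beta Cb)
    (resolution : forall i, geometric_resolution (S i) cd zeta)
    (penalty : forall i, penalty_scaling mu (S i) calpha),
  exists h0 : R, 0 < h0 /\
  forall i, meshsize (S i) <= h0 ->
    let P := precond_mx Omega mu sym (S i) in
    let K := saddle_mx Omega mu sym (S i) *m invmx P in
    let H := weight_mx Omega mu sym (S i) in
    [/\ P \in unitmx,
        forall y, y != 0 -> g <= ipH H (K *m y) y / ipH H y y,
        forall y, y != 0 -> normH H (K *m y) <= G * normH H y
      & forall (b y0 : 'cV[R]_(nV (S i) + nQ (S i)))
               (y : nat -> 'cV[R]_(nV (S i) + nQ (S i))),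
          (forall k, gmres_iterate H K b y0 k (y k)) ->
          forall k, normH H (b - K *m y k.+1) <=
                    Num.sqrt (1 - g ^+ 2 / G ^+ 2) * normH H (b - K *m y k)].
Proof.
pose g := fov_lower Ca CA beta; pose G := fov_upper Ca Cb.
have g0 : 0 < g by rewrite lt_min invr_gt0 ltr0n/= divr_gt0 ?mulr_gt0 ?exprn_gt0.
have gG : g <= G.
  apply: (@le_trans _ _ 1).
    by rewrite /g /fov_lower ge_min invf_le1 ?ler1n// ltr0n.
  rewrite /G /fov_upper -addrA lerDl addr_ge0// divr_ge0 ?mulr_ge0 ?exprn_ge0 ?(ltW Cb_gt0) ?(ltW Ca_gt0)//.
exists g, G; split; first by rewrite g0.
move=> d d23 Omega GammaD oO _ O0 _ _ mu mu0 sym I S sigma cl Cl cd zeta _ kV kQ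
  sigma0 cl0 _ cd0 zeta0 _ mesh sb clen _ sV sQ an wp res _.
(* the discrepancy of b1 and b2 that saddle_fov tolerates *)
have delta0 : 0 < beta * Ca / (4 * CA) by rewrite divr_gt0 ?mulr_gt0.
have [h0 [h00 small]] := @consistency_small R d Omega GammaD mu sym sigma cl Cl cd zeta
  kV kQ d23 mu0 sigma0 cl0 cd0 zeta0 _ delta0 oO O0.
exists h0; split => // i hi.
have {}small := small _ (mesh i) (sb i) (clen i) (sV i) (sQ i) (an i) (res i) hi.
have [_ _ regular] := mesh i.
have d0 : (0 < d)%N by case: d23 => ->.
have [coer cont isup bcont] := wp i.
have aE := form_a_bil mu sym d0 regular (sb i) (res i).
have b1E := form_b1_bil Omega d0 regular.
have b2E := form_b2_bil d0 regular (sb i) (res i).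
have QE q : normQ Omega mu (pres q) = Num.sqrt (bil (mxM Omega mu (S i)) q q).
  by rewrite /normQ ipQ_bil.
have N0 := norma_ge0 (an i).
have NP := norma_gt0 (an i).
have [[ND _ _] _ _ _] := an i.
have Ac v : Ca * norma v ^+ 2 <= bil (mxA Omega mu sym (S i)) v v by rewrite -aE.
have AC u v : bil (mxA Omega mu sym (S i)) u v <= CA * norma u * norma v.
  by rewrite -aE (le_trans (ler_norm _)).
have Ms := mxM_sym Omega mu (S i).
have Mp := mxM_posdef beta_gt0 (wp i).
have isb q t : 0 <= t -> (forall v, bil (mxB2 Omega (S i)) v q <= t * norma v) ->
    beta * Num.sqrt (bil (mxM Omega mu (S i)) q q) <= t.
  move=> t0 ht; rewrite -QE; apply: (infsup_le beta_gt0 (an i) (wp i)) => // v.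
  by rewrite b2E.
have B1c v q : bil (mxB1 Omega (S i)) v q <=
    Cb * norma v * Num.sqrt (bil (mxM Omega mu (S i)) q q).
  by rewrite -b1E -QE (le_trans (ler_norm _))//; have [] := bcont v q.
have B2c v q : bil (mxB2 Omega (S i)) v q <=
    Cb * norma v * Num.sqrt (bil (mxM Omega mu (S i)) q q).
  by rewrite -b2E -QE (le_trans (ler_norm _))//; have [] := bcont v q.
have B12 v q : bil (mxB1 Omega (S i)) v q - bil (mxB2 Omega (S i)) v q >=
    - (beta * Ca / (4 * CA)) * norma v * Num.sqrt (bil (mxM Omega mu (S i)) q q).
  rewrite -b1E -b2E -QE -mulrA mulNr lerNl opprB (le_trans (ler_norm _))//.
have Pu := saddle_precond_unit (mxB1 Omega (S i)) Ca_gt0 NP Ac Mp.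
have fov := saddle_fov Ca_gt0 CA_gt0 beta_gt0 N0 NP Ac AC Ms Mp isb B12.
have bdd := saddle_bounded Ca_gt0 Cb_gt0 N0 NP ND Ac Ms Mp B1c B2c.
have Hp := saddle_ipH_gt0 Ca_gt0 NP Ac Ms Mp.
move=> P K H; split => //.
- by move=> y y0; rewrite ler_pdivlMr; [exact: fov|exact: Hp].
- move=> b y0 y hy k; apply: (gmres_contraction g0 gG _ Hp fov bdd hy).
  rewrite /H /weight_mx tr_block_mx !trmx0 !trmx_inv Ms.
  by rewrite /mxAs linearZ/= linearD/= trmxK [_^T + _]addrC.
Qed.
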